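(* Let $N\ge3$, let $\Omega\subset\mathbb{R}^N$ be a bounded and smooth domain, put $2^*=\frac{2N}{N-2}$, and let $M(s^2)=s^{r-2}$. For $a>0$ and exponents $1<q<\varpi<2$ consider the nonlocal problem $$(P_a)\qquad -M(\|u\|_W^2)\Delta u=-au^{q-1}+u^{\varpi-1}\ \text{ in }\Omega,\qquad u=0\ \text{ on }\partial\Omega.$$ If $r\in(2+\frac2N,2^* )$, then, for suitable exponents $1<q<\varpi<2$, there exists a family of functions, each of which satisfies $(P_a)$ for some $a\in(0,1]$, which is bounded in $L^\infty$ but unbounded in $\mathcal{C}^1$. In the limiting case $r=2^*$, for suitable exponents $1<q<\varpi<2$, a family of functions bounded in $L^\infty$ but unbounded in $\mathcal{C}^1$ exists, all satisfying $(P_a)$ with one fixed $a>0$.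
   Context: $\|u\|_W=\left(\int_\Omega|\nabla u|^2\right)^{1/2}$ is the norm of $H_0^1(\Omega)=W_0^{1,2}(\Omega)$. Functions satisfying $(P_a)$ are nonnegative (so that the powers $u^{q-1}$, $u^{\varpi-1}$ make sense) nontrivial weak solutions in $H_0^1(\Omega)$. The exponents $q,\varpi$ are the same for all members of the family. *)

(* Defs.v *)
From HB Require Import structures.
From mathcomp Require Import all_boot all_order all_algebra.
From mathcomp Require Import all_classical all_reals all_analysis.

Set Implicit Arguments.
Unset Strict Implicit.
Unset Printing Implicit Defensive.

Import Order.TTheory GRing.Theory Num.Theory.
Import numFieldNormedType.Exports.

Local Open Scope classical_set_scope.
Local Open Scope ring_scope.

(* The sigma-algebra on R^n generated by the coordinates, i.e. the product of
   the Borel sigma-algebras, which is the Borel one. *)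
Fact rV_display : measure_display. Proof. exact: default_measure_display. Qed.

Section measurable_rV.
Context {R : realType} {n : nat}.

Definition rV_coord (i : 'I_n) (x : 'rV[R]_n) : R := x ord0 i.

Let rV_set0 : g_sigma_preimage rV_coord set0.
Proof. exact: sigma_algebra0. Qed.

Let rV_setC A : g_sigma_preimage rV_coord A -> g_sigma_preimage rV_coord (~` A).
Proof. exact: sigma_algebraC. Qed.

Let rV_bigcup (F : (set 'rV[R]_n)^nat) :
  (forall i, g_sigma_preimage rV_coord (F i)) ->
  g_sigma_preimage rV_coord (\bigcup_i F i).
Proof. exact: sigma_algebra_bigcup. Qed.

HB.instance Definition _ := @isMeasurable.Build rV_display 'rV[R]_n
  (g_sigma_preimage rV_coord) rV_set0 rV_setC rV_bigcup.

Lemma measurable_rV_coord (i : 'I_n) : measurable_fun [set: 'rV[R]_n] (rV_coord i).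
Proof.
move=> _ Y mY; rewrite setTI; apply: sub_sigma_algebra => /=.
rewrite -bigcup_seq/=; exists i => /=; first by rewrite mem_index_enum.
by exists Y => //; rewrite setTI.
Qed.

Lemma measurable_fun_rVP d (T : measurableType d) (f : T -> 'rV[R]_n) :
  (forall i, measurable_fun [set: T] (rV_coord i \o f)) ->
  measurable_fun [set: T] f.
Proof.
move=> mf.
have H : g_sigma_preimage (fun i => rV_coord i \o f) `<=` measurable.
  apply: smallest_sub; first exact: sigma_algebra_measurable.
  rewrite -bigcup_seq; apply: bigcup_sub => i _ A [B mB <-]; exact: mf.
move=> _ A mA; apply: H; rewrite g_sigma_preimage_comp.
by exists A.
Qed.
End measurable_rV.

Lemma sigma_finite_prod d1 d2 (T1 : measurableType d1) (T2 : measurableType d2)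
    (R : realType) (m1 : {sigma_finite_measure set T1 -> \bar R})
    (m2 : {sigma_finite_measure set T2 -> \bar R}) :
  sigma_finite setT (m1 \x m2)%E.
Proof.
have /sigma_finiteP[F [TF ndF Foo]] := sigma_finiteT m1.
have /sigma_finiteP[G [TG ndG Goo]] := sigma_finiteT m2.
exists (fun k => F k `*` G k).
  rewrite -setXTT TF TG predeqE => -[x y]; split.
    move=> [/= [k _ Fkx] [l _ Gly]]; exists (maxn k l) => //; split.
    - by move: x Fkx; exact/subsetPset/ndF/leq_maxl.
    - by move: y Gly; exact/subsetPset/ndG/leq_maxr.
  by move=> [k _ []/= ? ?]; split; exists k.
move=> k; have [? ?] := Foo k; have [? ?] := Goo k.
split; first exact: measurableX.
by rewrite product_measure1E// lte_mul_pinfty// ge0_fin_numE.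
Qed.

Section lebesgue_step.
Context {R : realType} {n : nat}.

Definition rV_cons (p : measurableTypeR R * 'rV[R]_n) : 'rV[R]_n.+1 :=
  row_mx (p.1)%:M p.2.

Definition rV_uncons (x : 'rV[R]_n.+1) : measurableTypeR R * 'rV[R]_n :=
  (x ord0 ord0, @rsubmx R 1 1 n x).

Lemma rV_consK : cancel rV_cons rV_uncons.
Proof.
move=> [x v]; rewrite /rV_uncons /rV_cons/= row_mxKr; congr pair.
rewrite (_ : ord0 = @lshift 1 n ord0); last exact/val_inj.
by rewrite (@row_mxEl R 1 1 n) mxE eqxx.
Qed.

Lemma measurable_rV_cons : measurable_fun setT rV_cons.
Proof.
apply: measurable_fun_rVP => i; rewrite /comp /rV_coord /rV_cons.
case: (@split_ordP 1 n i) => j ->.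
- rewrite (_ : (fun _ => _) = fst); first exact: measurable_fst.
  by apply/funext => p; rewrite (@row_mxEl R 1 1 n) mxE !ord1 eqxx.
- rewrite (_ : (fun _ => _) = rV_coord j \o snd).
    by apply: measurableT_comp => //; exact: measurable_rV_coord.
  by apply/funext => p; rewrite (@row_mxEr R 1 1 n).
Qed.

Lemma measurable_rV_uncons : measurable_fun setT rV_uncons.
Proof.
apply/measurable_fun_pairP; split; first exact: (measurable_rV_coord ord0).
apply: measurable_fun_rVP => i.
rewrite (_ : _ \o _ = @rV_coord R n.+1 (rshift 1 i)).
  exact: measurable_rV_coord.
by apply/funext => x; rewrite /rV_coord/= mxE.
Qed.

Variable mu : {sigma_finite_measure set 'rV[R]_n -> \bar R}.

Definition lebesgue_step : set 'rV[R]_n.+1 -> \bar R :=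
  pushforward (lebesgue_measure \x mu)%E rV_cons.

Let m_cons A : measurable A -> measurable (rV_cons @^-1` A).
Proof. by move=> mA; rewrite -[X in measurable X]setTI; exact: measurable_rV_cons. Qed.

Let step0 : lebesgue_step set0 = 0%E.
Proof. by rewrite /lebesgue_step /pushforward preimage_set0 measure0. Qed.

Let step_ge0 A : (0 <= lebesgue_step A)%E.
Proof. by rewrite /lebesgue_step /pushforward. Qed.

Let step_sigma_additive : semi_sigma_additive lebesgue_step.
Proof.
move=> F mF tF mUF; rewrite /lebesgue_step /pushforward preimage_bigcup.
apply: measure_semi_sigma_additive.
- by move=> k; exact: m_cons.
- apply/trivIsetP => /= i j _ _ ij; rewrite -preimage_setI.
  by move/trivIsetP : tF => /(_ _ _ _ _ ij) ->//; rewrite preimage_set0.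
- by rewrite -preimage_bigcup; exact: m_cons.
Qed.

HB.instance Definition _ := isMeasure.Build _ _ _ lebesgue_step
  step0 step_ge0 step_sigma_additive.

Let step_sigma_finite : sigma_finite setT lebesgue_step.
Proof.
have [F FT Foo] := sigma_finite_prod lebesgue_measure mu.
exists (fun k => rV_uncons @^-1` F k).
  by rewrite -preimage_bigcup -FT preimage_setT.
move=> k; have [mF Fk] := Foo k; split.
  by rewrite -[X in measurable X]setTI; exact: measurable_rV_uncons.
rewrite /lebesgue_step /pushforward -comp_preimage.
by rewrite (_ : rV_uncons \o rV_cons = id)//; apply/funext => p; exact: rV_consK.
Qed.

HB.instance Definition _ := Measure_isSigmaFinite.Build _ _ _ lebesgue_step
  step_sigma_finite.
End lebesgue_step.

(* The n-dimensional Lebesgue measure, as an n-fold product of the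
   one-dimensional one. *)
Fixpoint lebesgue_rV (R : realType) (n : nat) :
    {sigma_finite_measure set 'rV[R]_n -> \bar R} :=
  if n is n'.+1 then lebesgue_step (lebesgue_rV R n') else \d_(0 : 'rV[R]_0).

Definition partial {R : realType} {n : nat} (i : 'I_n) (f : 'rV[R]_n -> R) :
    'rV[R]_n -> R :=
  'D_(delta_mx ord0 i) f.

Definition iter_partial {R : realType} {n : nat} (s : seq 'I_n)
    (f : 'rV[R]_n -> R) : 'rV[R]_n -> R :=
  foldr partial f s.

(* f is of class C^infinity on R^n *)
Definition smooth {R : realType} {n : nat} (f : 'rV[R]_n -> R) :=
  forall (s : seq 'I_n) (x : 'rV[R]_n),
    {for x, continuous (iter_partial s f)} /\
    forall i, derivable (iter_partial s f) x (delta_mx ord0 i).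

(* Near each of its boundary points Omega lies, up to relabeling and reflecting
   the axes, strictly above the graph of a C^infinity function of the N - 1
   other coordinates; [col' i x] is x with its i-th coordinate removed. *)
Definition smooth_boundary {R : realType} {N : nat} (Omega : set 'rV[R]_N) :=
  forall x0, (closure Omega `\` Omega°) x0 ->
  exists (i : 'I_N) (b : bool) (gamma : 'rV[R]_N.-1 -> R) (e : R),
    [/\ smooth gamma, 0 < e &
        forall x, ball x0 e x ->
          (Omega x <-> 0 < (-1) ^+ b * (x ord0 i - gamma (col' i x)))].

Definition bounded_smooth_domain {R : realType} {N : nat}
    (Omega : set 'rV[R]_N) :=
  [/\ open Omega, connected Omega, Omega !=set0, bounded_set Omega &
      smooth_boundary Omega].

(* C_c^infinity(Omega), the functions being extended by 0 outside Omega *)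
Definition test_function {R : realType} {N : nat} (Omega : set 'rV[R]_N)
    (phi : 'rV[R]_N -> R) :=
  smooth phi /\
  exists K, [/\ compact K, K `<=` Omega & forall x, ~ K x -> phi x = 0].

Definition in_L2 {R : realType} {N : nat} (Omega : set 'rV[R]_N)
    (u : 'rV[R]_N -> R) :=
  measurable_fun Omega u /\
  (lebesgue_rV R N).-integrable Omega (fun x => (u x ^+ 2)%:E).

Definition weak_partial {R : realType} {N : nat} (Omega : set 'rV[R]_N)
    (i : 'I_N) (u v : 'rV[R]_N -> R) :=
  forall phi, test_function Omega phi ->
    \int[lebesgue_rV R N]_(x in Omega) (u x * partial i phi x) =
    - \int[lebesgue_rV R N]_(x in Omega) (v x * phi x).

(* u is in H^1(Omega) = W^{1,2}(Omega) and g is its weak gradient, which is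
   unique only almost everywhere in Omega *)
Definition in_H1 {R : realType} {N : nat} (Omega : set 'rV[R]_N)
    (u : 'rV[R]_N -> R) (g : 'I_N -> 'rV[R]_N -> R) :=
  in_L2 Omega u /\ forall i, in_L2 Omega (g i) /\ weak_partial Omega i u (g i).

(* u is in H^1_0(Omega), the closure of C_c^infinity(Omega) in H^1(Omega),
   and g is its weak gradient *)
Definition in_H10 {R : realType} {N : nat} (Omega : set 'rV[R]_N)
    (u : 'rV[R]_N -> R) (g : 'I_N -> 'rV[R]_N -> R) :=
  in_H1 Omega u g /\
  forall e : R, 0 < e -> exists2 phi, test_function Omega phi &
    \int[lebesgue_rV R N]_(x in Omega) (u x - phi x) ^+ 2 +
    \sum_(i < N) \int[lebesgue_rV R N]_(x in Omega)
                   (g i x - partial i phi x) ^+ 2 < e.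

(* ||u||_W, where g is the weak gradient of u *)
Definition W_norm {R : realType} {N : nat} (Omega : set 'rV[R]_N)
    (g : 'I_N -> 'rV[R]_N -> R) : R :=
  Num.sqrt (\int[lebesgue_rV R N]_(x in Omega) (\sum_(i < N) g i x ^+ 2)).

(* u is a nonnegative nontrivial weak solution in H^1_0(Omega) of
     - M(||u||_W^2) Delta u = - a u^(q-1) + u^(p-1)  in Omega,
   u = 0 on the boundary. *)
Definition solves_P {R : realType} {N : nat} (Omega : set 'rV[R]_N)
    (M : R -> R) (a q p : R) (u : 'rV[R]_N -> R) :=
  [/\ {ae lebesgue_rV R N, forall x, Omega x -> 0 <= u x},
      ~ {ae lebesgue_rV R N, forall x, Omega x -> u x = 0} &
      exists2 g, in_H10 Omega u g &
        forall phi h, in_H10 Omega phi h ->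
          M (W_norm Omega g ^+ 2) *
            \int[lebesgue_rV R N]_(x in Omega) (\sum_(i < N) g i x * h i x) =
          \int[lebesgue_rV R N]_(x in Omega)
            ((- a * u x `^ (q - 1) + u x `^ (p - 1)) * phi x)].

Definition Linfty_norm {R : realType} {N : nat} (Omega : set 'rV[R]_N)
    (u : 'rV[R]_N -> R) : \bar R :=
  Lnorm (lebesgue_rV R N) +oo%E (EFin \o (u \_ Omega)).

Definition bounded_in_Linfty {R : realType} {N : nat} (Omega : set 'rV[R]_N)
    (F : set ('rV[R]_N -> R)) :=
  exists C : R, forall u, F u -> (Linfty_norm Omega u <= C%:E)%E.

Definition extends_to_closure {R : realType} {N : nat} (Omega : set 'rV[R]_N)
    (f : 'rV[R]_N -> R) :=
  exists2 h : 'rV[R]_N -> R, {within closure Omega, continuous h} &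
    forall x, Omega x -> h x = f x.

(* u is of class C^1 on Omega and u and its first partial derivatives extend
   continuously to the closure of Omega *)
Definition in_C1 {R : realType} {N : nat} (Omega : set 'rV[R]_N)
    (u : 'rV[R]_N -> R) :=
  [/\ forall x, Omega x -> forall i, derivable u x (delta_mx ord0 i),
      extends_to_closure Omega u &
      forall i, extends_to_closure Omega (partial i u)].

Definition C1_norm {R : realType} {N : nat} (Omega : set 'rV[R]_N)
    (u : 'rV[R]_N -> R) : \bar R :=
  (ereal_sup [set `|u x|%:E | x in Omega] +
   \sum_(i < N) ereal_sup [set `|partial i u x|%:E | x in Omega])%E.

Definition unbounded_in_C1 {R : realType} {N : nat} (Omega : set 'rV[R]_N)
    (F : set ('rV[R]_N -> R)) :=
  (forall u, F u -> in_C1 Omega u) /\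
  forall C : R, exists2 u, F u & (C%:E < C1_norm Omega u)%E.

(* The critical Sobolev exponent 2^* = 2N / (N - 2) *)
Definition sobolev_exponent (R : realType) (N : nat) : R :=
  2 * N%:R / (N%:R - 2).

(* Main.v *)
Require Import Defs.
From HB Require Import structures.
From mathcomp Require Import all_boot all_order all_algebra.
From mathcomp Require Import all_classical all_reals all_analysis.
From mathcomp Require Import measurable_realfun ess_sup_inf ring lra.
Import Order.TTheory GRing.Theory Num.Theory.
Import numFieldNormedType.Exports.
Local Open Scope classical_set_scope.
Local Open Scope ring_scope.
Set Implicit Arguments.
Unset Strict Implicit.
Unset Printing Implicit Defensive.

(** Since 0 < q - 1 < p - 1 < 1, the equation - Delta v = v^(p-1) - A v^(q-1)
on R^N has, for a suitable A in ]0, 1[, a radial solution v with compact support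
and v(0) = 1 ([compact_profile]): the absorption term drives v to zero at a
finite radius, with zero gradient. For x0 in Omega and rho small enough the
function u(x) = c v((x - x0) / rho) vanishes outside a compact subset of Omega.
With D the Dirichlet integral of v, one has ||u||_W^2 = c^2 rho^(N-2) D
([sol_W_norm]), so that u solves the nonlocal problem as soon as

  (c^2 rho^(N-2) D)^m c / rho^2 = c^(p-1),  m = (r - 2) / 2,  a = A c^(p-q).

The first equation determines the amplitude as a constant times rho^(g/s), with
g = 2 - (N-2) m and s = 2 m + 2 - p > 0 ([amplitude_eq]). The gradient of u is of
order c / rho, hence unbounded as rho tends to 0 if g < s, which means p < N m.
If 2 + 2/N < r < 2^*, then N m > 1 leaves room for p > 1, and g > 0 makes c, and
with it a, at most 1 for small rho. If r = 2^*, then g = 0: the amplitude c and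
the coefficient a are the same for all rho, and N m > 2 allows any p < 2.

The profile is found by shooting in A. In the variable t = |x|^2 / 2, with
v = F(t) and Q = - F', the equation reads 2 t Q' + N Q = F^(p-1) - A F^(q-1). A
finite difference scheme depends continuously on A, and at A = 1 its solution is
the constant 1; by the intermediate value theorem some A gives a minimum equal to
0 on [0, T], unless A = 0 already gives a nonnegative solution ([shooting]).
Solutions of the differential equation are limits of the scheme along an
ultrafilter ([scheme_limit_solution]). The energy t Q^2 + potential(F) decreases,
and as long as it is nonnegative it forces F to reach 0 before a time which does
not depend on A ([zero_time_bound]); with T larger than this time the zero of F is
an interior minimum, so that Q vanishes there as well and F can be continued by 0.

Such a C^1 radial function belongs to H^1_0 because it is approximated in C^1 by
the radial test functions p(T - t) exp(- kap / (T - t)) with p a polynomial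
([flat_approx], [radial_in_H10]). Integration by parts comes from the invariance
of the Lebesgue measure under translations ([cbs_derive0]), and the weak
formulation against all of H^1_0 follows by density ([H10_density]). *)

(** * A finite difference scheme for the radial profile *)

Lemma continuous_powR_max0 (R : realType) (a : R) : 0 < a ->
  continuous (fun x : R => (Num.max 0 x) `^ a).
Proof.
move=> a0 x; have [x0|x0] := ltP 0 x.
  have cx : {for x, continuous (fun y : R => y `^ a)}.
    apply/differentiable_continuous/derivable1_diffP.
    by apply: derivable_powR; rewrite in_itv /= x0.
  rewrite /prop_for /continuous_at (_ : Num.max 0 x = x); last first.
    by apply/max_idPr; exact: ltW.
  apply: cvg_trans cx; apply: near_eq_cvg.
  near=> y; congr (_ `^ _); apply/esym/max_idPr/ltW.
  near: y; exact: lt_nbhsr.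
rewrite /prop_for /continuous_at (_ : Num.max 0 x = 0); last exact/max_idPl.
rewrite powR0 ?gt_eqF//; apply/cvgr0Pnorm_lt => e e0.
near=> y; rewrite ger0_norm ?powR_ge0//.
have xy : `|y - x| < e `^ a^-1.
  rewrite distrC; near: y; apply: cvgr_dist_lt; [exact: cvg_id|exact: powR_gt0].
have -> : e = (e `^ a^-1) `^ a by rewrite -powRrM mulVf ?gt_eqF// powRr1// ltW.
apply: gt0_ltr_powR; rewrite ?nnegrE ?le_max ?lexx ?powR_ge0//.
rewrite gt_max powR_gt0//=; apply: le_lt_trans xy.
by rewrite (le_trans _ (ler_norm _))//; lra.
Unshelve. all: by end_near. Qed.

Section scheme.
Variables (R : realType) (N : nat) (al be : R).
Hypotheses (N1 : (1 < N)%N) (al0 : 0 < al) (albe : al < be).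

(** Truncation to [0, 1], where the profile takes its values, makes the
nonlinearity bounded and continuous on the whole line. *)
Definition clamp (y : R) : R := Num.min 1 (Num.max 0 y).

Lemma clamp_ge0 y : 0 <= clamp y.
Proof. by rewrite /clamp le_min ler01 le_max lexx. Qed.

Lemma clamp_le1 y : clamp y <= 1.
Proof. by rewrite /clamp ge_min lexx. Qed.

Lemma clamp_id y : 0 <= y <= 1 -> clamp y = y.
Proof.
by move=> /andP[y0 y1]; rewrite /clamp (max_idPr y0); exact/min_idPr.
Qed.

Lemma continuous_clamp : continuous clamp.
Proof.
move=> y; rewrite /clamp.
apply: (@continuous_min R R (fun=> 1) (fun y => Num.max 0 y)); first exact: cvg_cst.
by apply: (@continuous_max R R (fun=> 0) id); [exact: cvg_cst|exact: cvg_id].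
Qed.

Lemma continuous_clamp_powR (a : R) : 0 < a ->
  continuous (fun y => clamp y `^ a).
Proof.
move=> a0 y.
rewrite (_ : (fun y => _) = (fun x : R => (Num.max 0 x) `^ a) \o clamp); last first.
  by apply/funext => x /=; rewrite (max_idPr (clamp_ge0 _)).
apply: continuous_comp; first exact: continuous_clamp.
exact: continuous_powR_max0.
Qed.

Lemma clamp_powR_le1 a y : 0 < a -> clamp y `^ a <= 1.
Proof.
move=> a0; have <- : 1 `^ a = 1 :> R by rewrite powR1.
rewrite ge0_ler_powR ?nnegrE ?clamp_ge0 ?clamp_le1//; exact: ltW.
Qed.

Definition nonlin (A y : R) : R := clamp y `^ be - A * clamp y `^ al.

Lemma nonlin_cvg (I : Type) (G : set_system I) {FG : Filter G} (A y : I -> R) a b :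
  A @ G --> a -> y @ G --> b -> (fun i => nonlin (A i) (y i)) @ G --> nonlin a b.
Proof.
move=> Aa yb.
have be0 : 0 < be by exact: lt_trans al0 albe.
apply: cvgB; last apply: cvgM => //.
- apply: (@cvg_comp _ _ _ y (fun x => clamp x `^ be) _ _ _ yb).
  exact: continuous_clamp_powR.
- apply: (@cvg_comp _ _ _ y (fun x => clamp x `^ al) _ _ _ yb).
  exact: continuous_clamp_powR.
Qed.

Lemma nonlin_norm A y : 0 <= A <= 1 -> `|nonlin A y| <= 1.
Proof.
move=> /andP[A0 A1]; rewrite /nonlin.
have be0 : 0 < be by exact: lt_trans al0 albe.
have h1 := clamp_powR_le1 y be0; have h2 := clamp_powR_le1 y al0.
have h3 := powR_ge0 (clamp y) be; have h4 := powR_ge0 (clamp y) al.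
by rewrite ler_norml; apply/andP; split; nra.
Qed.

(** A step of length h for F' = - Q and 2 t Q' + N Q = nonlin F at t = k h; it is
implicit in Q, so that the new Q is a weighted mean of the old one and of
nonlin F / N, and the singular time t = 0 needs no special treatment. *)
Fixpoint scheme (h A : R) (k : nat) : R * R :=
  if k is k'.+1 then
    let FQ := scheme h A k' in
    let F' := FQ.1 - h * FQ.2 in
    (F', (2 * k%:R * FQ.2 + nonlin A F') / (2 * k%:R + N%:R))
  else (1, nonlin A 1 / N%:R).

Lemma N_ge2 : 2 <= N%:R :> R.
Proof. by rewrite (ler_nat _ 2). Qed.

Lemma scheme_Q_norm h A k : 0 <= A <= 1 -> `|(scheme h A k).2| <= 1.
Proof.
move=> A01; have N2 := N_ge2; elim: k => [|k IH] /=.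
  rewrite normrM normfV ler_pdivrMr ?normr_gt0 ?gt_eqF//; last lra.
  by rewrite mul1r [leRHS]ger0_norm; [have := nonlin_norm 1 A01|]; lra.
have k0 : 0 <= k.+1%:R :> R by [].
rewrite normrM normfV ler_pdivrMr ?normr_gt0 ?gt_eqF//.
rewrite mul1r [leRHS]ger0_norm; last lra.
have := nonlin_norm ((scheme h A k).1 - h * (scheme h A k).2) A01 => Hk.
apply: le_trans (ler_normD _ _) _; rewrite normrM [`|2 * _|]ger0_norm; last lra.
by nra.
Qed.

Lemma scheme_F_step h A k : (scheme h A k.+1).1 - (scheme h A k).1 = h * - (scheme h A k).2.
Proof. by rewrite /=; ring. Qed.

Lemma scheme_Q_step h A k : (scheme h A k.+1).2 - (scheme h A k).2 =
  (nonlin A (scheme h A k.+1).1 - N%:R * (scheme h A k.+1).2) / (2 * k.+1%:R).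
Proof.
have N2 := N_ge2; rewrite /=; set F := (_ - h * _); set Q := (scheme _ _ _).2.
by field; rewrite ?pnatr_eq0; apply/andP; split => //; rewrite gt_eqF//;
  have : 0 <= k%:R :> R by []; lra.
Qed.

(** The equation gives no bound on Q' near t = 0; this replaces one: Q is a mean of
the values of nonlin F / N taken so far, hence close to the value at F = 1 as
long as F is. *)
Lemma scheme_Q_start h A e k :
  (forall j, (j <= k)%N -> `|nonlin A (scheme h A j).1 - nonlin A 1| <= e) ->
  `|(scheme h A k).2 - nonlin A 1 / N%:R| <= e.
Proof.
have N2 := N_ge2.
elim: k => [|k IH] H; first by rewrite subrr normr0; exact: le_trans (H 0%N _).
have {}IH := IH (fun j jk => H j (leqW jk)).
have := H k.+1 (leqnn _); rewrite /=.
set F := (_ - h * _); set Q := (scheme _ _ _).2 in IH *.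
have k0 : 0 <= k.+1%:R :> R by [].
move=> Hk.
have -> : (2 * k.+1%:R * Q + nonlin A F) / (2 * k.+1%:R + N%:R) - nonlin A 1 / N%:R =
  (2 * k.+1%:R * (Q - nonlin A 1 / N%:R) + (nonlin A F - nonlin A 1)) / (2 * k.+1%:R + N%:R).
  by field; apply/andP; split; rewrite gt_eqF//; lra.
rewrite normrM normfV ler_pdivrMr ?normr_gt0 ?gt_eqF//.
rewrite [`|_ + N%:R|]ger0_norm; last lra.
have e0 : 0 <= e by exact: le_trans Hk.
apply: le_trans (ler_normD _ _) _; rewrite normrM [`|2 * _|]ger0_norm; last lra.
by nra.
Qed.

Lemma scheme_cvg (I : Type) (G : set_system I) {FG : Filter G} (A : I -> R) a h k :
  A @ G --> a ->
  (fun i => (scheme h (A i) k).1) @ G --> (scheme h a k).1 /\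
  (fun i => (scheme h (A i) k).2) @ G --> (scheme h a k).2.
Proof.
move=> Aa; elim: k => [|k [IH1 IH2]].
  split; first exact: cvg_cst.
  apply: cvgM; last exact: cvg_cst.
  by apply: (@nonlin_cvg _ G FG A (fun=> 1)) => //; exact: cvg_cst.
have F' : (fun i => (scheme h (A i) k).1 - h * (scheme h (A i) k).2) @ G -->
    (scheme h a k).1 - h * (scheme h a k).2.
  by apply: cvgB => //; apply: cvgM => //; exact: cvg_cst.
split => //=; apply: cvgM; last exact: cvg_cst.
apply: cvgD; first by apply: cvgM => //; exact: cvg_cst.
exact: (@nonlin_cvg _ G FG A).
Qed.

Lemma scheme1 h k : scheme h 1 k = (1, 0).
Proof.
have n11 : nonlin 1 1 = 0.
  by rewrite /nonlin clamp_id ?lexx ?ler01// !powR1 mulr1 subrr.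
elim: k => [|k IH] /=; first by rewrite n11 mul0r.
by rewrite IH /= mulr0 subr0 n11 mulr0 addr0 mul0r.
Qed.

End scheme.

(** * Passage to the limit in the scheme *)

Lemma cvg_ler (R : realType) (I : Type) (G : set_system I) {FG : ProperFilter G}
    (f g : I -> R) a b :
  f @ G --> a -> g @ G --> b -> (\forall i \near G, f i <= g i) -> a <= b.
Proof.
move=> fa gb fg; rewrite -subr_ge0.
apply: (cvgr_to_ge (cvgB gb fa)); apply: filterS fg => i.
by rewrite /= subr_ge0.
Qed.

(** Convergence along an ultrafilter replaces the extraction of subsequences, at
all times simultaneously. *)
Lemma ultra_bounded_cvg (R : realType) (I : Type) (U : set_system I)
    {FU : UltraFilter U} (x : I -> R) (C : R) :
  (forall i, `|x i| <= C) -> cvg (x @ U).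
Proof.
move=> xC; have UC : (x @ U) `[- C, C]%classic.
  by apply: nearW => i /=; rewrite in_itv /= -ler_norml.
have [p [_ clp]] := @segment_compact R (- C) C (x @ U) _ UC.
apply/cvg_ex; exists p => V Vp.
have [//|nV] := @in_ultra_setVsetC _ U (x @^-1` V) FU.
have [z [/= nVz Vz]] := clp (~` V) V nV Vp.
by [].
Qed.

Lemma telescope_le (R : realType) (y : nat -> R) (L : R) (j k : nat) : (j <= k)%N ->
  (forall i, (j <= i < k)%N -> `|y i.+1 - y i| <= L) ->
  `|y k - y j| <= (k%:R - j%:R) * L.
Proof.
move=> /subnK <-; elim: (k - j)%N => [|d IH] H.
  by rewrite add0n !subrr normr0 mul0r.
have h1 : `|y (d + j)%N - y j| <= ((d + j)%:R - j%:R) * L.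
  apply: IH => i /andP[ji ik]; apply: H; rewrite ji /=.
  by rewrite (ltn_trans ik)// addSn.
have h2 : `|y (d.+1 + j)%N - y (d + j)%N| <= L.
  by rewrite addSn; apply: H; rewrite leq_addl addSn /=.
rewrite (_ : _ - y j = (y (d.+1 + j)%N - y (d + j)%N) + (y (d + j)%N - y j)); last ring.
apply: le_trans (ler_normD _ _) _; apply: le_trans (lerD h2 h1) _.
by rewrite !natrD -(natr1 d); lra.
Qed.

Lemma telescope_norm (R : realType) (y : nat -> R) (L m : R) (j k : nat) :
  (forall i : nat, m <= i%:R -> `|y i.+1 - y i| <= L) -> m <= j%:R -> m <= k%:R ->
  `|y k - y j| <= `|k%:R - j%:R| * L.
Proof.
move=> H; wlog jk : j k / (j <= k)%N => [hw mj mk|mj mk].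
  have /orP[jk|kj] := leq_total j k; first exact: hw.
  by rewrite distrC [`|_%:R - _|]distrC; exact: hw.
rewrite [X in X * _]ger0_norm ?subr_ge0 ?ler_nat//.
apply: telescope_le => // i /andP[ji ik]; apply: H.
by rewrite (le_trans mj)// ler_nat.
Qed.

Section scheme_limit.
Variables (R : realType) (N : nat) (al be : R).
Hypotheses (N1 : (1 < N)%N) (al0 : 0 < al) (albe : al < be).
Variables (A_ : nat -> R) (U : set_system nat).
Hypotheses (A01 : forall n, 0 <= A_ n <= 1) (FU : UltraFilter U) (Uoo : \oo `<=` U).

Definition mesh (n : nat) : R := n.+1%:R^-1.
Let Fs n k := (scheme N al be (mesh n) (A_ n) k).1.
Let Qs n k := (scheme N al be (mesh n) (A_ n) k).2.
Let idx (n : nat) (t : R) := Num.truncn (t * n.+1%:R).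

Let FPU : ProperFilter U. Proof. exact: ultra_proper. Qed.
Existing Instance FPU.

(** The filter of the pairs (n, k) for which n is large and the grid point
k / (n + 1) is close to c. Convergence along it is locally uniform convergence
of the discrete functions, which passes to their difference quotients. *)
Definition grid_near (c : R) : set_system (nat * nat) :=
  [set S | exists2 d : R, 0 < d & \forall n \near U,
     forall k : nat, `|k%:R * mesh n - c| < d -> S (n, k)].

Global Instance grid_near_filter c : Filter (grid_near c).
Proof.
split; first by exists 1 => //; exact: nearW.
- move=> P Q [d d0 dP] [e e0 eQ]; exists (Num.min d e); first by rewrite lt_min d0.
  near=> n => k; rewrite lt_min => /andP[kd ke]; split.
    by move: k kd {ke}; near: n.
  by move: k ke {kd}; near: n.
- move=> P Q PQ [d d0 dP]; exists d => //.
  by near=> n => k kd; apply: PQ; move: k kd; near: n.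
Unshelve. all: by end_near. Qed.

Lemma mesh_cvg0 : (fun n => mesh n) @ U --> (0 : R).
Proof. by move=> V /(@cvg_harmonic R) /Uoo. Qed.

Lemma mesh_gt0 n : 0 < mesh n.
Proof. by rewrite /mesh invr_gt0. Qed.

Lemma idx_bound n t : 0 <= t -> t - mesh n < (idx n t)%:R * mesh n <= t.
Proof.
move=> t0; have n0 : 0 < n.+1%:R :> R by [].
have /andP[h1 h2] : (idx n t)%:R <= t * n.+1%:R < (idx n t).+1%:R.
  by apply: truncn_itv; rewrite mulr_ge0.
rewrite /mesh ler_pdivrMr// h1 andbT ltr_pdivlMr// mulrBl mulVf ?gt_eqF//.
by rewrite ltrBlDr natr1.
Qed.

Lemma idx_cvg t : 0 <= t -> (fun n => (idx n t)%:R * mesh n) @ U --> t.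
Proof.
move=> t0; apply/cvgrPdist_lt => e e0; near=> n.
have /andP[h1 h2] := idx_bound n t0.
rewrite ger0_norm ?subr_ge0//; apply: (@lt_le_trans _ _ (mesh n)); first lra.
apply/ltW; rewrite -[ltLHS]ger0_norm ?ltW ?mesh_gt0// -[X in `|X|]subr0 distrC.
by near: n; apply: cvgr_dist_lt; [exact: mesh_cvg0|].
Unshelve. all: by end_near. Qed.

Lemma mesh_small (e : R) : 0 < e -> \forall n \near U, mesh n < e.
Proof.
move=> e0; near=> n; rewrite -[ltLHS]ger0_norm ?ltW ?mesh_gt0//.
rewrite -[X in `|X|]subr0 distrC.
by near: n; apply: cvgr_dist_lt; [exact: mesh_cvg0|].
Unshelve. all: by end_near. Qed.

Lemma Qs_norm n k : `|Qs n k| <= 1.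
Proof. by apply: scheme_Q_norm. Qed.

Lemma Fs_step n k : `|Fs n k.+1 - Fs n k| <= mesh n.
Proof.
rewrite /Fs scheme_F_step normrM normrN ger0_norm; last exact/ltW/mesh_gt0.
by rewrite ler_piMr ?Qs_norm// ltW ?mesh_gt0.
Qed.

Lemma Fs_norm n t : `|Fs n (idx n t)| <= 1 + `|t|.
Proof.
have [t0|t0] := ltP t 0.
  rewrite /idx (_ : Num.truncn _ = 0%N); last first.
    by apply/truncn0Pn; rewrite -ltNge (lt_trans _ ltr01)// pmulr_llt0.
  by rewrite /Fs /= normr1; have := normr_ge0 t; lra.
have := @telescope_norm _ (Fs n) (mesh n) 0 0 (idx n t) (fun i _ => Fs_step n i).
move=> /(_ (lexx _) (ler0n _ _)).
have /andP[h1 h2] := idx_bound n t0.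
rewrite subr0 [`|_%:R|]ger0_norm// => h3.
rewrite [`|t|]ger0_norm//.
have -> : Fs n (idx n t) = (Fs n (idx n t) - Fs n 0%N) + 1 by rewrite /Fs /=; ring.
by apply: le_trans (ler_normD _ _) _; rewrite normr1; lra.
Qed.

Definition limF (t : R) : R := lim ((fun n => Fs n (idx n t)) @ U).
Definition limQ (t : R) : R := lim ((fun n => Qs n (idx n t)) @ U).
Definition limA : R := lim (A_ @ U).

Lemma cvg_limA : A_ @ U --> limA.
Proof.
apply: (@ultra_bounded_cvg _ _ U FU _ 1) => n.
by have /andP[? ?] := A01 n; rewrite ger0_norm.
Qed.

Lemma limA01 : 0 <= limA <= 1.
Proof.
apply/andP; split.
  apply: (@cvg_ler _ _ U _ (fun=> 0) A_) => //; [exact: cvg_cst|exact: cvg_limA|].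
  by apply: nearW => n; have /andP[] := A01 n.
apply: (@cvg_ler _ _ U _ A_ (fun=> 1)) => //; [exact: cvg_limA|exact: cvg_cst|].
by apply: nearW => n; have /andP[] := A01 n.
Qed.

Lemma cvg_limF t : (fun n => Fs n (idx n t)) @ U --> limF t.
Proof. exact: (@ultra_bounded_cvg _ _ U FU _ (1 + `|t|) (Fs_norm^~ t)). Qed.

Lemma cvg_limQ t : (fun n => Qs n (idx n t)) @ U --> limQ t.
Proof. exact: (@ultra_bounded_cvg _ _ U FU _ 1 (fun n => Qs_norm n _)). Qed.

Lemma limF0 : limF 0 = 1.
Proof.
rewrite /limF (_ : (fun n => _) = fun=> 1); first exact: lim_cst.
by apply/funext => n; rewrite /idx mul0r truncn0.
Qed.

Lemma limQ0 : limQ 0 = nonlin al be limA 1 / N%:R.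
Proof.
apply/cvg_lim => //.
rewrite (_ : (fun n => _) = fun n => nonlin al be (A_ n) 1 / N%:R); last first.
  by apply/funext => n; rewrite /idx mul0r truncn0.
apply: cvgM; last exact: cvg_cst.
by apply: (@nonlin_cvg _ _ _ al0 albe _ U _ A_ (fun=> 1)); [exact: cvg_limA|exact: cvg_cst].
Qed.

Lemma near_grid (P : set nat) c : U P -> grid_near c (fun nk => P nk.1).
Proof. by move=> UP; exists 1 => //; near=> n => k _ /=; near: n.
Unshelve. all: by end_near. Qed.

Lemma grid_cvg_fst (f : nat -> R) (l c : R) : f @ U --> l ->
  (fun nk => f nk.1) @ grid_near c --> l.
Proof. by move=> fl V /fl UV; exact: (@near_grid (f @^-1` V)). Qed.

(** On the grid points near c the sequences [y n] are equi-Lipschitz, so that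
their limit at c is also their limit along all these points. *)
Lemma equi_lipschitz_grid_cvg (y : nat -> nat -> R) (L c d0 : R) (m : nat -> R) (l : R) :
  0 <= c -> 0 < d0 ->
  (\forall n \near U, forall k, m n <= k%:R -> `|y n k.+1 - y n k| <= L * mesh n) ->
  (\forall n \near U, forall k : nat, `|k%:R * mesh n - c| < d0 -> m n <= k%:R) ->
  0 <= L ->
  (fun n => y n (idx n c)) @ U --> l ->
  (fun nk => y nk.1 nk.2) @ grid_near c --> l.
Proof.
move=> c0 d00 ystep md L0 yl; apply/cvgrPdist_lt => e e0.
pose d := Num.min (d0 / 2) (e / (4 * (L + 1))).
have d_gt0 : 0 < d by rewrite lt_min divr_gt0//= divr_gt0//; lra.
exists d => //.
near=> n => k kd /=.
have ms : mesh n < d by near: n; exact: mesh_small.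
have /andP[i1 i2] := idx_bound n c0.
have dd0 : d <= d0 / 2 by rewrite ge_min lexx.
have Ld : (L + 1) * d <= e / 4.
  have : d <= e / (4 * (L + 1)) by rewrite ge_min lexx orbT.
  rewrite ler_pdivlMr; last lra.
  by lra.
have st : forall k : nat, m n <= k%:R -> `|y n k.+1 - y n k| <= L * mesh n.
  by near: n.
have mk : forall k : nat, `|k%:R * mesh n - c| < d0 -> m n <= k%:R by near: n.
have ic : `|(idx n c)%:R * mesh n - c| < mesh n by rewrite ltr_distl; lra.
have := telescope_norm st (mk _ (_ : `|(idx n c)%:R * mesh n - c| < d0)) (mk k _).
have -> : `|k%:R - (idx n c)%:R| * (L * mesh n) = L * `|k%:R * mesh n - (idx n c)%:R * mesh n|.
  by rewrite -mulrBl normrM [`|mesh n|]ger0_norm ?ltW ?mesh_gt0//; ring.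
move=> /(_ _ _)Ht.
have {}Ht : `|y n k - y n (idx n c)| <= L * `|k%:R * mesh n - (idx n c)%:R * mesh n|.
  by apply: Ht; lra.
have ki : `|k%:R * mesh n - (idx n c)%:R * mesh n| < 2 * d.
  by move: kd ic; rewrite !ltr_distl => /andP[? ?] /andP[? ?]; lra.
have ye : `|l - y n (idx n c)| < e / 4.
  by near: n; apply: cvgr_dist_lt => //; lra.
rewrite (_ : l - _ = (l - y n (idx n c)) - (y n k - y n (idx n c))); last ring.
apply: le_lt_trans (ler_normB _ _) _.
by nra.
Unshelve. all: by end_near. Qed.

Lemma F_grid c : 0 <= c -> (fun nk => Fs nk.1 nk.2) @ grid_near c --> limF c.
Proof.
move=> c0; apply: (@equi_lipschitz_grid_cvg Fs 1 c 1 (fun=> 0)) => //.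
- by apply: nearW => n k _; rewrite mul1r; exact: Fs_step.
- by apply: nearW => n k _.
- exact: cvg_limF.
Qed.

Lemma FS_grid c : 0 <= c -> (fun nk => Fs nk.1 nk.2.+1) @ grid_near c --> limF c.
Proof.
move=> c0.
rewrite (_ : (fun nk => _) = fun nk : nat * nat => Fs nk.1 nk.2 - mesh nk.1 * Qs nk.1 nk.2); last first.
  by apply/funext => -[n k].
rewrite -[limF c]subr0; apply: cvgB; first exact: F_grid.
apply/cvgr0Pnorm_lt => e e0.
have := near_grid c (mesh_small e0); apply: filterS => -[n k] /= mn.
rewrite normrM [`|mesh n|]ger0_norm ?ltW ?mesh_gt0// (le_lt_trans _ mn)//.
by rewrite ler_piMr ?Qs_norm// ltW ?mesh_gt0.
Qed.

Lemma grid_id c : (fun nk : nat * nat => nk.2%:R * mesh nk.1) @ grid_near c --> c.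
Proof.
apply/cvgrPdist_lt => e e0; exists e => //; apply: nearW => n k /=.
by rewrite distrC.
Qed.

Lemma grid_idS c : (fun nk : nat * nat => nk.2.+1%:R * mesh nk.1) @ grid_near c --> c.
Proof.
rewrite (_ : (fun nk => _) = fun nk : nat * nat => nk.2%:R * mesh nk.1 + mesh nk.1); last first.
  by apply/funext => -[n k] /=; rewrite -natr1 mulrDl mul1r.
rewrite -[X in _ --> X]addr0; apply: cvgD; first exact: grid_id.
exact: (grid_cvg_fst _ mesh_cvg0).
Qed.

Lemma Qs_step_norm n k :
  `|Qs n k.+1 - Qs n k| <= (1 + N%:R) / (2 * k.+1%:R).
Proof.
rewrite /Qs scheme_Q_step// normrM normfV [`|2 * _|]ger0_norm//.
rewrite ler_pM2r ?invr_gt0//; apply: le_trans (ler_normB _ _) _.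
rewrite lerD// ?nonlin_norm// normrM ger0_norm// ler_piMr//.
exact: (Qs_norm n k.+1).
Qed.

(** For c > 0 the steps of Q are of the order of the mesh; at c = 0 they are not,
and [scheme_Q_start] is used instead. *)
Lemma Q_grid c : 0 <= c -> (fun nk => Qs nk.1 nk.2) @ grid_near c --> limQ c.
Proof.
rewrite le_eqVlt => /predU1P[<-|c0].
  rewrite limQ0.
  have cA := cvg_limA.
  have cA1 : (fun nk => nonlin al be (A_ nk.1) 1) @ grid_near 0 --> nonlin al be limA 1.
    apply: (@nonlin_cvg _ _ _ al0 albe _ _ _ (fun nk : nat * nat => A_ nk.1) (fun=> 1)).
      exact: grid_cvg_fst.
    exact: cvg_cst.
  have cF : (fun nk => nonlin al be (A_ nk.1) (Fs nk.1 nk.2) -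
      nonlin al be (A_ nk.1) 1) @ grid_near 0 --> (0 : R).
    rewrite -[X in _ --> X](subrr (nonlin al be limA 1)); apply: cvgB => //.
    apply: (@nonlin_cvg _ _ _ al0 albe _ _ _ (fun nk : nat * nat => A_ nk.1) (fun nk => Fs nk.1 nk.2)).
      exact: grid_cvg_fst.
    by have := @F_grid 0 (lexx _); rewrite limF0.
  suff cQ : (fun nk => Qs nk.1 nk.2 - nonlin al be (A_ nk.1) 1 / N%:R) @ grid_near 0 --> (0 : R).
    rewrite -[X in _ --> X]add0r.
    rewrite (_ : (fun nk => _) = fun nk => (Qs nk.1 nk.2 - nonlin al be (A_ nk.1) 1 / N%:R)
       + nonlin al be (A_ nk.1) 1 / N%:R); last by apply/funext => nk; rewrite subrK.
    by apply: cvgD => //; apply: cvgM => //; exact: cvg_cst.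
  apply/cvgr0Pnorm_le => e e0.
  move/cvgr0Pnorm_le : cF => /(_ _ e0)[d d0 Hd]; exists d => //.
  near=> n => k kd /=.
  have Hdn : forall k : nat, `|k%:R * mesh n - 0| < d ->
     `|nonlin al be (A_ n) (Fs n k) - nonlin al be (A_ n) 1| <= e by near: n.
  apply: scheme_Q_start => // j jk; apply: Hdn.
  have h := mesh_gt0 n.
  apply: le_lt_trans kd; rewrite !subr0 !ger0_norm ?mulr_ge0 ?(ltW h)//.
  by rewrite ler_pM2r// ler_nat.
have N2 := N_ge2 R N1.
apply: (@equi_lipschitz_grid_cvg Qs ((1 + N%:R) / c) c (c / 2)
   (fun n => c / 2 / mesh n)) => //; [exact: ltW|lra| | | |exact: cvg_limQ].
- apply: nearW => n k; rewrite ler_pdivrMr ?mesh_gt0// => ck.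
  apply: le_trans (Qs_step_norm n k) _; rewrite -!mulrA ler_pM2l; last lra.
  have h := mesh_gt0 n.
  rewrite ler_pdivlMl// ler_pdivrMr//.
  have : 0 <= k%:R :> R by [].
  by rewrite -natr1; nra.
- apply: nearW => n k; rewrite ler_pdivrMr ?mesh_gt0// ltr_distl => /andP[h1 h2].
  by lra.
- by rewrite divr_ge0 ?ltW//; lra.
Unshelve. all: by end_near. Qed.

(** The increments of [y] are [mesh n] times [r], and [r] tends to [rho] near
the point c; so the limit [Y] of [y] has slope [rho] near c. *)
Lemma grid_slope (y : nat -> nat -> R) (r : nat * nat -> R) (Y : R -> R) (rho c : R) :
  (forall t, 0 <= t -> (fun n => y n (idx n t)) @ U --> Y t) ->
  (forall n k, y n k.+1 - y n k = mesh n * r (n, k)) ->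
  r @ grid_near c --> rho ->
  forall e : R, 0 < e -> exists2 d : R, 0 < d & forall a b : R, 0 <= a -> a <= b ->
    `|a - c| < d -> `|b - c| < d -> `|Y b - Y a - rho * (b - a)| <= e * (b - a).
Proof.
move=> yY yr rr e e0.
move/cvgrPdist_le : rr => /(_ _ e0)[d d0 Hd].
exists (d / 2); first lra.
move=> a b a0 ab ad bd; have b0 : 0 <= b by exact: le_trans ab.
have cba : (fun n => (idx n b)%:R * mesh n - (idx n a)%:R * mesh n) @ U --> b - a.
  by apply: cvgB; exact: idx_cvg.
apply: (@cvg_ler _ _ U _ (fun n => `|y n (idx n b) - y n (idx n a) -
     rho * ((idx n b)%:R * mesh n - (idx n a)%:R * mesh n)|)
   (fun n => e * ((idx n b)%:R * mesh n - (idx n a)%:R * mesh n))).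
- apply: cvg_norm; apply: cvgB; first by apply: cvgB; exact: yY.
  by apply: cvgM => //; exact: cvg_cst.
- by apply: cvgM => //; exact: cvg_cst.
near=> n.
have Hdn : forall k : nat, `|k%:R * mesh n - c| < d -> `|rho - r (n, k)| <= e by near: n.
have ms : mesh n < d / 2 by near: n; apply: mesh_small; lra.
have n0 := mesh_gt0 n.
have ij : (idx n a <= idx n b)%N.
  by apply: le_truncn; rewrite ler_pM2r.
have /andP[a1 a2] := idx_bound n a0; have /andP[b1 b2] := idx_bound n b0.
have := @telescope_le _ (fun k => y n k - rho * (k%:R * mesh n)) (e * mesh n) _ _ ij.
rewrite (_ : _ - _ - (_ - _) = y n (idx n b) - y n (idx n a) -
     rho * ((idx n b)%:R * mesh n - (idx n a)%:R * mesh n)); last ring.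
rewrite [X in _ <= X](_ : _ = e * ((idx n b)%:R * mesh n - (idx n a)%:R * mesh n)); last ring.
apply => i /andP[ai ib].
rewrite -natr1 (_ : _ - _ = (y n i.+1 - y n i) - rho * mesh n); last ring.
rewrite yr (_ : _ - _ = (r (n, i) - rho) * mesh n); last ring.
rewrite normrM [`|mesh n|]ger0_norm ?(ltW n0)// ler_pM2r//.
rewrite distrC; apply: Hdn.
have i1 : (idx n a)%:R * mesh n <= i%:R * mesh n by rewrite ler_pM2r// ler_nat.
have i2 : i%:R * mesh n <= (idx n b)%:R * mesh n by rewrite ler_pM2r// ler_nat ltnW.
have := ad; have := bd; rewrite !ltr_distl => /andP[? ?] /andP[? ?]; apply/andP; split; lra.
Unshelve. all: by end_near. Qed.

Lemma limF_slope c : 0 <= c ->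
  forall e : R, 0 < e -> exists2 d : R, 0 < d & forall a b : R, 0 <= a -> a <= b ->
    `|a - c| < d -> `|b - c| < d ->
    `|limF b - limF a - (- limQ c) * (b - a)| <= e * (b - a).
Proof.
move=> c0; apply: (@grid_slope Fs (fun nk => - Qs nk.1 nk.2)).
- by move=> t _; exact: cvg_limF.
- by move=> n k; rewrite /Fs scheme_F_step.
- by apply: cvgN; exact: Q_grid.
Qed.

Lemma QS_grid c : 0 < c -> (fun nk => Qs nk.1 nk.2.+1) @ grid_near c --> limQ c.
Proof.
move=> c0; have cQ := Q_grid (ltW c0).
rewrite (_ : (fun nk => _) = fun nk : nat * nat => Qs nk.1 nk.2 +
   (Qs nk.1 nk.2.+1 - Qs nk.1 nk.2)); last by apply/funext => nk; ring.
rewrite -[limQ c]addr0; apply: cvgD => //.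
have cN : (fun nk : nat * nat => mesh nk.1 * ((1 + N%:R) / (2 * (nk.2.+1%:R * mesh nk.1))))
    @ grid_near c --> (0 : R).
  rewrite -[X in _ --> X](mul0r ((1 + N%:R) / (2 * c))); apply: cvgM.
    exact: (grid_cvg_fst _ mesh_cvg0).
  apply: cvgM; first exact: cvg_cst.
  apply: cvgV; first by rewrite mulf_neq0// gt_eqF.
  by apply: cvgM; [exact: cvg_cst|exact: grid_idS].
apply/cvgr0Pnorm_le => e e0; move/cvgr0Pnorm_le : cN => /(_ _ e0).
apply: filterS => -[n k] /=; apply: le_trans.
apply: le_trans (Qs_step_norm n k) _; rewrite ger0_norm; last first.
  by rewrite mulr_ge0 ?divr_ge0 ?mulr_ge0 ?ltW ?mesh_gt0.
by rewrite le_eqVlt; apply/orP; left; apply/eqP; field; rewrite gt_eqF ?mesh_gt0//=.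
Qed.

Lemma limQ_slope c : 0 < c ->
  forall e : R, 0 < e -> exists2 d : R, 0 < d & forall a b : R, 0 <= a -> a <= b ->
    `|a - c| < d -> `|b - c| < d ->
    `|limQ b - limQ a -
      ((nonlin al be limA (limF c) - N%:R * limQ c) / (2 * c)) * (b - a)| <= e * (b - a).
Proof.
move=> c0.
apply: (@grid_slope Qs (fun nk => (nonlin al be (A_ nk.1) (Fs nk.1 nk.2.+1) -
   N%:R * Qs nk.1 nk.2.+1) / (2 * (nk.2.+1%:R * mesh nk.1)))).
- by move=> t _; exact: cvg_limQ.
- move=> n k; rewrite /Qs scheme_Q_step//; cbn [fst snd]; rewrite -/(Fs n k.+1).
  by field; rewrite gt_eqF ?mesh_gt0//= nat1r pnatr_eq0.
- apply: cvgM; last first.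
    apply: cvgV; first by rewrite mulf_neq0// gt_eqF.
    by apply: cvgM; [exact: cvg_cst|exact: grid_idS].
  apply: cvgB.
    apply: (@nonlin_cvg _ _ _ al0 albe _ _ _ (fun nk : nat * nat => A_ nk.1)).
      by apply: grid_cvg_fst; exact: cvg_limA.
    by apply: FS_grid; exact: ltW.
  by apply: cvgM; [exact: cvg_cst|exact: QS_grid].
Qed.

Lemma limQ_continuous_at (c e : R) : 0 <= c -> 0 < e ->
  exists2 d : R, 0 < d & forall t, 0 <= t -> `|t - c| < d -> `|limQ c - limQ t| <= e.
Proof.
move=> c0 e0; have /cvgrPdist_le/(_ _ e0)[d d0 Hd] := Q_grid c0.
exists (d / 2); first lra.
move=> t t0 td.
apply: (@cvg_ler _ _ U _ (fun n => `|limQ c - Qs n (idx n t)|) (fun=> e)).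
- apply: cvg_norm; apply: cvgB; first exact: cvg_cst.
  exact: cvg_limQ.
- exact: cvg_cst.
near=> n.
have Hdn : forall k : nat, `|k%:R * mesh n - c| < d -> `|limQ c - Qs n k| <= e by near: n.
apply: Hdn; have ms : mesh n < d / 2 by near: n; apply: mesh_small; lra.
have /andP[i1 i2] := idx_bound n t0; have n0 := mesh_gt0 n.
by have := td; rewrite !ltr_distl => /andP[? ?]; apply/andP; split; lra.
Unshelve. all: by end_near. Qed.

Lemma limQ_neg t : t < 0 -> limQ t = limQ 0.
Proof.
move=> t0; rewrite /limQ; congr (lim (_ @ U)); apply/funext => n.
rewrite /idx mul0r truncn0 (_ : Num.truncn _ = 0%N)//.
by apply/truncn0Pn; rewrite -ltNge (lt_trans _ ltr01)// pmulr_llt0.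
Qed.

End scheme_limit.

(** * Real functions of one variable *)

(** Only intervals with an end at c occur, so that the hypothesis can be checked
separately on both sides of c, for functions glued at c. *)
Lemma slope_is_derive (R : realType) (Y : R -> R) (rho c : R) :
  (forall e : R, 0 < e -> exists2 d : R, 0 < d & forall a b : R, a <= b ->
    a = c \/ b = c -> `|a - c| < d -> `|b - c| < d ->
    `|Y b - Y a - rho * (b - a)| <= e * (b - a)) ->
  is_derive c 1 Y rho.
Proof.
move=> H.
have cv : (fun h : R => h^-1 *: ((Y \o shift c) (h *: (1 : R)) - Y c)) @ 0^' --> rho.
  apply/cvgrPdist_le => e /H[d d0 Hd]; near=> h.
  have h0 : h != 0 by near: h; exact: nbhs_dnbhs_neq.
  have hd : `|h| < d.
    near: h; apply: dnbhs0_lt; exact: d0.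
  rewrite /= [h *: 1]mulr1 /GRing.scale /=.
  rewrite (_ : rho - _ = - (h^-1 * (Y (h + c) - Y c - rho * h))); last by field.
  rewrite normrN normrM normfV ler_pdivrMl ?normr_gt0// [leRHS]mulrC.
  have [hpos|hneg] := ltP 0 h.
    have ch : c <= h + c by lra.
    have := Hd c (h + c) ch (or_introl erefl); rewrite addrK subrr normr0.
    move=> /(_ d0 hd); rewrite [`|h|]gtr0_norm//.
  have ch : h + c <= c by lra.
  have := Hd (h + c) c ch (or_intror erefl); rewrite addrK subrr normr0 => /(_ hd d0).
  rewrite (_ : c - (h + c) = - h); last lra.
  rewrite (_ : Y c - _ - _ = - (Y (h + c) - Y c - rho * h)); last lra.
  by rewrite normrN [`|h|]ler0_norm.
by apply: DeriveDef; [exact: cvgP cv|exact: cvg_lim cv].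
Unshelve. all: by end_near. Qed.

Lemma is_derive_slope (R : realType) (f : R -> R) (c d : R) : is_derive c 1 f d ->
  forall e : R, 0 < e -> exists2 r : R, 0 < r & forall h, `|h| < r ->
    `|f (c + h) - f c - d * h| <= e * `|h|.
Proof.
move=> [df fd] e e0.
have cv : (fun h : R => h^-1 *: ((f \o shift c) (h *: (1 : R)) - f c)) @ 0^' --> d.
  by rewrite -fd; exact: df.
move/cvgrPdist_le : cv => /(_ _ e0) [r /= r0 Hr]; exists r => // h hr.
have [->|h0] := eqVneq h 0; first by rewrite addr0 mulr0 subr0 subrr normr0 mulr0.
have := Hr h; rewrite /= sub0r normrN => /(_ hr h0).
rewrite [h *: 1]mulr1 /GRing.scale /=.
rewrite (_ : d - _ = - (h^-1 * (f (c + h) - f c - d * h))); last by rewrite (addrC h c); field.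
by rewrite normrN normrM normfV ler_pdivrMl ?normr_gt0// [leRHS]mulrC.
Qed.

Lemma is_derive_pos_left (R : realType) (f : R -> R) (c d : R) :
  is_derive c 1 f d -> 0 < d ->
  exists2 r : R, 0 < r & forall x, c - r < x -> x < c -> f x < f c.
Proof.
move=> fd d0; have [r r0 H] := is_derive_slope fd (divr_gt0 d0 (ltr0n _ 2)).
exists r => // x xr xc; have xn : `|x - c| < r by rewrite ltr0_norm ?subr_lt0//; lra.
have := H _ xn; have -> : c + (x - c) = x by ring.
by rewrite [`|x - c|]ltr0_norm ?subr_lt0// ler_norml => /andP[? ?]; nra.
Qed.

Lemma is_derive_pos_right (R : realType) (f : R -> R) (c d : R) :
  is_derive c 1 f d -> 0 < d ->
  exists2 r : R, 0 < r & forall x, c < x -> x < c + r -> f c < f x.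
Proof.
move=> fd d0; have [r r0 H] := is_derive_slope fd (divr_gt0 d0 (ltr0n _ 2)).
exists r => // x xc xr; have xn : `|x - c| < r by rewrite gtr0_norm ?subr_gt0//; lra.
have := H _ xn; have -> : c + (x - c) = x by ring.
by rewrite [`|x - c|]gtr0_norm ?subr_gt0// ler_norml => /andP[? ?]; nra.
Qed.

Lemma is_derive_local_min (R : realType) (f : R -> R) (c d r : R) :
  is_derive c 1 f d -> 0 < r -> (forall x, `|x - c| < r -> f c <= f x) -> d = 0.
Proof.
move=> fd r0 H; apply/eqP; rewrite eq_le; apply/andP; split; rewrite leNgt; apply/negP => d0.
  have [s s0 Hs] := is_derive_pos_left fd d0.
  pose x := c - Num.min r s / 2.
  have m0 : 0 < Num.min r s by rewrite lt_min r0.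
  have mr : Num.min r s <= r by rewrite ge_min lexx.
  have ms : Num.min r s <= s by rewrite ge_min lexx orbT.
  have : f c <= f x by apply: H; rewrite /x ltr_distl; lra.
  by rewrite leNgt Hs// /x; lra.
have dN : 0 < - d by rewrite oppr_gt0.
have [s s0 Hs] := is_derive_pos_right (is_deriveN fd) dN.
pose x := c + Num.min r s / 2.
have m0 : 0 < Num.min r s by rewrite lt_min r0.
have mr : Num.min r s <= r by rewrite ge_min lexx.
have ms : Num.min r s <= s by rewrite ge_min lexx orbT.
have : f c <= f x by apply: H; rewrite /x ltr_distl; lra.
have : (- f) c < (- f) x by apply: Hs; rewrite /x; lra.
by rewrite ltrN2 ltNge => /negP.
Qed.

Lemma first_nonpos (R : realType) (f : R -> R) (t1 : R) :
  continuous f -> 0 < f 0 -> 0 <= t1 -> f t1 <= 0 ->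
  exists t, [/\ 0 < t, t <= t1, f t = 0 & forall s, 0 <= s < t -> 0 < f s].
Proof.
move=> cf f0 t10 ft1.
pose S := `[0, t1]%classic `&` f @^-1` [set y | y <= 0].
have clS : closed S.
  by apply: closedI; [exact: interval_closed|apply: preimage_closed => //; exact: closed_le].
have cS : compact S.
  by apply: subclosed_compact clS (@segment_compact R 0 t1) _; exact: subIsetl.
have S0 : S !=set0 by exists t1; split => //=; rewrite in_itv /= t10 lexx.
have cid : {within S, continuous (id : R -> R)}.
  by apply: continuous_subspaceT => x; exact: cvg_id.
have [t /set_mem[/= tt1 ft] Ht] := compact_EVT_min S0 cS cid.
move: tt1; rewrite in_itv /= => /andP[t0 tt1].
have pos s : 0 <= s < t -> 0 < f s.
  move=> /andP[s0 st]; rewrite ltNge; apply/negP => fs.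
  have /mem_set/Ht : S s by split => //=; rewrite in_itv /= s0 ltW// (lt_le_trans st).
  by rewrite leNgt st.
have tpos : 0 < t.
  by rewrite lt_neqAle t0 andbT; apply/eqP => t0'; move: ft f0; rewrite -t0' ltNge => ->.
exists t; split => //; apply/eqP; rewrite eq_le ft/=.
have /cvg_at_left_filter cl := cf t.
apply: (cvgr_to_ge cl); near=> s.
apply/ltW/pos/andP; split; near: s; first exact: nbhs_left_ge.
exact: nbhs_left_lt.
Unshelve. all: by end_near. Qed.

Lemma is_derive_mul (R : realType) (V : normedModType R) (f g : V -> R) (x v : V) (df dg : R) :
  is_derive x v f df -> is_derive x v g dg ->
  is_derive x v (fun y => f y * g y) (f x * dg + g x * df).
Proof. by move=> fd gd; exact: (is_deriveM fd gd). Qed.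

Lemma is_derive_comp1 (R : realType) (f g : R -> R) (x df dg : R) :
  is_derive (g x) 1 f df -> is_derive x 1 g dg ->
  is_derive x 1 (fun y => f (g y)) (df * dg).
Proof. by move=> fd gd; exact: (is_derive1_comp fd gd). Qed.

Lemma is_derive_cont (R : realType) (f : R -> R) (x df : R) :
  is_derive x 1 f df -> {for x, continuous f}.
Proof. by move=> [fd _]; apply/differentiable_continuous/derivable1_diffP. Qed.

(** By the equation 2 s Q' + n Q = g, n Q is a weighted mean of g. At a minimum s
of Q on [0, t] with n Q(s) < g(s) the derivative of Q would be positive, so that
Q would be smaller just before s. *)
Lemma average_ge (R : realType) (Q g : R -> R) (n m t : R) : 0 < n ->
  continuous Q -> n * Q 0 = g 0 ->
  (forall s : R, 0 < s -> is_derive s 1 Q ((g s - n * Q s) / (2 * s))) ->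
  0 <= t -> (forall s : R, 0 <= s <= t -> m <= g s) -> m <= n * Q t.
Proof.
move=> n0 cQ Q0 dQ t0 gm.
have [s] := EVT_min t0 (continuous_subspaceT cQ).
rewrite in_itv /= => /andP[s0 st] sm.
have Qst : Q s <= Q t by apply: sm; rewrite in_itv /= t0 lexx.
apply: (@le_trans _ _ (n * Q s)); last by rewrite ler_pM2l.
have mgs : m <= g s by apply: gm; rewrite s0 st.
have [s00|spos] := eqVneq s 0; first by rewrite s00 Q0 -s00.
have {}spos : 0 < s by rewrite lt_neqAle eq_sym spos.
rewrite leNgt; apply/negP => Qm.
have [r r0 Hr] : exists2 r : R, 0 < r & forall x : R, s - r < x -> x < s -> Q x < Q s.
  apply: (is_derive_pos_left (dQ s spos)); rewrite divr_gt0 ?mulr_gt0//.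
  by rewrite subr_gt0 (lt_le_trans Qm).
pose x := s - Num.min r s / 2.
have m0 : 0 < Num.min r s by rewrite lt_min r0.
have mr : Num.min r s <= r by rewrite ge_min lexx.
have ms : Num.min r s <= s by rewrite ge_min lexx orbT.
have : Q s <= Q x by apply: sm; rewrite in_itv /= /x; apply/andP; split; lra.
by rewrite leNgt Hr// /x; lra.
Qed.

Lemma average_le (R : realType) (Q g : R -> R) (n m t : R) : 0 < n ->
  continuous Q -> n * Q 0 = g 0 ->
  (forall s : R, 0 < s -> is_derive s 1 Q ((g s - n * Q s) / (2 * s))) ->
  0 <= t -> (forall s : R, 0 <= s <= t -> g s <= m) -> n * Q t <= m.
Proof.
move=> n0 cQ Q0 dQ t0 gm; rewrite -lerN2 -mulrN.
apply: (@average_ge _ (- Q) (- g)) => //.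
- by move=> x; apply: continuousN; exact: cQ.
- by rewrite /= mulrN Q0.
- move=> s s0; have := is_deriveN (dQ s s0); congr (is_derive _ _ _ _).
  by rewrite !fctE; ring.
- by move=> s /gm; rewrite lerN2.
Qed.

(** As long as 0 <= F <= 1, these are the equations for u(x) = F (|x|^2 / 2) to be
a radial solution of - Delta u = u^be - A u^al in dimension N, with Q = - F'. At
t = 0 the term 2 t Q' drops out. *)
Definition radial_solution (R : realType) (N : nat) (al be A : R) (F Q : R -> R) :=
  [/\ F 0 = 1, N%:R * Q 0 = nonlin al be A 1, continuous Q,
      forall t : R, is_derive t 1 F (- Q t) &
      forall t : R, 0 < t ->
        is_derive t 1 Q ((nonlin al be A (F t) - N%:R * Q t) / (2 * t))].

(** * The energy of a radial solution and its first zero *)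

Section profile.
Variables (R : realType) (N : nat) (al be A : R) (F Q : R -> R).
Hypotheses (N1 : (1 < N)%N) (al0 : 0 < al) (albe : al < be) (be1 : be < 1).
Hypotheses (A0 : 0 <= A) (A1 : A < 1) (sol : radial_solution N al be A F Q).

Let N2 : 2 <= N%:R :> R. Proof. exact: N_ge2. Qed.
Let N0 : 0 < N%:R :> R. Proof. exact: lt_le_trans N2. Qed.
Let F0 : F 0 = 1. Proof. by case: sol. Qed.
Let cQ : continuous Q. Proof. by case: sol. Qed.
Let dF (t : R) : is_derive t 1 F (- Q t). Proof. by case: sol. Qed.
Let dQ (t : R) : 0 < t ->
  is_derive t 1 Q ((nonlin al be A (F t) - N%:R * Q t) / (2 * t)).
Proof. by case: sol => _ _ _ _; exact. Qed.
Let cF : continuous F. Proof. by move=> t; exact: is_derive_cont (dF t). Qed.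

Lemma nonlinE (y : R) : 0 <= y <= 1 -> nonlin al be A y = y `^ be - A * y `^ al.
Proof. by move=> y01; rewrite /nonlin clamp_id. Qed.

Let Q00 : 0 < Q 0.
Proof.
case: sol => _ NQ _ _ _; rewrite -(pmulr_rgt0 _ N0).
rewrite NQ nonlinE ?ler01 ?lexx//.
by rewrite !powR1 mulr1 subr_gt0.
Qed.

(** The primitive of y^be - A y^al which vanishes at 0. *)
Definition potential (y : R) : R := (Num.max 0 y) `^ (be + 1) / (be + 1) -
  A * ((Num.max 0 y) `^ (al + 1) / (al + 1)).

(** The sum of |grad u|^2 / 2 and of the potential of u, for u(x) = F (|x|^2 / 2). *)
Definition energy (t : R) := t * (Q t * Q t) + potential (F t).

Lemma is_derive_potential (y : R) : 0 < y -> is_derive y 1 potential (y `^ be - A * y `^ al).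
Proof.
move=> y0.
have d (c : R) : 0 < c -> is_derive y 1 (fun z : R => (Num.max 0 z) `^ (c + 1) / (c + 1)) (y `^ c).
  move=> c0; apply: (@near_eq_is_derive _ _ _ (fun z : R => z `^ (c + 1) / (c + 1))).
    near=> z; congr (_ `^ _ / _); apply/esym/max_idPr/ltW.
    by near: z; exact: lt_nbhsr.
  apply: (is_derive_eq (is_derive_mul (is_derive1_powR (c + 1) y0)
    (is_derive_cst ((c + 1)^-1) y 1))); rewrite addrK /cst /=; field; rewrite ?gt_eqF//; lra.
have be0 : 0 < be by exact: lt_trans albe.
apply: (is_derive_eq (is_deriveB (d be be0) (is_derive_mul (is_derive_cst A y 1) (d al al0)))).
by rewrite /cst mulr0 addr0.
Unshelve. all: by end_near. Qed.

Lemma continuous_potential : continuous potential.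
Proof.
have [al0' albe' be1'] : [/\ 0 < al, al < be & be < 1] by [].
have c (d : R) : 0 < d -> continuous (fun z : R => (Num.max 0 z) `^ (d + 1) / (d + 1)).
  move=> d0 y; apply: cvgM; last exact: cvg_cst.
  by apply: continuous_powR_max0; lra.
move=> y; apply: cvgB; first by apply: c; lra.
by apply: cvgM; [exact: cvg_cst|apply: c].
Qed.

Lemma continuous_energy : continuous energy.
Proof.
move=> t; apply: cvgD.
  by apply: cvgM; [exact: cvg_id|apply: cvgM; exact: cQ].
by apply: (@continuous_comp _ _ _ F potential); [exact: cF|exact: continuous_potential].
Qed.

Lemma is_derive_energy (t : R) : 0 < t -> 0 < F t <= 1 ->
  is_derive t 1 energy ((1 - N%:R) * (Q t * Q t)).
Proof.
move=> t0 /andP[Ft0 Ft1].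
apply: (is_derive_eq (is_deriveD
  (is_derive_mul (is_derive_id t 1) (is_derive_mul (dQ t0) (dQ t0)))
  (is_derive_comp1 (is_derive_potential Ft0) (dF t)))); rewrite nonlinE ?Ft1 ?(ltW Ft0)//=.
by field; rewrite ?gt_eqF//; lra.
Qed.

Lemma energy_MVT (x y : R) : 0 <= x -> x < y -> (forall s : R, x < s < y -> 0 < F s <= 1) ->
  exists2 c, x < c < y & energy y - energy x = (1 - N%:R) * (Q c * Q c) * (y - x).
Proof.
move=> x0 xy Fs.
have dE (s : R) : s \in `]x, y[ -> is_derive s 1 energy ((1 - N%:R) * (Q s * Q s)).
  rewrite in_itv /= => sxy; apply: is_derive_energy; last exact: Fs.
  by have /andP[xs _] := sxy; exact: le_lt_trans xs.
have [c] := MVT xy dE (continuous_subspaceT continuous_energy).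
by rewrite in_itv /= => cxy E; exists c.
Qed.

Lemma energy_nincr (x y : R) : 0 <= x -> x <= y -> (forall s : R, x < s < y -> 0 < F s <= 1) ->
  energy y <= energy x.
Proof.
have [A0' A1' N2'] : [/\ 0 <= A, A < 1 & 2 <= N%:R :> R] by [].
move=> x0; rewrite le_eqVlt => /predU1P[->//|xy] Fs.
have [c _ E] := energy_MVT x0 xy Fs.
have : 0 <= (N%:R - 1) * (Q c * Q c) * (y - x).
  by rewrite mulr_ge0 ?subr_ge0 ?(ltW xy)// mulr_ge0 -?expr2 ?sqr_ge0//; lra.
by lra.
Qed.

Lemma F_decr (x y : R) : x < y -> (forall s : R, x < s < y -> 0 < Q s) -> F y < F x.
Proof.
move=> xy Qs.
have [c] := @MVT R F (fun t => - Q t) x y xy (fun s _ => dF s) (continuous_subspaceT cF).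
rewrite in_itv /= => /Qs Qc; nra.
Qed.

(** F decreases at first, and the energy with it. If F came back to 1, its energy
would again be at least the initial one. *)
Lemma F_lt1 (T0 : R) : (forall s : R, 0 <= s < T0 -> 0 < F s) ->
  forall t : R, 0 < t < T0 -> F t < 1.
Proof.
have [A0' A1' N2'] : [/\ 0 <= A, A < 1 & 2 <= N%:R :> R] by [].
move=> Fpos t /andP[t0 tT]; rewrite ltNge; apply/negP => Ft.
have [r r0 Qr] : exists2 r : R, 0 < r & forall s : R, `|0 - s| < r -> 0 < Q s.
  have [r /= r0 Hr] := cvgr_gt (Q 0) (@cQ 0) 0 Q00.
  by exists r => // s sr; exact: Hr.
pose x0 := Num.min r t / 2.
have m0 : 0 < Num.min r t by rewrite lt_min r0.
have mr : Num.min r t <= r by rewrite ge_min lexx.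
have mt : Num.min r t <= t by rewrite ge_min lexx orbT.
have x00 : 0 < x0 by rewrite /x0; lra.
have Qx (s : R) : 0 <= s <= x0 -> 0 < Q s.
  move=> /andP[s0 sx]; apply: Qr; rewrite sub0r normrN ger0_norm//.
  by apply: le_lt_trans sx _; rewrite /x0; lra.
have Fx (s : R) : 0 < s <= x0 -> F s < 1.
  move=> /andP[s0 sx]; rewrite -F0; apply: F_decr => // z /andP[z0 zs].
  by apply: Qx; rewrite ltW//= ltW// (lt_le_trans zs).
have [s1 [s10 s1t Fs1 Hs1]] : exists s1, [/\ x0 < s1, s1 <= t, F s1 = 1 &
    forall s : R, x0 <= s < s1 -> F s < 1].
  have cG : continuous (fun s => 1 - F (x0 + s)).
    move=> s; apply: cvgB; first exact: cvg_cst.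
    apply: (@continuous_comp _ _ _ (fun s => x0 + s) F); last exact: cF.
    by apply: cvgD; [exact: cvg_cst|exact: cvg_id].
  have [| | |s [s0 st Gs Hs]] := first_nonpos (t1 := t - x0) cG.
  - by rewrite addr0 subr_gt0 Fx// x00 lexx.
  - by rewrite /x0; lra.
  - by rewrite subrKC subr_le0.
  exists (x0 + s); split; [lra|lra|lra|].
  move=> z /andP[xz zs]; have := Hs (z - x0); rewrite subrKC subr_gt0; apply.
  by apply/andP; split; lra.
have Fs (s : R) : 0 < s < s1 -> 0 < F s <= 1.
  move=> /andP[s0 ss]; apply/andP; split.
    by apply: Fpos; rewrite (ltW s0) (lt_trans ss)// (le_lt_trans s1t).
  have [sx|xs] := leP s x0; first by apply/ltW/Fx; rewrite s0.
  by apply/ltW/Hs1; rewrite (ltW xs).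
have Fsx (s : R) : 0 < s < x0 -> 0 < F s <= 1.
  by move=> /andP[? ?]; apply: Fs; apply/andP; split; lra.
have [c /andP[c0 cx] E1] := energy_MVT (lexx 0) x00 Fsx.
have E2 : energy s1 <= energy x0.
  apply: energy_nincr; [lra|lra|move=> s /andP[? ?]; apply: Fs; apply/andP; split; lra].
have Qc : 0 < Q c by apply: Qx; rewrite (ltW c0) (ltW cx).
have : energy x0 < energy 0.
  by rewrite -subr_lt0 E1 subr0 -mulrA nmulr_rlt0 ?mulr_gt0//; lra.
apply/negP; rewrite -leNgt; apply: le_trans E2.
rewrite /energy mul0r add0r F0 Fs1 lerDr mulr_ge0//; first lra.
by rewrite -expr2 sqr_ge0.
Qed.

(** A nonnegative potential means A y^al / (al + 1) <= y^be / (be + 1), and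
al + 1 < be + 1. *)
Lemma potential_ge0 (y : R) : 0 < y <= 1 -> 0 <= potential y -> 0 < nonlin al be A y.
Proof.
have [al0' albe' be1'] : [/\ 0 < al, al < be & be < 1] by [].
move=> /andP[y0 y1]; rewrite nonlinE ?(ltW y0)// /potential (max_idPr (ltW y0)).
rewrite !powRD ?(gt_eqF y0) ?implybT// !powRr1 ?(ltW y0)//.
have := powR_gt0 be y0; have := powR_gt0 al y0.
move: (y `^ be) (y `^ al) => X Z Z0 X0 H.
have H1 : A * (Z / (al + 1)) <= X / (be + 1).
  rewrite -(ler_pM2l y0) -subr_ge0; move: H; congr (_ <= _).
  by field; rewrite ?gt_eqF//; lra.
have H2 : A * Z * (be + 1) <= X * (al + 1).
  have -> : A * Z * (be + 1) = A * (Z / (al + 1)) * ((al + 1) * (be + 1)) by field; rewrite ?gt_eqF//; lra.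
  have -> : X * (al + 1) = X / (be + 1) * ((al + 1) * (be + 1)) by field; rewrite ?gt_eqF//; lra.
  by rewrite ler_pM2r// mulr_gt0//; lra.
rewrite subr_gt0; have AZ : 0 <= A * Z by rewrite mulr_ge0// ltW.
by nra.
Qed.

Section before_zero.
Variable T0 : R.
Hypotheses (Fpos : forall s : R, 0 <= s < T0 -> 0 < F s).
Hypothesis (ET0 : 0 <= energy T0).

Lemma F_le1 (s : R) : 0 <= s < T0 -> 0 < F s <= 1.
Proof.
move=> sT; rewrite Fpos//=; have /andP[s0 sT0] := sT.
move: s0; rewrite le_eqVlt => /predU1P[<-|s0]; first by rewrite F0.
by rewrite ltW// (F_lt1 Fpos)// s0.
Qed.

Lemma energy_ge0 (s : R) : 0 <= s < T0 -> 0 <= energy s.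
Proof.
move=> /andP[s0 sT]; apply: le_trans ET0 _; apply: energy_nincr => //; first exact: ltW.
move=> z /andP[sz zT]; apply: F_le1; rewrite zT andbT; lra.
Qed.

(** At a first zero of Q the energy is the potential of F, which is thus
nonnegative; then the nonlinearity is positive there, and so is Q'. *)
Lemma Q_gt0 (t : R) : 0 <= t < T0 -> 0 < Q t.
Proof.
move=> /andP[t0 tT]; rewrite ltNge; apply/negP => Qt.
have [t2 [t20 t2t Qt2 Qs]] := first_nonpos cQ Q00 t0 Qt.
have t2T : 0 <= t2 < T0 by rewrite (ltW t20) (le_lt_trans t2t).
have := energy_ge0 t2T; rewrite /energy Qt2 mulr0 mulr0 add0r => P0.
have nl := potential_ge0 (F_le1 t2T) P0.
have [r r0 Hr] : exists2 r : R, 0 < r & forall x : R, t2 - r < x -> x < t2 -> Q x < Q t2.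
  apply: (is_derive_pos_left (dQ t20)).
  by rewrite Qt2 mulr0 subr0 divr_gt0// mulr_gt0.
pose x := t2 - Num.min r t2 / 2.
have m0 : 0 < Num.min r t2 by rewrite lt_min r0.
have mr : Num.min r t2 <= r by rewrite ge_min lexx.
have ms : Num.min r t2 <= t2 by rewrite ge_min lexx orbT.
have : 0 < Q x by apply: Qs; rewrite /x; apply/andP; split; lra.
by rewrite ltNge -Qt2 ltW// Hr// /x; lra.
Qed.

Lemma F_nincr (x y : R) : 0 <= x -> x <= y -> y < T0 -> F y <= F x.
Proof.
move=> x0; rewrite le_eqVlt => /predU1P[->//|xy] yT.
apply/ltW/F_decr => // s /andP[xs sy]; apply: Q_gt0.
by apply/andP; split; lra.
Qed.

Variables (la ka si : R).
Hypotheses (la1 : 1 < la) (la_lt : la * (al + 1) < be + 1).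
Hypotheses (ka0 : 0 < ka) (si1 : 1 <= si) (T0si : T0 <= si * si).
Hypotheses (ka1 : ka * (la * N%:R) <= la - 1).
Hypotheses (ka2 : ka * ka <= 1 / (la * (al + 1)) - 1 / (be + 1)).

(** Either F^(be-al) is at least la A, at t and hence at all earlier times, and
then the nonlinearity is comparable to F^be and its mean N Q is at least of this
order; or the potential at t is negative of order F^(be+1), and nonnegativity of
the energy bounds t Q^2 from below, where t is at most si^2. *)
Lemma Q_lower_bound (t : R) : 0 <= t < T0 -> ka / si * F t `^ ((be + 1) / 2) <= Q t.
Proof.
have [al0' albe' be1'] : [/\ 0 < al, al < be & be < 1] by [].
have [A0' A1' N2'] : [/\ 0 <= A, A < 1 & 2 <= N%:R :> R] by [].
have [la1' lalt' ka0'] : [/\ 1 < la, la * (al + 1) < be + 1 & 0 < ka] by [].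
have [si1' ka1' ka2'] : [/\ 1 <= si, ka * (la * N%:R) <= la - 1 & ka * ka <= 1 / (la * (al + 1)) - 1 / (be + 1)] by [].
move=> tT; have /andP[t0 tT0] := tT.
have /andP[Ft0 Ft1] := F_le1 tT; have Qt := Q_gt0 tT.
have si0 : 0 < si by lra.
set w := F t `^ ((be + 1) / 2).
have w0 : 0 < w by exact: powR_gt0.
have ww : w * w = F t `^ (be + 1).
  by rewrite /w -powRD ?(gt_eqF Ft0) ?implybT//; congr (_ `^ _); lra.
have [C|C] := leP (la * A) (F t `^ (be - al)).
- have NQ : (la - 1) / la * F t `^ be <= N%:R * Q t.
    apply: (@average_ge _ Q (fun s => nonlin al be A (F s))) => //.
      by case: sol => ? ? _ _ _; rewrite F0.
    move=> s /andP[s0 st].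
    have sT : 0 <= s < T0 by rewrite s0 (le_lt_trans st).
    have /andP[Fs0 Fs1] := F_le1 sT.
    have Fts : F t <= F s by exact: F_nincr.
    rewrite nonlinE ?Fs1 ?(ltW Fs0)//.
    have h1 : F t `^ be <= F s `^ be.
      by rewrite ge0_ler_powR ?nnegrE ?(ltW Fs0) ?(ltW Ft0)//; lra.
    have h2 : la * A <= F s `^ (be - al).
      apply: le_trans C _.
      by rewrite ge0_ler_powR ?nnegrE ?(ltW Fs0) ?(ltW Ft0)//; lra.
    have h3 : F s `^ be = F s `^ (be - al) * F s `^ al.
      by rewrite -powRD ?(gt_eqF Fs0) ?implybT// subrK.
    have h4 := powR_gt0 al Fs0.
    have h5 : la * A * F s `^ al <= F s `^ be by rewrite h3 ler_pM2r.
    rewrite mulrAC ler_pdivrMr; last lra.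
    by move: h1 h5; move: (F s `^ be) (F s `^ al) (F t `^ be) => X Z Y; nra.
  have wF : w <= F t `^ be.
    by rewrite /w; apply: ger_powR; [rewrite Ft0|lra].
  have h : ka * w <= Q t.
    have la0 : 0 < la * N%:R by apply: mulr_gt0; lra.
    rewrite -(ler_pM2r la0).
    have la00 : 0 < la by lra.
    have h1 : (la - 1) * F t `^ be <= N%:R * Q t * la.
      by rewrite -ler_pdivrMr// mulrAC.
    have h2 : (la - 1) * w <= (la - 1) * F t `^ be by rewrite ler_pM2l//; lra.
    have h3 : ka * (la * N%:R) * w <= (la - 1) * w by rewrite ler_pM2r.
    by lra.
  apply: le_trans h; rewrite mulrAC ler_pdivrMr//.
  by rewrite ler_peMr// mulr_ge0// ltW.
- have E := energy_ge0 tT.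
  have P : ka * ka * (w * w) <= - potential (F t).
    rewrite /potential (max_idPr (ltW Ft0)) ww opprB.
    have h3 : F t `^ (be + 1) = F t `^ (be - al) * F t `^ (al + 1).
      by rewrite -powRD ?(gt_eqF Ft0) ?implybT//; congr (_ `^ _); lra.
    have h4 := powR_gt0 (al + 1) Ft0; have h5 := powR_gt0 (be + 1) Ft0.
    have h6 : F t `^ (be + 1) <= la * A * F t `^ (al + 1).
      by rewrite h3 ler_pM2r// ltW.
    have h7 : F t `^ (be + 1) / (la * (al + 1)) <= A * (F t `^ (al + 1) / (al + 1)).
      rewrite ler_pdivrMr; last by apply: mulr_gt0; lra.
      rewrite [leRHS](_ : _ = la * A * F t `^ (al + 1))//; field; rewrite ?gt_eqF//; lra.
    apply: (@le_trans _ _ (F t `^ (be + 1) / (la * (al + 1)) - F t `^ (be + 1) / (be + 1))); last first.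
      by rewrite lerB.
    by have := ler_wpM2r (ltW h5) ka2; rewrite mulrBl !mul1r mulrC [X in _ - X]mulrC [X in _ <= X - _]mulrC.
  have h : (ka * w) * (ka * w) <= (si * Q t) * (si * Q t).
    move: E; rewrite /energy; have := mulr_gt0 Qt Qt.
    move: P T0si tT0; rewrite !mulrA; nra.
  rewrite mulrAC ler_pdivrMr// [leRHS]mulrC leNgt; apply/negP => k.
  have k0 : 0 <= si * Q t by rewrite mulr_ge0// ltW.
  by have := ltr_pM k0 k0 k k; rewrite ltNge h.
Qed.

(** By [Q_lower_bound] the function F^((1 - be) / 2), which starts at 1 and stays
positive, decreases at a rate of at least (1 - be) / 2 * ka / si. This is where
be < 1 is essential. *)
Lemma zero_time_bound : (1 - be) / 2 * ka * T0 <= si.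
Proof.
have [al0' albe' be1'] : [/\ 0 < al, al < be & be < 1] by [].
have [si1' ka1' ka2'] : [/\ 1 <= si, ka * (la * N%:R) <= la - 1 & ka * ka <= 1 / (la * (al + 1)) - 1 / (be + 1)] by [].
have si0 : 0 < si by lra.
have [nu nuE] : exists nu, nu = (1 - be) / 2 by exists ((1 - be) / 2).
have nu0 : 0 < nu by lra.
have step (t : R) : 0 < t < T0 -> nu * ka * t <= si.
  move=> /andP[t0 tT].
  pose Y s := F s `^ nu; pose dY s := nu * F s `^ (nu - 1) * - Q s.
  have dYs (s : R) : 0 <= s <= t -> is_derive s 1 Y (dY s).
    move=> /andP[s0 st]; apply: (@is_derive_comp1 R (fun z => z `^ nu) F); last exact: dF.
    by apply: is_derive1_powR; apply: Fpos; rewrite s0 (le_lt_trans st).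
  have dYoo (s : R) : s \in `]0, t[ -> is_derive s 1 Y (dY s).
    by rewrite in_itv /= => /andP[s0 st]; apply: dYs; rewrite (ltW s0) (ltW st).
  have cY : {within `[0, t], continuous Y}.
    apply: derivable_within_continuous => s; rewrite in_itv /= => st.
    by have [] := dYs s st.
  have [c] := MVT t0 dYoo cY.
  rewrite in_itv /= => /andP[c0 ct] E.
  have cT : 0 <= c < T0 by rewrite (ltW c0) (lt_trans ct).
  have Fc := Fpos cT; have Qc := Q_lower_bound cT.
  have dYc : dY c <= - (nu * ka / si).
    rewrite /dY mulrN lerN2 -!mulrA ler_pM2l//.
    apply: (@le_trans _ _ (F c `^ (nu - 1) * (ka / si * F c `^ ((be + 1) / 2)))); last first.
      by rewrite ler_pM2l// powR_gt0.
    rewrite mulrCA -powRD ?(gt_eqF Fc) ?implybT//.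
    rewrite (_ : nu - 1 + _ = 0) ?powRr0 ?mulr1//.
    by lra.
  have Y0 : Y 0 = 1 by rewrite /Y F0 powR1.
  have Yt : 0 <= Y t by exact: powR_ge0.
  have := ler_wpM2r (ltW t0) dYc; move: E; rewrite subr0 Y0 => <- h.
  have : nu * ka / si * t <= 1 by lra.
  by rewrite mulrAC ler_pdivrMr// mul1r.
rewrite -nuE leNgt; apply/negP => k.
have nk : 0 < nu * ka by rewrite mulr_gt0.
have q0 : 0 < si / (nu * ka) by rewrite divr_gt0.
have qT : si / (nu * ka) < T0 by rewrite ltr_pdivrMr// mulrC.
have := step ((si / (nu * ka) + T0) / 2); rewrite leNgt => /(_ _)/negP; apply.
  by apply/andP; split; lra.
by rewrite mulrC -ltr_pdivrMr//; lra.
Qed.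

End before_zero.
End profile.

(** * Existence of a compactly supported profile *)

(** The scheme starts at time 0; for negative times F is continued by its tangent
at 0, which makes it differentiable at 0. *)
Lemma scheme_limit_solution (R : realType) (N : nat) (al be : R) (A_ : nat -> R)
    (U : set_system nat) :
  (1 < N)%N -> 0 < al -> al < be -> (forall n, 0 <= A_ n <= 1) ->
  UltraFilter U -> \oo `<=` U ->
  exists2 F, radial_solution N al be (limA A_ U) F (limQ N al be A_ U) &
    forall t, 0 <= t -> F t = limF N al be A_ U t.
Proof.
move=> N1 al0 albe A01 FU Uoo.
pose Q := limQ N al be A_ U; pose F0 := limF N al be A_ U.
pose F t := if t < 0 then 1 - Q 0 * t else F0 t.
have FE t : 0 <= t -> F t = F0 t by rewrite /F leNgt => /negbTE ->.
have N2 : 2 <= N%:R :> R by exact: N_ge2.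
have F00 : F0 0 = 1 by exact: limF0.
have dF (t : R) : is_derive t 1 F (- Q t).
  have [t0|t0|t0] := ltgtP t 0.
  - have -> : Q t = Q 0 by exact: limQ_neg.
    apply: (@near_eq_is_derive _ _ _ (fun s : R => 1 - Q 0 * s)).
      near=> s; rewrite /F ifT//.
      by near: s; exact: lt_nbhsl.
    have d := is_deriveB (is_derive_cst (1 : R) t (1 : R))
      (is_derive_mul (is_derive_cst (Q 0) t 1) (is_derive_id t (1 : R))).
    apply: (is_derive_eq d).
    by rewrite /cst /= mulr0 addr0 mulr1 sub0r.
  - apply: slope_is_derive => e e0.
    have [d d0 Hd] := limF_slope N1 al0 albe A01 FU Uoo (ltW t0) e0.
    exists (Num.min d t); first by rewrite lt_min d0.
    move=> a b ab _; rewrite !lt_min !ltr_distl => /andP[/andP[? ?] /andP[? ?]].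
    move=> /andP[/andP[? ?] /andP[? ?]].
    rewrite !FE; [|lra|lra]; apply: Hd => //; first lra.
    + by rewrite ltr_distl; apply/andP; split; lra.
    + by rewrite ltr_distl; apply/andP; split; lra.
  - rewrite t0; apply: slope_is_derive => e e0.
    have [d d0 Hd] := limF_slope N1 al0 albe A01 FU Uoo (lexx 0) e0.
    exists d => // a b ab a0b ad bd.
    have [a0|a0] := leP 0 a.
      by rewrite !FE//; [apply: Hd|exact: le_trans ab].
    have b0 : b = 0 by case: a0b => // a00; move: a0; rewrite a00 ltxx.
    rewrite b0 FE// F00 /F a0 (_ : _ - _ = 0); last ring.
    by rewrite normr0 mulr_ge0// ?ltW//; lra.
have dQ (t : R) : 0 < t -> is_derive t 1 Q
    ((nonlin al be (limA A_ U) (F t) - N%:R * Q t) / (2 * t)).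
  move=> t0; apply: slope_is_derive => e e0.
  have [d d0 Hd] := limQ_slope N1 al0 albe A01 FU Uoo t0 e0.
  exists (Num.min d t); first by rewrite lt_min d0.
  move=> a b ab _; rewrite !lt_min !ltr_distl => /andP[/andP[? ?] /andP[? ?]].
  move=> /andP[/andP[? ?] /andP[? ?]].
  rewrite FE; last exact: ltW.
  apply: Hd => //; first lra.
  + by rewrite ltr_distl; apply/andP; split; lra.
  + by rewrite ltr_distl; apply/andP; split; lra.
exists F => //; split=> //.
- by rewrite FE.
- by rewrite limQ0// mulrC divfK// gt_eqF//; lra.
- move=> t; have [t0|t0] := ltP 0 t; first exact: is_derive_cont (dQ t t0).
  have Qt : Q t = Q 0.
    by move: t0; rewrite le_eqVlt => /predU1P[->//|t0]; exact: limQ_neg.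
  rewrite /prop_for /continuous_at -/Q Qt; apply/cvgrPdist_le => e e0.
  have [d d0 Hd] := limQ_continuous_at N1 al0 albe A01 FU Uoo (lexx 0) e0.
  near=> s; have [s0|s0] := ltP s 0.
    by rewrite /Q limQ_neg// subrr normr0 ltW.
  apply: Hd => //; rewrite subr0 ger0_norm//.
  have : s < t + d by near: s; apply: lt_nbhsl; lra.
  lra.
Unshelve. all: by end_near. Qed.

Fixpoint scheme_min (R : realType) (N : nat) (al be h A : R) (k : nat) : R :=
  if k is k'.+1 then
    Num.min (scheme_min N al be h A k') (scheme N al be h A k).1
  else 1.

Lemma scheme_min_le (R : realType) (N : nat) (al be h A : R) (k j : nat) :
  (j <= k)%N -> scheme_min N al be h A k <= (scheme N al be h A j).1.
Proof.
elim: k => [|k IH]; first by rewrite leqn0 => /eqP ->.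
rewrite leq_eqVlt => /predU1P[->|]; first by rewrite /= ge_min lexx orbT.
by rewrite ltnS => /IH; apply: le_trans; rewrite /= ge_min lexx.
Qed.

Lemma scheme_min_attained (R : realType) (N : nat) (al be h A : R) (k : nat) :
  exists2 j, (j <= k)%N & scheme_min N al be h A k = (scheme N al be h A j).1.
Proof.
elim: k => [|k [j jk E]]; first by exists 0%N.
rewrite [scheme_min _ _ _ _ _ _]/=; have [|] := leP (scheme_min N al be h A k) _ => _.
  by exists j => //; exact: leqW.
by exists k.+1.
Qed.

Lemma scheme_min_cvg (R : realType) (N : nat) (al be h a : R) (k : nat) :
  0 < al -> al < be ->
  {for a, continuous (fun A => scheme_min N al be h A k)}.
Proof.
move=> al0 albe; elim: k => [|k IH]; first exact: cvg_cst.
apply: (@continuous_min R R (fun A => scheme_min N al be h A k)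
  (fun A => (scheme N al be h A k.+1).1)) => //.
by have [] := @scheme_cvg R N al be al0 albe _ (nbhs a) _ id a h k.+1 cvg_id.
Qed.

(** The minimum of the scheme over its first k steps is continuous in A, and at
A = 1 it is 1 since the scheme is then constant. Either it is nonnegative at
A = 0, or it vanishes for some A. *)
Lemma shooting (R : realType) (N : nat) (al be h : R) (k : nat) : 0 < al -> al < be ->
  exists2 A : R, 0 <= A <= 1 & 0 <= scheme_min N al be h A k /\
    (A = 0 \/ exists2 j, (j <= k)%N & (scheme N al be h A j).1 = 0).
Proof.
move=> al0 albe; have [m0|m0] := leP 0 (scheme_min N al be h 0 k).
  by exists 0; rewrite ?lexx ?ler01//; split => //; left.
have m1 : scheme_min N al be h 1 k = 1.
  by have [j _ ->] := scheme_min_attained N al be h 1 k; rewrite scheme1.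
have v01 : Num.min (scheme_min N al be h 0 k) (scheme_min N al be h 1 k) <= 0 <=
    Num.max (scheme_min N al be h 0 k) (scheme_min N al be h 1 k).
  by rewrite m1 ge_min le_max (ltW m0) ler01 orbT.
have [A] := IVT ler01
  (continuous_subspaceT (fun a => @scheme_min_cvg R N al be h a k al0 albe)) v01.
rewrite in_itv /= => A01 mA; exists A => //; split; first by rewrite mA.
by right; have [j jk E] := scheme_min_attained N al be h A k; exists j => //; rewrite -E.
Qed.

(** The zeros of the discrete solutions stay in [0, T], so that they converge along
the ultrafilter, and their limit is a zero of F by locally uniform convergence. *)
Lemma shooting_limit (R : realType) (N : nat) (al be T : R) :
  (1 < N)%N -> 0 < al -> al < be -> 0 < T ->
  exists (A : R) (F Q : R -> R), [/\ 0 <= A <= 1, radial_solution N al be A F Q,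
    (forall t, 0 <= t <= T -> 0 <= F t) &
    A = 0 \/ exists2 t, 0 <= t <= T & F t = 0].
Proof.
move=> N1 al0 albe T0.
pose K n := Num.truncn (T * n.+1%:R).
have /choice[A_ HA] : forall n, exists A : R, 0 <= A <= 1 /\
    (0 <= scheme_min N al be (mesh R n) A (K n) /\
    (A = 0 \/ exists2 j, (j <= K n)%N & (scheme N al be (mesh R n) A j).1 = 0)).
  by move=> n; have [A A01 H] := shooting N (mesh R n) (K n) al0 albe; exists A.
have A01 n : 0 <= A_ n <= 1 by case: (HA n).
have [U [FU Uoo]] := ultraFilterLemma eventually_filter.
have [F sol FE] := scheme_limit_solution N1 al0 albe A01 FU Uoo.
have PU : ProperFilter U by exact: ultra_proper.
exists (limA A_ U), F, (limQ N al be A_ U); split => //.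
- exact: limA01.
- move=> t /andP[t0 tT]; rewrite FE//.
  have c0 : (fun _ : nat => 0 : R) @ U --> (0 : R) by exact: cvg_cst.
  have cl : (fun n => (scheme N al be (mesh R n) (A_ n)
      (Num.truncn (t * n.+1%:R))).1) @ U --> limF N al be A_ U t.
    exact: cvg_limF.
  apply: (cvg_ler c0 cl).
  apply: nearW => n /=; have [_ [m0 _]] := HA n; apply: le_trans m0 _.
  by apply: scheme_min_le; apply: le_truncn; rewrite ler_pM2r.
have [UA|UA] := in_ultra_setVsetC [set n | A_ n = 0] FU.
  left; apply/cvg_lim => //.
  have c0 : (fun _ : nat => 0 : R) @ U --> (0 : R) by exact: cvg_cst.
  apply: cvg_trans c0.
  by apply: near_eq_cvg; apply: filterS UA => n /= ->.
right.
have /choice[k Hk] : forall n, exists j, A_ n <> 0 ->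
    (j <= K n)%N /\ (scheme N al be (mesh R n) (A_ n) j).1 = 0.
  move=> n; have [_ [_ [An0|[j jK Fj]]]] := HA n; first by exists 0%N.
  by exists j.
pose tk n : R := if A_ n == 0 then 0 else (k n)%:R * mesh R n.
have tk01 n : 0 <= tk n <= T.
  rewrite /tk; case: eqP => [_|/Hk[kK _]]; first by rewrite lexx ltW.
  rewrite mulr_ge0 ?invr_ge0//=.
  apply: (@le_trans _ _ ((K n)%:R * mesh R n)); first by rewrite ler_pM2r ?invr_gt0// ler_nat.
  by have /andP[] := idx_bound n (ltW T0).
have ctk : tk @ U --> lim (tk @ U).
  apply: (@ultra_bounded_cvg _ _ U FU _ T) => n.
  by have /andP[? ?] := tk01 n; rewrite ger0_norm.
set t := lim (tk @ U) in ctk.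
have t0 : 0 <= t.
  have c0 : (fun _ : nat => 0 : R) @ U --> (0 : R) by exact: cvg_cst.
  by apply: (cvg_ler c0 ctk); apply: nearW => n; have /andP[] := tk01 n.
exists t.
  have cT : (fun _ : nat => T) @ U --> T by exact: cvg_cst.
  rewrite t0/=; apply: (cvg_ler ctk cT); apply: nearW => n.
  by have /andP[] := tk01 n.
rewrite FE//; apply/eqP/negPn/negP => Ft.
have Ft0 : 0 < `|limF N al be A_ U t| by rewrite normr_gt0.
have /cvgrPdist_lt/(_ _ Ft0)[d d0 Hd] := F_grid N1 al0 albe A01 FU Uoo t0.
move/cvgrPdist_lt : ctk => /(_ _ d0) Htk.
have [n [[Hn1 Hn2] An]] := filter_ex (filterI (filterI Hd Htk) UA).
have {}An : A_ n <> 0 := An.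
have [kK F0] := Hk n An.
have := Hn1 (k n); rewrite /= F0 subr0 ltxx => Hf.
suff : false by [].
apply: Hf; by move: Hn2; rewrite /= /tk; case: eqP => // _; rewrite distrC.
Qed.

Definition truncate (R : realType) (T : R) (f : R -> R) (t : R) : R :=
  if t < T then f t else 0.

Lemma is_derive_truncate (R : realType) (T : R) (f : R -> R) (t d : R) :
  f T = 0 -> (t <= T -> is_derive t 1 f d) -> (T <= t -> d = 0) ->
  is_derive t 1 (truncate T f) d.
Proof.
move=> fT0 fd d0; have [tT|tT|tT] := ltgtP t T.
- apply: (@near_eq_is_derive _ _ _ f); last exact: (fd (ltW tT)).
  by near=> s; rewrite /truncate ifT//; near: s; exact: lt_nbhsl.
- apply: (@near_eq_is_derive _ _ _ (cst 0)).
    by near=> s; rewrite /truncate ifF//; apply/negbTE; rewrite -leNgt ltW//; near: s; exact: lt_nbhsr.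
  by rewrite d0 ?ltW//; exact: is_derive_cst.
- have {}d0 : d = 0 by apply: d0; rewrite tT.
  have {}fd : is_derive T 1 f 0 by rewrite -tT -d0; apply: fd; rewrite tT.
  rewrite tT d0; apply: slope_is_derive => e e0.
  have [r r0 Hr] := is_derive_slope fd e0.
  have H x : `|x - T| < r -> `|truncate T f x| <= e * `|x - T|.
    move=> xr; rewrite /truncate; case: ifPn => _; last first.
      by rewrite normr0 mulr_ge0// ltW.
    by have := Hr _ xr; rewrite subrKC fT0 mul0r !subr0.
  have HT : truncate T f T = 0 by rewrite /truncate ltxx.
  exists r => // a b ab [aT|bT] ar br; rewrite mul0r subr0.
    by rewrite aT HT subr0 (le_trans (H _ br))// ger0_norm// subr_ge0 -aT.
  rewrite bT HT sub0r normrN (le_trans (H _ ar))// distrC ger0_norm//.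
  by rewrite subr_ge0 -bT.
Unshelve. all: by end_near. Qed.

(** The shooting solution is nonnegative on [0, T] and by [zero_time_bound] it
vanishes at some t < T. Being an interior minimum, t is a zero of Q as well, so
that F and Q can be continued by 0. *)
Theorem compact_profile (R : realType) (N : nat) (al be : R) :
  (1 < N)%N -> 0 < al -> al < be -> be < 1 ->
  exists (A T : R) (F Q : R -> R), [/\ 0 < A < 1, 0 < T,
    [/\ F 0 = 1, (forall t, 0 <= t -> 0 <= F t <= 1),
        (forall t, T <= t -> F t = 0) & (forall t, T <= t -> Q t = 0)],
    continuous Q /\ N%:R * Q 0 = 1 - A &
    (forall t : R, is_derive t 1 F (- Q t)) /\
    (forall t : R, 0 < t ->
      is_derive t 1 Q ((F t `^ be - A * F t `^ al - N%:R * Q t) / (2 * t)))].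
Proof.
move=> N1 al0 albe be1.
have N2 : 2 <= N%:R :> R by exact: N_ge2.
have be0 : 0 < be by exact: lt_trans albe.
(* la separates the two cases of Q_lower_bound: 1 < la < (be + 1) / (al + 1) *)
have [la [la1 la2]] : exists la : R, 1 < la /\ la * (al + 1) < be + 1.
  exists ((al + be + 2) / (2 * (al + 1))); split.
    by rewrite ltr_pdivlMr; lra.
  rewrite mulrAC ltr_pdivrMr; last lra.
  by nra.
have [ka [ka0 ka1 ka2]] : exists ka : R, [/\ 0 < ka, ka * (la * N%:R) <= la - 1 &
    ka * ka <= 1 / (la * (al + 1)) - 1 / (be + 1)].
  set x := 1 / (la * (al + 1)) - 1 / (be + 1).
  have laa : 0 < la * (al + 1) by apply: mulr_gt0; lra.
  have x0 : 0 < x.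
    rewrite /x subr_gt0 !div1r ltf_pV2// posrE; lra.
  have laN : 0 < la * N%:R by apply: mulr_gt0; lra.
  have y0 : 0 < (la - 1) / (la * N%:R) by rewrite divr_gt0//; lra.
  exists (Num.min (Num.min 1 x) ((la - 1) / (la * N%:R))); split.
  - by rewrite !lt_min ltr01 x0.
  - by rewrite -ler_pdivlMr// ge_min lexx orbT.
  - set k := Num.min _ _.
    have k0 : 0 <= k by rewrite !le_min ler01 !ltW.
    have k1 : k <= 1 by rewrite !ge_min lexx.
    have kx : k <= x by rewrite !ge_min lexx orbT.
    by rewrite (le_trans _ kx)// ler_piMr.
(* T = si^2 is so large that F cannot be positive with nonnegative energy up to T *)
pose nu : R := (1 - be) / 2 * ka.
have nu0 : 0 < nu by apply: mulr_gt0 => //; lra.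
pose si : R := 1 + nu^-1.
have nuV : 0 < nu^-1 by rewrite invr_gt0.
have si1 : 1 <= si by rewrite /si; lra.
pose T := si * si; have T0 : 0 < T by rewrite mulr_gt0//; lra.
have siT : si < nu * T.
  rewrite /T mulrA ltr_pMl; last lra.
  by rewrite /si mulrDr mulr1 divff ?gt_eqF//; lra.
have [A [F [Q [/andP[A0 A1] sol Fge0 HA]]]] := shooting_limit N1 al0 albe T0.
have [F0 NQ0 cQ dF dQ] := sol.
have cF : continuous F by move=> t; exact: is_derive_cont (dF t).
(* for A = 1 the nonlinearity and hence Q would be nonpositive, and F would be
   nondecreasing *)
have {}A1 : A < 1.
  rewrite lt_neqAle A1 andbT; apply/eqP => A1'.
  have nl y : nonlin al be A y <= 0.
    rewrite A1' /nonlin mul1r subr_le0.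
    have [->|y0] := eqVneq (clamp y) 0; first by rewrite !powR0 ?gt_eqF.
    apply: ger_powR; last exact: ltW.
    by rewrite lt_neqAle eq_sym y0 clamp_ge0 clamp_le1.
  have Qle (t : R) : 0 <= t -> N%:R * Q t <= 0.
    move=> t0; apply: (@average_le R Q (fun s => nonlin al be A (F s)) _ 0 t) => //.
    - exact: lt_le_trans N2.
    - by rewrite F0.
  have [A00|[t /andP[t0 tT] Ft]] := HA; first by move: A1'; rewrite A00; lra.
  have [t00|t00] := eqVneq t 0; first by move: Ft; rewrite t00 F0; lra.
  have tpos : 0 < t by rewrite lt_neqAle eq_sym t00.
  have [c] := MVT tpos (fun s _ => dF s) (continuous_subspaceT cF).
  rewrite in_itv /= => /andP[c0 ct]; rewrite Ft F0 subr0 => E.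
  have := Qle c (ltW c0); rewrite pmulr_rle0; last lra.
  by move: E; nra.
have tb T0' : T0' <= T -> (forall s, 0 <= s < T0' -> 0 < F s) ->
    0 <= energy al be A F Q T0' -> T0' < T.
  move=> T0T Fs E.
  have := zero_time_bound N1 al0 albe be1 A0 A1 sol Fs E la1 la2 ka0 si1 T0T ka1 ka2.
  rewrite -/nu => h; rewrite -(ltr_pM2l nu0); exact: le_lt_trans siT.
have [t [t0 tT Ft Fpos]] : exists t, [/\ 0 < t, t <= T, F t = 0 &
    forall s, 0 <= s < t -> 0 < F s].
  have [[z /andP[z0 zT] Fz]|nz] := pselect (exists2 z, 0 <= z <= T & F z = 0).
    have [|||s [s0 sz Fs Hs]] := first_nonpos (f := F) (t1 := z) cF => //.
    - by rewrite F0.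
    - by rewrite Fz.
    - by exists s; split => //; exact: le_trans zT.
  have [A00|//] := HA.
  have FT s : 0 <= s <= T -> 0 < F s.
    move=> sT; rewrite lt_neqAle Fge0// andbT; apply/eqP => Fs.
    by apply: nz; exists s.
  suff : T < T by rewrite ltxx.
  apply: tb => //.
    by move=> s /andP[s0 sT]; apply: FT; rewrite s0 ltW.
  rewrite /energy /potential A00 mul0r subr0 addr_ge0//.
    by rewrite mulr_ge0 ?(ltW T0)// -expr2 sqr_ge0.
  by rewrite divr_ge0 ?powR_ge0//; lra.
have Pt : potential al be A (F t) = 0.
  have b1 : be + 1 != 0 by rewrite gt_eqF//; lra.
  have a1 : al + 1 != 0 by rewrite gt_eqF//; lra.
  rewrite Ft /potential (max_idPl (lexx 0)) !powR0//.
  by rewrite !mul0r mulr0 subrr.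
have Et : 0 <= energy al be A F Q t.
  by rewrite /energy Pt addr0 mulr_ge0 ?(ltW t0)// -expr2 sqr_ge0.
have {}tT : t < T by exact: tb.
have Qt : Q t = 0.
  apply/eqP; rewrite -oppr_eq0; apply/eqP.
  apply: (is_derive_local_min (dF t) (r := Num.min t (T - t))).
    by rewrite lt_min t0 subr_gt0.
  move=> x; rewrite lt_min !ltr_distl => /andP[/andP[? ?] /andP[? ?]].
  by rewrite Ft Fge0//; apply/andP; split; lra.
have Qpos (s : R) : 0 <= s < t -> 0 < Q s by exact: (Q_gt0 N1 al0 albe be1 A0 A1 sol Fpos Et).
have Apos : 0 < A.
  rewrite lt_neqAle A0 andbT; apply/eqP => A00.
  (* for A = 0 the square of s^(N/2) Q would increase on [0, t] *)
  have dG (s : R) : 0 < s -> is_derive s 1 (fun s => s ^+ N * (Q s * Q s))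
      (s ^+ N.-1 * Q s * nonlin al be A (F s)).
    move=> s0; have dX : is_derive s 1 (fun x : R => x ^+ N) (N%:R * s ^+ N.-1 *: (1 : R)).
      by apply: DeriveDef; [exact: exprn_derivable|exact: exp_derive].
    apply: (is_derive_eq (is_derive_mul dX (is_derive_mul (dQ s s0) (dQ s s0)))).
    rewrite /GRing.scale /= mulr1 -[in LHS](prednK (ltnW N1)) exprS prednK ?(ltnW N1)//.
    by field; rewrite gt_eqF.
  have th : 0 < t / 2 < t by apply/andP; split; lra.
  have /andP[th0 tht] := th.
  have cG : {within `[t / 2, t], continuous (fun s => s ^+ N * (Q s * Q s))}.
    apply: derivable_within_continuous => s; rewrite in_itv /= => /andP[s0 _].
    by have [] := dG s (lt_le_trans th0 s0).
  have dG' (s : R) : s \in `]t / 2, t[ -> is_derive s 1 (fun s => s ^+ N * (Q s * Q s))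
      (s ^+ N.-1 * Q s * nonlin al be A (F s)).
    by rewrite in_itv /= => /andP[s0 _]; apply: dG; exact: lt_trans s0.
  have [c] := MVT tht dG' cG; rewrite in_itv /= => /andP[c0 ct].
  rewrite Qt !mulr0 sub0r => E.
  have : 0 < (t / 2) ^+ N * (Q (t / 2) * Q (t / 2)).
    have Qh : 0 < Q (t / 2) by apply: Qpos; rewrite tht ltW.
    by rewrite !mulr_gt0// exprn_gt0.
  rewrite -oppr_lt0 E; apply/negP; rewrite -leNgt.
  have cpos : 0 < c by exact: lt_trans c0.
  rewrite mulr_ge0//; last by rewrite subr_ge0 ltW.
  rewrite mulr_ge0//.
    by rewrite mulr_ge0 ?exprn_ge0 ?(ltW cpos)// ltW// Qpos// (ltW cpos).
  by rewrite /nonlin -A00 mul0r subr0 powR_ge0.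
have F01 (s : R) : 0 <= s < t -> 0 < F s <= 1.
  exact: (F_le1 N1 al0 albe be1 A0 A1 sol Fpos).
have trE (f : R -> R) (s : R) : f t = 0 -> s <= t -> truncate t f s = f s.
  by move=> ft; rewrite /truncate le_eqVlt => /predU1P[->|->//]; rewrite ltxx ft.
have tr0 (f : R -> R) (s : R) : t <= s -> truncate t f s = 0.
  by move=> ts; rewrite /truncate ltNge ts.
have dQt (s : R) : 0 < s -> is_derive s 1 (truncate t Q)
    ((truncate t F s `^ be - A * truncate t F s `^ al - N%:R * truncate t Q s) / (2 * s)).
  move=> s0; apply: is_derive_truncate => // st.
    rewrite !trE//; apply: (is_derive_eq (dQ s s0)); congr ((_ - _) / _).
    apply: nonlinE; move: st; rewrite le_eqVlt => /predU1P[->|st].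
      by rewrite Ft lexx ler01.
    have /andP[/ltW Fs0 Fs1] : 0 < F s <= 1 by apply: F01; rewrite st ltW.
    by rewrite Fs0.
  by rewrite !tr0// !powR0 ?gt_eqF// !mulr0 !subr0 mul0r.
exists A, t, (truncate t F), (truncate t Q); split => //.
- by rewrite Apos.
- split; [by rewrite trE// ltW| |exact: tr0|exact: tr0].
  move=> s s0; rewrite /truncate; case: ifPn => st; last by rewrite lexx ler01.
  have /andP[/ltW Fs0 Fs1] : 0 < F s <= 1 by apply: F01; rewrite s0.
  by rewrite Fs0.
- split; last first.
    rewrite trE// ?ltW// NQ0 /nonlin clamp_id ?ler01 ?lexx//.
    by rewrite !powR1 mulr1.
  move=> s; have [s0|s0] := ltP 0 s; first exact: is_derive_cont (dQt s s0).
  rewrite /prop_for /continuous_at trE//; last by rewrite (le_trans s0)// ltW.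
  apply: cvg_trans (cQ s); apply: near_eq_cvg; near=> x.
  by rewrite trE// ltW//; near: x; apply: lt_nbhsl; exact: le_lt_trans t0.
- split => // s; apply: is_derive_truncate => // ts; first by rewrite trE.
  by rewrite tr0// oppr0.
Unshelve. all: by end_near. Qed.

(** * The Lebesgue measure on R^n: cubes and affine maps *)

Section cubes.
Context {R : realType}.

Lemma rV_ballE n (c : 'rV[R]_n) (e : R) : 0 < e ->
  ball c e = [set x : 'rV[R]_n | forall i, `|c ord0 i - x ord0 i| < e].
Proof.
move=> e0; apply/seteqP; split=> x /=; first by move=> [_ H] i; exact: H.
by move=> H; split => // i j; rewrite !ord1; exact: H.
Qed.

Lemma measurable_rV_ball n (c : 'rV[R]_n) (e : R) : 0 < e -> measurable (ball c e).
Proof.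
move=> e0; rewrite rV_ballE//.
rewrite (_ : [set x | _] = \big[setI/setT]_(i < n) (rV_coord i @^-1` ball (c ord0 i) e)).
  apply: bigsetI_measurable => i _; rewrite -[X in measurable X]setTI.
  apply: measurable_rV_coord => //.
  exact: measurable_ball.
rewrite -bigcap_seq; apply/seteqP; split=> x /=; first by move=> H i _; exact: H.
by move=> H i; apply: H; rewrite /= mem_index_enum.
Qed.

(** An open set is a countable union of cubes with rational centres and radii
1 / (m + 1). *)
Lemma open_measurable_rV n (U : set 'rV[R]_n) : open U -> measurable U.
Proof.
move=> oU.
pose V (q : 'rV[rat]_n * nat) : set 'rV[R]_n :=
  if pselect (ball (map_mx ratr q.1 : 'rV[R]_n) (q.2.+1%:R^-1) `<=` U)
  then ball (map_mx ratr q.1 : 'rV[R]_n) (q.2.+1%:R^-1) else set0.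
rewrite (_ : U = \bigcup_q V q).
  apply: countable_bigcupT_measurable => //.
  move=> q; rewrite /V; case: pselect => [?|?]; last exact: measurable0.
  exact: measurable_rV_ball.
apply/seteqP; split=> [x Ux|x [q _]]; last by rewrite /V; case: pselect => //; exact.
have [e /= e0 eU] : exists2 e : R, 0 < e & ball x e `<=` U.
  by have [e /= e0 eU] := (nbhs_ballP _ _).1 (open_nbhs_nbhs (conj oU Ux)); exists e.
have [m me] : exists m : nat, m.+1%:R^-1 < e / 2.
  have [m _ Hm] := @near_infty_natSinv_lt R (PosNum (divr_gt0 e0 (ltr0n _ 2))).
  by exists m; exact: (Hm m (leqnn m)).
have m0 : 0 < m.+1%:R^-1 :> R by rewrite invr_gt0.
have /choice[q qx] : forall i, exists q : rat, `|ratr q - x ord0 i| < m.+1%:R^-1.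
  move=> i; have [q] : exists q : rat, ratr q \in `](x ord0 i - m.+1%:R^-1), (x ord0 i)[.
    by apply: rat_in_itvoo; rewrite ltrBlDr ltrDl.
  rewrite in_itv /= => /andP[q1 q2]; exists q; rewrite ltr_distl q1 /=.
  by rewrite (lt_trans q2)// ltrDl.
exists (\row_i q i, m) => //; rewrite /V; case: pselect => [sub|] /=; rewrite rV_ballE//=.
  by move=> i; rewrite !mxE; exact: qx.
case=> y /= Hy; apply: eU; rewrite rV_ballE// => i.
have := Hy i; have := qx i; rewrite !mxE distrC => h1 h2.
apply: le_lt_trans (ler_distD (ratr (q i)) _ _) _.
by apply: lt_trans (ltrD h1 h2) _; rewrite [ltRHS]splitr ltrD.
Qed.

Lemma continuous_measurable_rV n (f : 'rV[R]_n -> R) : continuous f ->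
  measurable_fun [set: 'rV[R]_n] f.
Proof.
move=> /continuousP cf; apply: (measurability _ (RGenOpens.measurableE R)).
move=> _ [_ [a [b ->] <-]]; rewrite setTI; apply: open_measurable_rV.
exact/cf/interval_open.
Qed.

Lemma lebesgue_rVS n (A : set 'rV[R]_n.+1) : lebesgue_rV R n.+1 A =
  (lebesgue_measure \x lebesgue_rV R n)%E (@rV_cons R n @^-1` A).
Proof. by []. Qed.

Lemma rV_cons_coord n (p : measurableTypeR R * 'rV[R]_n) (P : R -> R -> Prop) (c : 'rV[R]_n.+1) :
  (forall i, P (c ord0 i) (rV_cons p ord0 i)) <->
  P (c ord0 ord0) p.1 /\ forall i, P ((@rsubmx R 1 1 n c) ord0 i) (p.2 ord0 i).
Proof.
have c0 : rV_cons p ord0 ord0 = p.1 by have := rV_consK p; case: p => a b [].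
have cr i : rV_cons p ord0 (rshift 1 i) = p.2 ord0 i by rewrite /rV_cons (@row_mxEr R 1 1 n).
split=> [H|[H0 H1] i].
  by split=> [|i]; [rewrite -c0; exact: H|rewrite mxE -cr; exact: H].
case: (@split_ordP 1 n i) => j ->.
  by rewrite (_ : lshift n j = ord0) ?c0//; apply/val_inj; rewrite /= ord1.
by rewrite cr; have := H1 j; rewrite mxE.
Qed.

Lemma lebesgue_rV_ball n (c : 'rV[R]_n) (e : R) : 0 < e ->
  lebesgue_rV R n (ball c e) = ((2 * e) ^+ n)%:E.
Proof.
move=> e0; elim: n c => [|n IH] c.
  rewrite expr0 /= diracE mem_set// rV_ballE//= => i; by case: i.
rewrite lebesgue_rVS (_ : _ @^-1` _ = ball (c ord0 ord0) e `*` ball (@rsubmx R 1 1 n c) e).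
  rewrite product_measure1E//; [|exact: measurable_ball|exact: measurable_rV_ball].
  rewrite IH exprS EFinM; congr (_ * _)%E; rewrite mulr_natl.
  exact: (lebesgue_measure_ball _ (ltW e0)).
apply/seteqP; split=> p /=; rewrite !rV_ballE//=.
  by move=> /(@rV_cons_coord n p (fun a b => `|a - b| < e)).
by move=> H; apply/(@rV_cons_coord n p (fun a b => `|a - b| < e)).
Qed.

Definition affine n (x0 : 'rV[R]_n) (rho : R) (x : 'rV[R]_n) := x0 + rho *: x.

Lemma measurable_affine n (x0 : 'rV[R]_n) (rho : R) :
  measurable_fun [set: 'rV[R]_n] (affine x0 rho).
Proof.
apply: measurable_fun_rVP => i.
rewrite (_ : _ \o _ = fun x : 'rV[R]_n => x0 ord0 i + rho * rV_coord i x); last first.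
  by apply/funext => x; rewrite /rV_coord /affine /= !mxE.
apply: measurable_funD => //; apply: measurable_funM => //.
exact: measurable_rV_coord.
Qed.

(** As functions of A, both sides are measures up to the factor rho, and they agree
on half-open intervals. *)
Lemma lebesgue_measure_affine (t0 rho : R) (A : set R) : 0 < rho -> measurable A ->
  lebesgue_measure ((fun t => t0 + rho * t) @^-1` A) = (rho^-1%:E * lebesgue_measure A)%E.
Proof.
move=> rho0 mA.
have mf : measurable_fun [set: measurableTypeR R] (fun t : measurableTypeR R => t0 + rho * t : measurableTypeR R).
  by apply: measurable_funD => //; exact: measurable_funM.
have rho1 : 0 <= rho by exact: ltW.
pose pm := measure_function_pushforward__canonical__measure_function_Measure
  lebesgue_measure mf.
pose m := mscale (NngNum rho1) pm.
suff mE X : ocitv X -> lebesgue_measure X = m X.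
  rewrite (lebesgue_measure_unique mE mA) /m /mscale /= muleA -EFinM.
  by rewrite mulVf ?gt_eqF// mul1e.
move=> [[a b] _ <-].
rewrite /m /mscale /= /pushforward.
rewrite (_ : _ @^-1` _ = `](a - t0) / rho, (b - t0) / rho]%classic); last first.
  apply/seteqP; split=> t /=; rewrite !in_itv /= ltr_pdivrMr// ler_pdivlMr//.
    by move=> /andP[? ?]; apply/andP; split; lra.
  by move=> /andP[? ?]; apply/andP; split; lra.
rewrite !lebesgue_measure_itv /= !lte_fin ltr_pM2r ?invr_gt0// ltrD2r.
case: ifPn => _; last by rewrite mule0.
by rewrite /= -EFinM; congr EFin; field; rewrite gt_eqF.
Qed.

Lemma ge0_integral_affine (t0 rho : R) (g : R -> \bar R) : 0 < rho ->
  measurable_fun [set: measurableTypeR R] g -> (forall t, 0 <= g t)%E ->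
  (\int[lebesgue_measure]_t g (t0 + rho * t)%R = rho^-1%:E * \int[lebesgue_measure]_t g t)%E.
Proof.
move=> rho0 mg g0.
have mf : measurable_fun [set: measurableTypeR R]
    (fun t : measurableTypeR R => t0 + rho * t : measurableTypeR R).
  by apply: measurable_funD => //; exact: measurable_funM.
have rho1 : 0 <= rho^-1 by rewrite invr_ge0 ltW.
have /= <- := @ge0_integral_pushforward _ _ _ _ R _ mf lebesgue_measure setT g measurableT mg (fun y _ => g0 y).
rewrite -(@ge0_integral_mscale _ _ R lebesgue_measure setT measurableT (NngNum rho1))//.
by apply: eq_measure_integral => A mA _; exact: lebesgue_measure_affine.
Qed.

Lemma affine_cons n (x0 : 'rV[R]_n.+1) (rho t : R) (y : 'rV[R]_n) :
  affine x0 rho (rV_cons (t, y)) =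
  rV_cons (x0 ord0 ord0 + rho * t, affine (@rsubmx R 1 1 n x0) rho y).
Proof.
apply/rowP => i; rewrite /affine [LHS]mxE [X in _ + X]mxE.
have e0 (p : measurableTypeR R * 'rV[R]_n) : rV_cons p ord0 ord0 = p.1.
  by have := rV_consK p; case: p => a b [].
case: (@split_ordP 1 n i) => j ->.
  by rewrite (_ : lshift n j = ord0) ?e0//; apply/val_inj; rewrite /= ord1.
by rewrite /rV_cons !(@row_mxEr R 1 1 n) !mxE.
Qed.

(** Induction on the dimension by slicing along the first coordinate, which is
compatible with affine maps of this form. *)
Lemma lebesgue_rV_affine n (x0 : 'rV[R]_n) (rho : R) (A : set 'rV[R]_n) :
  0 < rho -> measurable A ->
  lebesgue_rV R n (affine x0 rho @^-1` A) = ((rho ^- n)%:E * lebesgue_rV R n A)%E.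
Proof.
move=> rho0; elim: n x0 A => [|n IH] x0 A mA.
  rewrite expr0 invr1 mul1e; congr (lebesgue_rV R 0 _).
  by apply/funext => x; rewrite /preimage /= (thinmx0 (affine x0 rho x)) (thinmx0 x).
rewrite !lebesgue_rVS.
pose B := @rV_cons R n @^-1` A.
have mB : measurable B by rewrite -[X in measurable X]setTI; exact: measurable_rV_cons.
pose g t := lebesgue_rV R n (xsection B t).
have mg : measurable_fun setT g by exact: measurable_fun_xsection.
have g0 t : (0 <= g t)%E by exact: measure_ge0.
have mf : measurable_fun [set: measurableTypeR R]
    (fun t : measurableTypeR R => x0 ord0 ord0 + rho * t : measurableTypeR R).
  by apply: measurable_funD => //; exact: measurable_funM.
transitivity (\int[lebesgue_measure]_t ((rho ^- n)%:E * g (x0 ord0 ord0 + rho * t)%R))%E.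
  apply: eq_integral => t _; rewrite /= /g -(IH (@rsubmx R 1 1 n x0)); last exact: measurable_xsection.
  congr (lebesgue_rV R n _); rewrite !xsectionE.
  by apply/funext => y; rewrite /B /preimage /= affine_cons.
rewrite ge0_integralZl//; last 2 first.
- by apply: measurableT_comp => //.
- by rewrite lee_fin invr_ge0 exprn_ge0// ltW.
rewrite ge0_integral_affine// muleA -EFinM; congr (_%:E * _)%E.
by rewrite exprS invfM mulrC.
Qed.

Lemma ge0_integral_rV_affine n (x0 : 'rV[R]_n) (rho : R) (f : 'rV[R]_n -> \bar R) :
  0 < rho -> measurable_fun [set: 'rV[R]_n] f -> (forall x, 0 <= f x)%E ->
  (\int[lebesgue_rV R n]_x f (affine x0 rho x) =
   (rho ^- n)%:E * \int[lebesgue_rV R n]_x f x)%E.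
Proof.
move=> rho0 mf f0; have mphi := @measurable_affine n x0 rho.
have rho1 : 0 <= rho ^- n by rewrite invr_ge0 exprn_ge0// ltW.
have /= <- := @ge0_integral_pushforward _ _ _ _ R _ mphi (lebesgue_rV R n) setT f measurableT mf (fun y _ => f0 y).
rewrite -(@ge0_integral_mscale _ _ R (lebesgue_rV R n) setT measurableT (NngNum rho1))//.
by apply: eq_measure_integral => A mA _; exact: lebesgue_rV_affine.
Qed.

(** With rho the scale of a concentrated solution this computes its Dirichlet
integral; with rho = 1 it is the translation invariance behind integration by
parts. *)
Lemma Rintegral_rV_affine n (x0 : 'rV[R]_n) (rho : R) (f : 'rV[R]_n -> R) :
  0 < rho -> (lebesgue_rV R n).-integrable setT (EFin \o f) ->
  \int[lebesgue_rV R n]_x f (affine x0 rho x) =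
  rho ^- n * \int[lebesgue_rV R n]_x f x.
Proof.
move=> rho0 intf; rewrite /Rintegral.
have mE : measurable_fun [set: 'rV[R]_n] (EFin \o f) by exact: measurable_int intf.
have pE := fineK (integrable_pos_fin_num measurableT intf).
have nE := fineK (integrable_neg_fin_num measurableT intf).
rewrite [in LHS]integralE [in RHS]integralE.
have -> : (\int[lebesgue_rV R n]_x (fun x => (f (affine x0 rho x))%:E)^\+ x =
    (rho ^- n)%:E * \int[lebesgue_rV R n]_x ((EFin \o f)^\+ x))%E.
  rewrite -(ge0_integral_rV_affine x0 rho0)//.
    by apply: eq_integral => x _; rewrite unlock.
  exact: measurable_funepos.
have -> : (\int[lebesgue_rV R n]_x (fun x => (f (affine x0 rho x))%:E)^\- x =
    (rho ^- n)%:E * \int[lebesgue_rV R n]_x ((EFin \o f)^\- x))%E.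
  rewrite -(ge0_integral_rV_affine x0 rho0)//.
    by apply: eq_integral => x _; rewrite unlock.
  exact: measurable_funeneg.
by rewrite -pE -nE -!EFinM -!EFinB /= mulrBr.
Qed.

End cubes.

(** * Continuous functions with bounded support *)

Section compactly_supported.
Context {R : realType} {n : nat}.
Local Notation mu := (lebesgue_rV R n).
Implicit Types f g : 'rV[R]_n -> R.

Definition cont_bounded_support f :=
  continuous f /\ exists L : R, forall x : 'rV[R]_n, L < `|x| -> f x = 0.

Lemma cbs_ge0_radius f : cont_bounded_support f ->
  exists2 L : R, 0 < L & forall x : 'rV[R]_n, L < `|x| -> f x = 0.
Proof.
move=> [_ [L HL]]; exists (`|L| + 1); first by have := normr_ge0 L; lra.
move=> x Lx; apply: HL; apply: le_lt_trans Lx; have := ler_norm L; lra.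
Qed.

Lemma cbs_bounded f : cont_bounded_support f ->
  exists2 C : R, 0 < C & forall x, `|f x| <= C.
Proof.
move=> fs; have [L L0 HL] := cbs_ge0_radius fs; have [cf _] := fs.
pose A : set 'rV[R]_n := [set x | `|x| <= L].
have A0 : A !=set0 by exists 0; rewrite /A /= normr0 ltW.
have cA : compact A.
  apply: bounded_closed_compact.
    by exists L; split; [exact: num_real|move=> M LM x /= xL; exact: le_trans (ltW LM)].
  rewrite (_ : A = (fun x : 'rV[R]_n => `|x|) @^-1` [set y | y <= L])//.
  by apply: preimage_closed => [x _|]; [exact: norm_continuous|exact: closed_le].
have cnf : {within A, continuous (fun x => `|f x|)}.
  apply: continuous_subspaceT => x.
  by apply: (@continuous_comp _ _ _ f (fun y : R => `|y|)); [exact: cf|exact: norm_continuous].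
have [c _ Hc] := compact_EVT_max A0 cA cnf.
exists (`|f c| + 1); first by have := normr_ge0 (f c); lra.
move=> x; have [xL|Lx] := leP `|x| L.
  have /Hc : x \in A by rewrite inE.
  lra.
by rewrite HL// normr0; have := normr_ge0 (f c); lra.
Qed.

Lemma cbs_integrable f : cont_bounded_support f -> mu.-integrable setT (EFin \o f).
Proof.
move=> fs; have [L L0 HL] := cbs_ge0_radius fs; have [C C0 HC] := cbs_bounded fs.
have [cf _] := fs.
have L1 : 0 < L + 1 by lra.
have mB := @measurable_rV_ball R n 0 _ L1.
have Bfin : (mu (ball (0 : 'rV[R]_n) (L + 1))%R < +oo)%E.
  by rewrite lebesgue_rV_ball// ltry.
have : mu.-integrable (ball (0 : 'rV[R]_n) (L + 1)) (EFin \o f).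
  apply: measurable_bounded_integrable => //.
  - by apply: measurable_funTS; exact: continuous_measurable_rV.
  - by exists C; split; [exact: num_real|move=> M CM x _; exact: le_trans (ltW CM)].
move/(integrable_mkcond _ mB); congr (integrable _ _ _).
apply/funext => x; rewrite /patch; case: ifPn => // /negP xB.
rewrite /= HL//; rewrite ltNge; apply/negP => xL; apply: xB; rewrite inE mx_norm_ball /ball_ /=.
by rewrite sub0r normrN; apply: le_lt_trans xL _; rewrite ltrDl.
Qed.

Lemma cbsM f g : cont_bounded_support f -> continuous g ->
  cont_bounded_support (fun x => f x * g x).
Proof.
move=> [cf [L HL]] cg; split; first by move=> x; exact: (cvgM (cf x) (cg x)).
by exists L => x /HL ->; rewrite mul0r.
Qed.

Lemma cbsD f g : cont_bounded_support f -> cont_bounded_support g ->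
  cont_bounded_support (fun x => f x + g x).
Proof.
move=> [cf [L HL]] [cg [K HK]]; split; first by move=> x; exact: (cvgD (cf x) (cg x)).
exists (Num.max L K) => x; rewrite gt_max => /andP[Lx Kx].
by rewrite HL// HK// addr0.
Qed.

Lemma cbsZ (k : R) f : cont_bounded_support f -> cont_bounded_support (fun x => k * f x).
Proof.
move=> [cf [L HL]]; split; first by move=> x; exact: (cvgM (cvg_cst _) (cf x)).
by exists L => x /HL ->; rewrite mulr0.
Qed.

Lemma cbsB f g : cont_bounded_support f -> cont_bounded_support g ->
  cont_bounded_support (fun x => f x - g x).
Proof.
move=> fs gs; have := cbsD fs (cbsZ (-1) gs); congr (cont_bounded_support _).
by apply/funext => x; rewrite mulN1r.
Qed.

Lemma is_derive_lineP (V : normedModType R) (f : V -> R) (x v : V) (s d : R) :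
  is_derive (x + s *: v) v f d <-> is_derive s 1 (fun t => f (x + t *: v)) d.
Proof.
have E : (fun h : R => h^-1 *: ((f \o shift (x + s *: v)) (h *: v) - f (x + s *: v))) =
  (fun h : R => h^-1 *: (((fun t => f (x + t *: v)) \o shift s) (h *: (1 : R)) - f (x + s *: v))).
  apply/funext => h; rewrite /= (_ : h *: 1 = h); last exact: mulr1.
  by rewrite scalerDl addrCA.
by split=> -[d1 d2]; apply: DeriveDef; rewrite /derivable /derive ?E// -?E.
Qed.

(** The difference quotients of f have integral 0 by translation invariance, and by
the mean value theorem they are bounded by the supremum of g on a fixed bounded
set, so that dominated convergence applies. *)
Lemma cbs_derive0 f (i : 'I_n) g : cont_bounded_support f -> cont_bounded_support g ->
  (forall x, is_derive x (delta_mx ord0 i : 'rV[R]_n) f (g x)) ->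
  \int[mu]_x g x = 0.
Proof.
move=> fs gs dfg; set v : 'rV[R]_n := delta_mx ord0 i.
have [L L0 HL] := cbs_ge0_radius fs; have [C C0 HC] := cbs_bounded gs.
have [cf _] := fs; have [cg _] := gs.
pose h (k : nat) : R := k.+1%:R^-1.
have h0 k : 0 < h k by rewrite /h invr_gt0.
have h1 k : h k <= 1 by rewrite /h invf_le1// ler1n.
pose D k x := (h k)^-1 * (f (affine (h k *: v) 1 x) - f x).
have aE k x : affine (h k *: v) 1 x = x + h k *: v by rewrite /affine scale1r addrC.
have fas k : cont_bounded_support (fun x => f (affine (h k *: v) 1 x)).
  split.
    move=> x; apply: (@continuous_comp _ _ _ (affine (h k *: v) 1) f); last exact: cf.
    rewrite (_ : affine _ _ = fun x => x + h k *: v); last by apply/funext => y; exact: aE.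
    exact: (cvgD cvg_id (cvg_cst _)).
  exists (L + `|v|) => x Lx; apply: HL; rewrite aE.
  have : `|x| <= `|x + h k *: v| + `|h k *: v|.
    by rewrite -{1}(addrK (h k *: v) x) ler_normB.
  rewrite normrZ ger0_norm ?(ltW (h0 k))//.
  have : h k * `|v| <= `|v| by rewrite ler_piMl.
  lra.
have Ds k : cont_bounded_support (D k) by apply: cbsZ; exact: cbsB.
have ID k : \int[mu]_x D k x = 0.
  rewrite RintegralZl//; last by apply: cbs_integrable; exact: cbsB.
  rewrite RintegralB//; [|exact: cbs_integrable|exact: cbs_integrable].
  rewrite Rintegral_rV_affine//; last exact: cbs_integrable.
  by rewrite expr1n invr1 mul1r subrr mulr0.
have DC k x : `|D k x| <= C.
  have dl (s : R) : is_derive s 1 (fun t => f (x + t *: v)) (g (x + s *: v)).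
    exact: (proj1 (@is_derive_lineP _ f x v s _) (dfg _)).
  have cl : {within `[0, h k], continuous (fun t => f (x + t *: v))}.
    by apply: derivable_within_continuous => s _; have [] := dl s.
  have [c _] := MVT (h0 k) (fun s _ => dl s) cl.
  rewrite scale0r addr0 subr0 /D aE => ->.
  by rewrite mulrC mulfK ?gt_eqF.
pose K := L + `|v| + 1.
have K0 : 0 < K by rewrite /K; have := normr_ge0 v; lra.
pose b : 'rV[R]_n -> R := (fun _ => C) \_ (ball (0 : 'rV[R]_n) K).
have mB := @measurable_rV_ball R n 0 _ K0.
have Bfin : (mu (ball (0 : 'rV[R]_n) K)%R < +oo)%E.
  by rewrite lebesgue_rV_ball// ltry.
have ib : mu.-integrable setT (EFin \o b).
  rewrite (_ : EFin \o b = (EFin \o (fun _ => C)) \_ (ball (0 : 'rV[R]_n) K)); last first.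
    by apply/funext => x; rewrite /b /patch /=; case: ifPn.
  apply/(integrable_mkcond _ mB); apply: measurable_bounded_integrable => //.
  exists C; split; first exact: num_real.
  by move=> M CM x _; rewrite /= ger0_norm ltW.
have Db k x : `|D k x| <= b x.
  rewrite /b /patch; case: ifPn => [_|/negP xB]; first exact: DC.
  have xK : K <= `|x|.
    rewrite leNgt; apply/negP => xK; apply: xB; rewrite inE mx_norm_ball /ball_ /=.
    by rewrite sub0r normrN.
  have vx : L < `|x + h k *: v|.
    have : `|x| <= `|x + h k *: v| + `|h k *: v|.
      by rewrite -{1}(addrK (h k *: v) x) ler_normB.
    rewrite normrZ ger0_norm ?(ltW (h0 k))//.
    have : h k * `|v| <= `|v| by rewrite ler_piMl.
    by move: xK; rewrite /K; lra.
  rewrite /D aE !HL ?subrr ?mulr0 ?normr0//.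
  by move: xK; rewrite /K; have := normr_ge0 v; lra.
have Dg x : (fun k => D k x) @ \oo --> g x.
  have dl : is_derive (0 : R) 1 (fun t => f (x + t *: v)) (g x).
    apply: (proj1 (@is_derive_lineP _ f x v 0 (g x))).
    by rewrite scale0r addr0; exact: dfg.
  apply/cvgrPdist_le => e e0; have [r r0 Hr] := is_derive_slope dl e0.
  near=> k; have hr : h k < r.
    near: k; have [m _ Hm] := @near_infty_natSinv_lt R (PosNum r0).
    by exists m => // k mk; exact: Hm.
  have := Hr (h k); rewrite ger0_norm ?(ltW (h0 k))// => /(_ hr).
  rewrite add0r scale0r addr0 /D aE => H.
  rewrite (_ : _ - _ = - ((f (x + h k *: v) - f x - g x * h k) / h k)); last first.
    by field; rewrite gt_eqF.
  by rewrite normrN normrM normfV [`|h k|]ger0_norm ?(ltW (h0 k))// ler_pdivrMr.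
have DgE : {ae mu, forall x, setT x -> (fun k => (EFin \o D k) x) @ \oo --> (EFin \o g) x}.
  by apply: aeW => x _; apply: cvg_EFin; [exact: nearW|exact: Dg].
have DbE : {ae mu, forall x k, setT x -> (`|(EFin \o D k) x| <= (EFin \o b) x)%E}.
  by apply: aeW => x k _; rewrite /= lee_fin; exact: Db.
have [_ _ cv] := @dominated_convergence _ _ R mu setT measurableT (fun k => EFin \o D k)
   (EFin \o g) (EFin \o b)
   (fun k => measurable_int _ (cbs_integrable (Ds k)))
   (measurable_int _ (cbs_integrable gs)) DgE ib DbE.
have Z k : (\int[mu]_x (EFin \o D k) x = 0)%E.
  by rewrite -[LHS]fineK ?(integrable_fin_num _ (cbs_integrable (Ds k)))//; congr EFin; exact: ID.
have cv0 : (fun k => \int[mu]_x (EFin \o D k) x)%E @ \oo --> (0 : \bar R)%E.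
  by under eq_fun do rewrite Z; exact: cvg_cst.
have E : (\int[mu]_x (EFin \o g) x = 0)%E.
  by apply: (cvg_unique _ cv cv0); exact: ereal_hausdorff.
by rewrite /Rintegral [X in fine X]E.
Unshelve. all: by end_near. Qed.

Lemma cbs_int_gt0 f (x0 : 'rV[R]_n) : cont_bounded_support f ->
  (forall x, 0 <= f x) -> 0 < f x0 -> 0 < \int[mu]_x f x.
Proof.
move=> fs f0 fx0; have [cf _] := fs.
have fx2 : f x0 / 2 < f x0 by lra.
have [e /= e0 He] := (nbhs_ballP _ _).1 (cvgr_gt (f x0) (cf x0) _ fx2).
have mB := @measurable_rV_ball R n x0 _ e0.
apply: (@lt_le_trans _ _ (\int[mu]_(x in ball x0 e) f x)); last first.
  rewrite Rintegral_mkcond; apply: le_Rintegral => //.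
  - have /(integrable_mkcond _ mB) := integrableS measurableT mB (@subsetT _ _) (cbs_integrable fs).
    congr (integrable _ _ _); apply/funext => x; rewrite /patch /=; by case: ifPn.
  - exact: cbs_integrable.
  - by move=> x _; rewrite /patch; case: ifPn.
have Bfin : (mu (ball x0 e)%R < +oo)%E by rewrite lebesgue_rV_ball// ltry.
apply: (@lt_le_trans _ _ (\int[mu]_(x in ball x0 e) (f x0 / 2))).
  rewrite Rintegral_cst// mulr_gt0 ?divr_gt0//.
  rewrite [X in fine X](_ : _ = ((2 * e) ^+ n)%:E); last exact: lebesgue_rV_ball.
  by rewrite /= exprn_gt0// mulr_gt0.
apply: le_Rintegral => //.
- apply: measurable_bounded_integrable => //.
  exists (f x0 / 2); split; first exact: num_real.
  by move=> M CM x _; rewrite /= ger0_norm ltW//; lra.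
- exact: integrableS measurableT mB (@subsetT _ _) (cbs_integrable fs).
- by move=> x xB; apply/ltW/He.
Qed.

End compactly_supported.

(** * Weierstrass approximation *)

Section bernstein.
Variable R : realType.
Implicit Types (g : nat -> R) (x : R).

(** The expectation of [g] under the binomial law of parameters n and x, as a
polynomial in x; for [g k = f (k / n)] this is the n-th Bernstein polynomial of
f. *)
Fixpoint bernstein (n : nat) (g : nat -> R) : {poly R} :=
  if n is n'.+1 then
    (1 - 'X) * bernstein n' g + 'X * bernstein n' (fun k => g k.+1)
  else (g 0%N)%:P.

Lemma bernsteinS n g x : (bernstein n.+1 g).[x] =
  (1 - x) * (bernstein n g).[x] + x * (bernstein n (fun k => g k.+1)).[x].
Proof. by rewrite /= !hornerE. Qed.

Lemma bernstein_le n g1 g2 x : 0 <= x <= 1 ->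
  (forall k, (k <= n)%N -> g1 k <= g2 k) ->
  (bernstein n g1).[x] <= (bernstein n g2).[x].
Proof.
move=> /andP[x0 x1]; elim: n g1 g2 => [|n IH] g1 g2 H.
  by rewrite /= !hornerE; exact: H.
rewrite !bernsteinS lerD// ler_wpM2l ?subr_ge0//; apply: IH => k kn; apply: H.
  exact: leqW.
by rewrite ltnS.
Qed.

Lemma bernstein_cst n (a : R) x : (bernstein n (fun=> a)).[x] = a.
Proof.
by elim: n => [|n IH]; [rewrite /= hornerE|rewrite bernsteinS IH; ring].
Qed.

Lemma bernsteinD n g1 g2 x :
  (bernstein n (fun k => g1 k + g2 k)).[x] = (bernstein n g1).[x] + (bernstein n g2).[x].
Proof.
by elim: n g1 g2 => [|n IH] g1 g2; [rewrite /= !hornerE|rewrite !bernsteinS !IH; ring].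
Qed.

Lemma bernsteinZ n (a : R) g x :
  (bernstein n (fun k => a * g k)).[x] = a * (bernstein n g).[x].
Proof.
by elim: n g => [|n IH] g; [rewrite /= !hornerE|rewrite !bernsteinS !IH; ring].
Qed.

(** The second moment of the binomial law about its mean; the shift a is what the
induction on n needs, as one step moves the mean by x. *)
Lemma bernstein_variance n (a : R) x :
  (bernstein n (fun k => (k%:R + a - n%:R * x) ^+ 2)).[x] = n%:R * x * (1 - x) + a ^+ 2.
Proof.
elim: n a => [|n IH] a; first by rewrite /= hornerE; ring.
rewrite bernsteinS.
have -> : (fun k => (k%:R + a - n.+1%:R * x) ^+ 2) = fun k => (k%:R + (a - x) - n%:R * x) ^+ 2.
  by apply/funext => k; rewrite -natr1; ring.
have -> : (fun k => (k.+1%:R + a - n.+1%:R * x) ^+ 2) =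
    fun k => (k%:R + (a + 1 - x) - n%:R * x) ^+ 2.
  by apply/funext => k; rewrite -!natr1; ring.
by rewrite !IH -natr1; ring.
Qed.

(** A form of uniform continuity adapted to the variance of the binomial law: the
pairs with |f y - f x| >= e form a compact set, on which (y - x)^2 is bounded away
from 0. *)
Lemma continuous_quadratic_modulus (f : R -> R) (e : R) : continuous f -> 0 < e ->
  exists2 C : R, 0 < C & forall x y, 0 <= x <= 1 -> 0 <= y <= 1 ->
    `|f y - f x| <= e + C * (y - x) ^+ 2.
Proof.
move=> cf e0.
have c1 : continuous (fun p : R * R => `|f p.2 - f p.1|).
  move=> p; apply: (@continuous_comp _ _ _ (fun p : R * R => f p.2 - f p.1) (fun y : R => `|y|)).
    apply: cvgB.
      by apply: (@continuous_comp _ _ _ snd f); [exact: cvg_snd|exact: cf].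
    by apply: (@continuous_comp _ _ _ fst f); [exact: cvg_fst|exact: cf].
  exact: norm_continuous.
have c2 : continuous (fun p : R * R => (p.2 - p.1) ^+ 2).
  move=> p; rewrite /continuous_at expr2; under eq_fun do rewrite expr2.
  by apply: cvgM; apply: cvgB; [exact: cvg_snd|exact: cvg_fst|exact: cvg_snd|exact: cvg_fst].
pose S : set (R * R) := `[0, 1]%classic `*` `[0, 1]%classic.
have cS : compact S by apply: compact_setX; exact: segment_compact.
pose D := S `&` (fun p : R * R => `|f p.2 - f p.1|) @^-1` [set y | e <= y].
have cD : compact D.
  apply: compact_closedI => //.
  by apply: preimage_closed => [p _|]; [exact: c1|exact: closed_ge].
have [D0|D0] := pselect (D !=set0); last first.
  exists 1 => // x y x01 y01; rewrite mul1r.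
  have [h|h] := leP e `|f y - f x|; first by case: D0; exists (x, y).
  by rewrite (le_trans (ltW h))// lerDl sqr_ge0.
have [[x1 y1] /set_mem[_ /= exy] Hmin] := compact_EVT_min D0 cD (continuous_subspaceT c2).
have m0 : 0 < (y1 - x1) ^+ 2.
  rewrite lt_neqAle sqr_ge0 andbT eq_sym sqrf_eq0 subr_eq0; apply/eqP => xy.
  by move: exy; rewrite xy subrr normr0 leNgt e0.
have S0 : S !=set0 by exists (0, 0); split; rewrite /= in_itv /= lexx ler01.
have [p _ Hmax] := compact_EVT_max S0 cS (continuous_subspaceT c1).
pose M := `|f p.2 - f p.1| + 1.
have M0 : 0 < M by rewrite /M; have := normr_ge0 (f p.2 - f p.1); lra.
exists (M / (y1 - x1) ^+ 2); first by rewrite divr_gt0.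
move=> x y x01 y01; have [h|h] := leP e `|f y - f x|; last first.
  by rewrite (le_trans (ltW h))// lerDl mulr_ge0 ?sqr_ge0// divr_ge0 ?sqr_ge0// ltW.
have Sxy : S (x, y) by split; rewrite /= in_itv.
have h1 : (y1 - x1) ^+ 2 <= (y - x) ^+ 2 by apply: (Hmin (x, y)); rewrite inE.
have h2 : `|f y - f x| <= M.
  by have := Hmax (x, y); rewrite inE => /(_ Sxy) /= h2; rewrite /M; lra.
apply: (le_trans h2); apply: (@le_trans _ _ (M / (y1 - x1) ^+ 2 * (y - x) ^+ 2)).
  by rewrite mulrAC ler_pdivlMr// ler_pM2l.
by rewrite lerDr ltW.
Qed.

(** By [continuous_quadratic_modulus] the error of the Bernstein polynomial at x is
at most e / 2 plus a constant times the variance x (1 - x) / n. *)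
Lemma weierstrass01 (f : R -> R) (e : R) : continuous f -> 0 < e ->
  exists p : {poly R}, forall x, 0 <= x <= 1 -> `|p.[x] - f x| <= e.
Proof.
move=> cf e0; have e2 : 0 < e / 2 by lra.
have [C C0 HC] := continuous_quadratic_modulus cf e2.
have [m Hm] : exists m : nat, m.+1%:R^-1 < e / 2 / C.
  have [m _ Hm] := @near_infty_natSinv_lt R (PosNum (divr_gt0 e2 C0)).
  by exists m; exact: (Hm m (leqnn m)).
pose n := m.+1; have n0 : 0 < n%:R :> R by rewrite ltr0n.
exists (bernstein n (fun k => f (k%:R / n%:R))) => x x01.
have kn k : (k <= n)%N -> 0 <= (k%:R / n%:R : R) <= 1.
  by move=> kn; rewrite divr_ge0//= ler_pdivrMr// mul1r ler_nat.
pose v (k : nat) := (k%:R / n%:R - x) ^+ 2.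
have Ev : (bernstein n v).[x] <= n%:R^-1.
  have -> : v = fun k => n%:R ^- 2 * (k%:R + 0 - n%:R * x) ^+ 2.
    by apply/funext => k; rewrite /v; field; rewrite gt_eqF.
  rewrite bernsteinZ bernstein_variance expr0n /= addr0.
  rewrite (_ : _ * _ = n%:R^-1 * (x * (1 - x))); last by field; rewrite gt_eqF.
  rewrite ler_piMr ?invr_ge0 ?ltW//; move: x01 => /andP[? ?]; nra.
have bnd : e / 2 + C * (bernstein n v).[x] <= e.
  have : C * (bernstein n v).[x] <= e / 2.
    rewrite -ler_pdivlMl// mulrC; apply: (le_trans Ev); exact: ltW.
  lra.
have E (s : R) : (bernstein n (fun k => s * (f x) + (e / 2 + C * v k))).[x] =
    s * f x + (e / 2 + C * (bernstein n v).[x]).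
  by rewrite bernsteinD bernsteinD !bernstein_cst bernsteinZ.
have H k : (k <= n)%N -> - (e / 2 + C * v k) <= f (k%:R / n%:R) - f x <= e / 2 + C * v k.
  by move=> /kn kn1; rewrite -ler_norml; exact: HC.
rewrite ler_norml; apply/andP; split.
  rewrite lerBrDl.
  have : (bernstein n (fun k => - (-1 * f x + (e / 2 + C * v k)))).[x] <=
      (bernstein n (fun k => f (k%:R / n%:R))).[x].
    by apply: bernstein_le => // k /H /andP[? ?]; lra.
  have -> : (fun k => - (-1 * f x + (e / 2 + C * v k))) =
      fun k => -1 * (-1 * f x + (e / 2 + C * v k)).
    by apply/funext => k; ring.
  by rewrite bernsteinZ E; lra.
rewrite lerBlDl.
have : (bernstein n (fun k => f (k%:R / n%:R))).[x] <=
    (bernstein n (fun k => 1 * f x + (e / 2 + C * v k))).[x].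
  by apply: bernstein_le => // k /H /andP[? ?]; lra.
by rewrite E; lra.
Qed.

Lemma weierstrass (f : R -> R) (T e : R) : continuous f -> 0 < T -> 0 < e ->
  exists p : {poly R}, forall x, 0 <= x <= T -> `|p.[x] - f x| <= e.
Proof.
move=> cf T0 e0.
have cg : continuous (fun x => f (T * x)).
  move=> x; apply: (@continuous_comp _ _ _ (fun x => T * x) f); last exact: cf.
  exact: (cvgM (cvg_cst _) cvg_id).
have [p Hp] := weierstrass01 cg e0.
exists (p \Po (T^-1 *: 'X)) => x /andP[x0 xT].
rewrite horner_comp !hornerE.
have := Hp (T^-1 * x); rewrite mulrA divff ?gt_eqF// mul1r; apply.
by rewrite mulr_ge0 ?invr_ge0 ?(ltW T0)//= mulrC ler_pdivrMr// mul1r.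
Qed.

Lemma poly_antiderivative (p : {poly R}) : exists2 P : {poly R}, P^`() = p & P.[0] = 0.
Proof.
exists (\poly_(i < (size p).+1) (if i is j.+1 then p`_j / j.+1%:R else 0)).
  apply/polyP => i; rewrite coef_deriv coef_poly ltnS.
  case: ltnP => [_|ip]; last by rewrite mul0rn nth_default.
  by rewrite -[LHS]mulr_natr divfK// pnatr_eq0.
by rewrite horner_coef0 coef_poly.
Qed.

End bernstein.

(** * Approximation by functions flat at the origin *)

Lemma is_derive_exprn (R : realType) (n : nat) (x : R) :
  is_derive x 1 (fun y : R => y ^+ n) (n%:R * x ^+ n.-1).
Proof.
apply: (@is_derive_eq _ _ _ _ _ _ _ (n%:R * x ^+ n.-1 *: (1 : R))).
  by apply: DeriveDef; [exact: exprn_derivable|exact: exp_derive].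
exact: mulr1.
Qed.

Lemma is_derive_inv (R : realType) (x : R) : x != 0 ->
  is_derive x 1 (fun y : R => y^-1) (- (x^-1 ^+ 2)).
Proof.
move=> x0; apply: (is_derive_eq (@is_deriveV _ id x 1 1 x0 (is_derive_id x 1))).
by rewrite /= /GRing.scale /= mulr1 exprVn.
Qed.

Section flat.
Variables (R : realType) (kap : R).
Hypothesis kap0 : 0 < kap.

(** A family of smooth functions whose derivatives are linear combinations of its
members, which makes induction on the order of differentiation possible. *)
Definition flat (m : nat) (s : R) : R :=
  if 0 < s then s^-1 ^+ m * expR (- (kap / s)) else 0.

Lemma flat_ge0 m s : 0 <= flat m s.
Proof.
rewrite /flat; case: ifPn => // s0.
by rewrite mulr_ge0 ?expR_ge0// exprn_ge0// invr_ge0 ltW.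
Qed.

(** The exponential beats all powers; a quadratic bound is enough for the derivative
at 0 to exist and to vanish. *)
Lemma flat_le_sqr m : exists2 C : R, 0 < C & forall s, flat m s <= C * s ^+ 2.
Proof.
have k0 := kap0.
exists (m.+2`!%:R / kap ^+ m.+2).
  by rewrite divr_gt0 ?exprn_gt0// ltr0n fact_gt0.
move=> s; rewrite /flat; case: ifPn => [s0|_]; last first.
  by rewrite mulr_ge0 ?sqr_ge0// divr_ge0// exprn_ge0// ltW.
have y0 : 0 < kap / s by rewrite divr_gt0.
have h : (kap / s) ^+ m.+2 / m.+2`!%:R <= expR (kap / s).
  by apply: le_trans (expR_ge1Dxn m.+1 (ltW y0)); rewrite lerDr.
have f0 : 0 < m.+2`!%:R :> R by rewrite ltr0n fact_gt0.
have h' : expR (- (kap / s)) <= m.+2`!%:R / (kap / s) ^+ m.+2.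
  rewrite expRN -[leRHS]invf_div lef_pV2// posrE ?expR_gt0//.
  by rewrite divr_gt0// exprn_gt0.
rewrite -ler_pdivlMl ?exprn_gt0 ?invr_gt0//.
apply: (le_trans h').
have sm : s ^+ m != 0 by rewrite expf_neq0// gt_eqF.
rewrite le_eqVlt; apply/orP; left; apply/eqP.
rewrite !exprMn !exprVn !exprS; field.
rewrite !gt_eqF ?exprn_gt0//.
Qed.

Lemma is_derive_flat m (s : R) :
  is_derive s 1 (flat m) (- m%:R * flat m.+1 s + kap * flat m.+2 s).
Proof.
have [s0|s0|s0] := ltgtP s 0.
- have Z k : flat k s = 0 by rewrite /flat ltNge ltW.
  rewrite !Z !mulr0 addr0.
  apply: (@near_eq_is_derive _ _ _ (cst 0)).
    near=> x; rewrite /flat /cst ltNge ltW//; near: x; exact: lt_nbhsl.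
- have sn0 : s != 0 by rewrite gt_eqF.
  apply: (@near_eq_is_derive _ _ _ (fun x : R => x^-1 ^+ m * expR (- (kap / x)))).
    near=> x; rewrite /flat ifT//; near: x; exact: lt_nbhsr.
  have dV := is_derive_inv sn0.
  have dX := is_derive_comp1 (is_derive_exprn m s^-1) dV.
  have dy : is_derive s 1 (fun x : R => - (kap / x)) (kap * s^-1 ^+ 2).
    apply: (is_derive_eq (is_deriveN (is_derive_mul (is_derive_cst kap s 1) dV))).
    by rewrite /cst mulr0 addr0 mulrN opprK.
  have dE := @is_derive_comp1 R expR (fun x => - (kap / x)) s _ _ (is_derive_expR (- (kap / s))) dy.
  apply: (is_derive_eq (is_derive_mul dX dE)).
  rewrite /flat s0; move: (expR _) => E.
  case: m {dX} => [|m] /=; first by rewrite !expr0 !expr2; ring.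
  by rewrite !exprS expr0; ring.
- have [C C0 HC] := flat_le_sqr m.
  rewrite s0 {2 3}/flat ltxx !mulr0 addr0.
  have H x : `|flat m x| <= C * x ^+ 2 by rewrite ger0_norm ?flat_ge0.
  have F0 : flat m 0 = 0 by rewrite /flat ltxx.
  apply: slope_is_derive => e e0; exists (e / C); first by rewrite divr_gt0.
  have H2 x : `|x| < e / C -> `|flat m x| <= e * `|x|.
    move=> xe; apply: (le_trans (H x)).
    rewrite -real_normK ?num_real// expr2 mulrA ler_wpM2r//.
    by rewrite mulrC -ler_pdivlMr// ltW.
  move=> a b ab [a0|b0]; [rewrite a0 in ab *|rewrite b0 in ab *].
    by rewrite !subr0 mul0r F0 !subr0 => _ /H2; rewrite [`|b|]ger0_norm.
  by rewrite mul0r F0 !subr0 !sub0r normrN => /H2 + _; rewrite [`|a|]ler0_norm.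
Unshelve. all: by end_near. Qed.

End flat.

(** The derivative of p is a uniform approximation of g. The factor exp (- kap / s)
with kap small is close to 1 except near 0, where g is small, and so are p and
p / s; its derivative is of order 1 / s there, which p / s compensates. *)
Lemma flat_approx (R : realType) (G g : R -> R) (T e : R) : continuous g ->
  (forall s : R, is_derive s 1 G (g s)) -> G 0 = 0 -> g 0 = 0 -> 0 < T -> 0 < e ->
  exists (p : {poly R}) (kap : R), 0 < kap /\ forall s, 0 < s -> s <= T ->
    `|p.[s] * flat kap 0 s - G s| <= e /\
    `|p^`().[s] * flat kap 0 s + p.[s] * (kap * flat kap 2 s) - g s| <= e.
Proof.
move=> cg dG G0 g0 T0 e0.
have [d [d0 d1 dT]] : exists d : R, [/\ 0 < d, 4 * d <= e & T * d * 2 <= e].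
  exists (Num.min (e / 4) (e / (T * 2))); split.
  - by rewrite lt_min !divr_gt0//; lra.
  - have : Num.min (e / 4) (e / (T * 2)) <= e / 4 by rewrite ge_min lexx.
    by lra.
  - have : Num.min (e / 4) (e / (T * 2)) <= e / (T * 2) by rewrite ge_min lexx orbT.
    rewrite ler_pdivlMr; last by lra.
    by lra.
have [pi Hpi] := weierstrass cg T0 d0.
have [p pE p0] := poly_antiderivative pi.
have [M M0 HM] : exists2 M : R, 0 < M & forall s, 0 <= s <= T -> `|g s| <= M.
  have cng : {within `[0, T], continuous (fun x => `|g x|)}.
    apply: continuous_subspaceT => x.
    by apply: (@continuous_comp _ _ _ g (fun y : R => `|y|)); [exact: cg|exact: norm_continuous].
  have [c _ Hc] := EVT_max (ltW T0) cng.
  exists (`|g c| + 1); first by have := normr_ge0 (g c); lra.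
  by move=> s sT; have := Hc s; rewrite in_itv /= => /(_ sT); lra.
have [eta eta0 Heta] : exists2 eta : R, 0 < eta & forall s, 0 <= s < eta -> `|g s| <= d.
  have /cvgrPdist_le/(_ _ d0) [eta /= eta0 H] : g @ (0 : R) --> (0 : R).
    by rewrite -[X in _ --> X]g0; exact: cg.
  exists eta => // s /andP[s0 se]; have := H s.
  by rewrite /= !sub0r !normrN [`|s|]ger0_norm//; exact.
pose B := M + d; have B0 : 0 < B by rewrite /B; lra.
have [kap [kap0 k1 k2]] : exists kap : R, [/\ 0 < kap, B * kap <= d * eta & B * kap <= d].
  exists (Num.min (d * eta / B) (d / B)); split.
  - by rewrite lt_min !divr_gt0// mulr_gt0.
  - by rewrite mulrC -ler_pdivlMr// ge_min lexx.
  - by rewrite mulrC -ler_pdivlMr// ge_min lexx orbT.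
exists p, kap; split => // s s0 sT.
have sn0 : s != 0 by rewrite gt_eqF.
rewrite /flat s0 expr0 mul1r; set chi := expR _; set y := kap / s in chi *.
have y0 : 0 < y by rewrite divr_gt0.
have chi0 : 0 < chi by exact: expR_gt0.
have chi1 : chi <= 1 by rewrite /chi -expR0 ler_expR oppr_le0 ltW.
have chiy : 1 - chi <= y by have := expR_ge1Dx (- y); rewrite -/chi; lra.
have ychi : y * chi <= 1.
  rewrite /chi expRN ler_pdivrMr ?expR_gt0// mul1r.
  by apply: le_trans (expR_ge1Dx y); rewrite lerDr.
have dp (z : R) : is_derive z 1 (horner p) (pi.[z]) by rewrite -pE; exact: is_derive_poly.
(* the mean value theorem bounds p and p - G by s times their derivatives *)
have pb (b : R) : (forall z, 0 <= z <= s -> `|pi.[z]| <= b) -> `|p.[s]| <= b * s.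
  move=> Hb; have [c] := MVT s0 (fun z _ => dp z) (continuous_subspaceT (@continuous_horner _ p)).
  rewrite in_itv /= => /andP[c0 cs]; rewrite p0 !subr0 => ->.
  by rewrite normrM [`|s|]gtr0_norm// ler_pM2r// Hb// !ltW.
have pG : `|p.[s] - G s| <= d * s.
  have dpG (z : R) : is_derive z 1 (fun z => p.[z] - G z) (pi.[z] - g z).
    exact: (is_deriveB (dp z) (dG z)).
  have cpG : {within `[0, s], continuous (fun z => p.[z] - G z)}.
    by apply: continuous_subspaceT => z; exact: is_derive_cont (dpG z).
  have [c] := MVT s0 (fun z _ => dpG z) cpG.
  rewrite in_itv /= => /andP[c0 cs]; rewrite p0 G0 !subr0 => ->.
  rewrite normrM [`|s|]gtr0_norm// ler_pM2r// Hpi// ltW//=.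
  by rewrite ltW// (lt_le_trans cs).
have piB z : 0 <= z <= T -> `|pi.[z]| <= `|g z| + d.
  move=> zT; rewrite (_ : pi.[z] = g z + (pi.[z] - g z)); last ring.
  by apply: le_trans (ler_normD _ _) _; rewrite lerD2l Hpi.
have pB : `|p.[s]| <= B * s.
  apply: pb => z /andP[z0 zs]; have zT : 0 <= z <= T by rewrite z0 (le_trans zs).
  by apply: le_trans (piB z zT) _; rewrite /B lerD2r HM.
have chin : `|1 - chi| = 1 - chi by rewrite ger0_norm// subr_ge0.
split.
  rewrite (_ : _ - G s = (p.[s] - G s) - p.[s] * (1 - chi)); last ring.
  apply: le_trans (ler_normB _ _) _; rewrite normrM chin.
  have h1 : `|p.[s]| * (1 - chi) <= B * s * y.
    by apply: ler_pM => //; rewrite subr_ge0.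
  have h2 : B * s * y = B * kap by rewrite /y; field.
  have h3 : d * s <= d * T by rewrite ler_pM2l.
  by lra.
rewrite pE (_ : _ - g s = (pi.[s] - g s) * chi - g s * (1 - chi) + p.[s] / s * (y * chi)); last first.
  by rewrite /y expr2; field.
have sT' : 0 <= s <= T by rewrite ltW.
have t1 : `|(pi.[s] - g s) * chi| <= d.
  rewrite normrM [`|chi|]gtr0_norm//; apply: (@le_trans _ _ (d * 1)); last by rewrite mulr1.
  by apply: ler_pM => //; [exact: ltW|exact: Hpi].
suff [t2 t3] : `|g s * (1 - chi)| <= d /\ `|p.[s] / s * (y * chi)| <= 2 * d.
  apply: le_trans (ler_normD _ _) _.
  have := ler_normB ((pi.[s] - g s) * chi) (g s * (1 - chi)); lra.
rewrite normrM chin normrM [`|y * chi|]ger0_norm; last by rewrite mulr_ge0 ?(ltW y0) ?(ltW chi0).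
rewrite normrM normfV [`|s|]gtr0_norm//.
have [se|se] := ltP s eta.
  have gs : `|g s| <= d by apply: Heta; rewrite (ltW s0).
  have ps : `|p.[s]| / s <= 2 * d.
    rewrite ler_pdivrMr//; apply: pb => z /andP[z0 zs].
    have zT : 0 <= z <= T by rewrite z0 (le_trans zs).
    apply: (le_trans (piB z zT)).
    have : `|g z| <= d by apply: Heta; rewrite z0 (le_lt_trans zs).
    lra.
  split.
    apply: (@le_trans _ _ (d * 1)); last by rewrite mulr1.
    by apply: ler_pM => //; [rewrite subr_ge0|lra].
  apply: (@le_trans _ _ (2 * d * 1)); last by rewrite mulr1.
  by apply: ler_pM => //; [rewrite divr_ge0// ltW|rewrite mulr_ge0 ?(ltW y0) ?(ltW chi0)].
have By : B * y <= d.
  rewrite /y mulrA ler_pdivrMr//; apply: (le_trans k1); by rewrite ler_pM2l.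
have ps : `|p.[s]| / s <= B by rewrite ler_pdivrMr.
have gs : `|g s| <= B by have := HM s sT'; rewrite /B; lra.
have ychiy : y * chi <= y by rewrite ler_piMr// ltW.
split.
  by apply: le_trans By; apply: ler_pM => //; rewrite subr_ge0.
apply: (@le_trans _ _ (B * y)); last by lra.
by apply: ler_pM => //; [rewrite divr_ge0// ltW|rewrite mulr_ge0 ?(ltW y0) ?(ltW chi0)].
Qed.

(** * Radial functions and radial test functions *)

Section radial.
Variables (R : realType) (N : nat) (x0 : 'rV[R]_N) (k T : R).
Hypotheses (k0 : 0 < k) (T0 : 0 < T).
Local Notation mu := (lebesgue_rV R N).
Local Notation e_ i := (delta_mx ord0 i : 'rV[R]_N).

Definition sqdist (x : 'rV[R]_N) : R := \sum_i (x ord0 i - x0 ord0 i) ^+ 2.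
Definition sqrad (x : 'rV[R]_N) : R := k * sqdist x.

Lemma sqdist_ge0 x : 0 <= sqdist x.
Proof. by apply: sumr_ge0 => i _; exact: sqr_ge0. Qed.

Lemma sqrad_ge0 x : 0 <= sqrad x.
Proof. by rewrite mulr_ge0 ?sqdist_ge0// ltW. Qed.

Lemma sqdist_line x (i : 'I_N) (s : R) :
  sqdist (x + s *: e_ i) = sqdist x + s * (2 * (x ord0 i - x0 ord0 i)) + s ^+ 2.
Proof.
rewrite /sqdist (bigD1 i)//= [in RHS](bigD1 i)//= !mxE !eqxx.
rewrite (eq_bigr (fun j => (x ord0 j - x0 ord0 j) ^+ 2)); last first.
  by move=> j ji; rewrite !mxE (negbTE ji) /= mulr0 addr0.
by rewrite /= mulr1n; ring.
Qed.

Lemma is_derive_sqrad (f : R -> R) (x : 'rV[R]_N) (i : 'I_N) (d : R) :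
  is_derive (sqrad x) 1 f d ->
  is_derive x (e_ i) (fun y => f (sqrad y)) (d * (2 * k * (x ord0 i - x0 ord0 i))).
Proof.
move=> fd; suff : is_derive (x + 0 *: e_ i) (e_ i) (fun y => f (sqrad y))
    (d * (2 * k * (x ord0 i - x0 ord0 i))) by rewrite scale0r addr0.
apply: (proj2 (@is_derive_lineP R _ (fun y => f (sqrad y)) x (e_ i) 0 _)); set c := x ord0 i - x0 ord0 i.
pose q (s : R) := k * sqdist x + s * (k * (2 * c)) + k * (s * s).
have qE s : sqrad (x + s *: e_ i) = q s by rewrite /sqrad sqdist_line /q -/c; ring.
have -> : (fun s => f (sqrad (x + s *: e_ i))) = (fun s => f (q s)).
  by apply/funext => s; rewrite qE.
have d1 := is_derive_mul (is_derive_id (0 : R) (1 : R)) (is_derive_cst (k * (2 * c)) (0 : R) (1 : R)).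
have d2 := is_derive_mul (is_derive_cst k (0 : R) (1 : R))
  (is_derive_mul (is_derive_id (0 : R) (1 : R)) (is_derive_id (0 : R) (1 : R))).
have d3 := is_deriveD (is_deriveD (is_derive_cst (k * sqdist x) (0 : R) (1 : R)) d1) d2.
have dq : is_derive (0 : R) 1 q (2 * k * c).
  by apply: (is_derive_eq d3); rewrite /cst /=; ring.
have q0 : q 0 = sqrad x by rewrite /q /sqrad !mul0r mulr0 !addr0.
by apply: is_derive_comp1; rewrite ?q0.
Qed.

Lemma is_derive_coord (x : 'rV[R]_N) (i j : 'I_N) :
  is_derive x (e_ i) (fun y : 'rV[R]_N => y ord0 j - x0 ord0 j) (i == j)%:R.
Proof.
suff : is_derive (x + 0 *: e_ i) (e_ i) (fun y : 'rV[R]_N => y ord0 j - x0 ord0 j)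
    (i == j)%:R by rewrite scale0r addr0.
apply: (proj2 (@is_derive_lineP R _ (fun y : 'rV[R]_N => y ord0 j - x0 ord0 j) x (e_ i) 0 _)).
have -> : (fun t : R => (x + t *: e_ i) ord0 j - x0 ord0 j) =
    (fun t : R => t * (i == j)%:R + (x ord0 j - x0 ord0 j)).
  by apply/funext => t; rewrite !mxE eqxx /= eq_sym; ring.
have d1 := is_deriveD (is_derive_mul (is_derive_id (0 : R) (1 : R))
  (is_derive_cst ((i == j)%:R : R) (0 : R) (1 : R)))
  (is_derive_cst (x ord0 j - x0 ord0 j) (0 : R) (1 : R)).
by apply: (is_derive_eq d1); rewrite /cst /=; ring.
Qed.

Lemma continuous_coordB (i : 'I_N) : continuous (fun x : 'rV[R]_N => x ord0 i - x0 ord0 i).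
Proof.
move=> x; exact: (cvgB (@coord_continuous R 1 N ord0 i x) (cvg_cst _)).
Qed.

Lemma continuous_sqrad : continuous sqrad.
Proof.
have cs (s : seq 'I_N) : continuous (fun x : 'rV[R]_N => \sum_(i <- s) (x ord0 i - x0 ord0 i) ^+ 2).
  elim: s => [|i s IH].
    rewrite (_ : (fun x => _) = fun _ : 'rV[R]_N => 0 : R); first exact: cst_continuous.
    by apply/funext => x; rewrite big_nil.
  rewrite (_ : (fun x => _) = fun x : 'rV[R]_N => (x ord0 i - x0 ord0 i) * (x ord0 i - x0 ord0 i) +
     \sum_(i <- s) (x ord0 i - x0 ord0 i) ^+ 2); last first.
    by apply/funext => x; rewrite big_cons expr2.
  move=> x; exact: (cvgD (cvgM (@continuous_coordB i x) (@continuous_coordB i x)) (IH x)).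
by move=> x; exact: (cvgM (cvg_cst _) (cs (index_enum _) x)).
Qed.

Lemma sqrad_ball x : sqrad x <= T -> ball x0 (T / k + 1) x.
Proof.
move=> xT; have Tk : 0 < T / k by rewrite divr_gt0.
rewrite rV_ballE//; last by lra.
move=> i; rewrite distrC.
have : `|x ord0 i - x0 ord0 i| ^+ 2 <= T / k.
  rewrite real_normK ?num_real// ler_pdivlMr// mulrC; apply: le_trans xT.
  rewrite ler_pM2l// /sqdist (bigD1 i)//= lerDl.
  by apply: sumr_ge0 => j _; exact: sqr_ge0.
have := normr_ge0 (x ord0 i - x0 ord0 i).
by move: (`|x ord0 i - x0 ord0 i|) (T / k) Tk => a b; rewrite expr2; nra.
Qed.

Lemma sqrad_compact : compact [set x | sqrad x <= T].
Proof.
apply: bounded_closed_compact.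
  exists (`|x0| + (T / k + 1)); split; first exact: num_real.
  move=> M LM x /= /sqrad_ball; rewrite mx_norm_ball /ball_ /= => xb.
  rewrite -[x](subKr x0) (le_trans (ler_normB _ _))//.
  by apply/ltW/lt_trans/LM; rewrite ltrD2l.
rewrite (_ : [set x | _] = sqrad @^-1` [set y | y <= T])//.
by apply: preimage_closed => [x _|]; [exact: continuous_sqrad|exact: closed_le].
Qed.

Lemma sqrad_cbs (f : 'rV[R]_N -> R) : continuous f ->
  (forall x, T <= sqrad x -> f x = 0) -> cont_bounded_support f.
Proof.
move=> cf f0; split => //; exists (`|x0| + (T / k + 1)) => x Lx; apply: f0.
apply/ltW; rewrite ltNge; apply/negP => /sqrad_ball.
rewrite mx_norm_ball /ball_ /= => xb.
have : `|x| <= `|x0| + `|x0 - x| by rewrite -{1}[x](subKr x0) ler_normB.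
lra.
Qed.

(** The combinations of the functions [flat kap m] of T - sqrad x with polynomial
coefficients. This class is closed under partial derivatives and consists of
continuous functions, hence of smooth ones. *)
Inductive flatfun (kap : R) : ('rV[R]_N -> R) -> Prop :=
| flatfun_flat m : flatfun kap (fun x => flat kap m (T - sqrad x))
| flatfun_coord i f : flatfun kap f ->
    flatfun kap (fun x => (x ord0 i - x0 ord0 i) * f x)
| flatfunD f g : flatfun kap f -> flatfun kap g -> flatfun kap (fun x => f x + g x)
| flatfunZ c f : flatfun kap f -> flatfun kap (fun x => c * f x).

Lemma flatfun_continuous kap f : 0 < kap -> flatfun kap f -> continuous f.
Proof.
move=> kap0; elim=> [m|i {}f _ IH|{}f g _ IHf _ IHg|c {}f _ IH] x.
- have cw : {for x, continuous (fun x => T - sqrad x)}.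
    exact: (cvgB (cvg_cst _) (@continuous_sqrad x)).
  apply: (@continuous_comp _ _ _ (fun x => T - sqrad x) (flat kap m) _ cw).
  exact: is_derive_cont (is_derive_flat kap0 m _).
- exact: (cvgM (@continuous_coordB i x) (IH x)).
- exact: (cvgD (IHf x) (IHg x)).
- exact: (cvgM (cvg_cst _) (IH x)).
Qed.

Lemma flatfun_derive kap f (i : 'I_N) : 0 < kap -> flatfun kap f ->
  exists2 g, flatfun kap g & forall x, is_derive x (e_ i) f (g x).
Proof.
move=> kap0; elim=> [m|j {}f ff [g fg dg]|{}f1 f2 _ [g1 fg1 dg1] _ [g2 fg2 dg2]|c {}f _ [g fg dg]].
- exists (fun x : 'rV[R]_N => (- (2 * k)) * ((x ord0 i - x0 ord0 i) *
      (- m%:R * flat kap m.+1 (T - sqrad x) + kap * flat kap m.+2 (T - sqrad x)))).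
    by do 2 constructor; constructor; constructor; constructor.
  move=> x; pose d := - m%:R * flat kap m.+1 (T - sqrad x) + kap * flat kap m.+2 (T - sqrad x).
  have dT : is_derive (sqrad x) 1 (fun t : R => T - t) (-1).
    by apply: (is_derive_eq (is_deriveB (is_derive_cst T (sqrad x) (1 : R)) (is_derive_id (sqrad x) (1 : R)))); rewrite sub0r.
  have := @is_derive_sqrad (fun t => flat kap m (T - t)) x i (d * -1)
    (@is_derive_comp1 R (flat kap m) (fun t => T - t) (sqrad x) _ _ (is_derive_flat kap0 m _) dT).
  move=> h; apply: (is_derive_eq h); rewrite /d; ring.
- exists (fun x : 'rV[R]_N => (x ord0 j - x0 ord0 j) * g x + (i == j)%:R * f x).
    by constructor; constructor.
  move=> x; apply: (is_derive_eq (is_derive_mul (is_derive_coord x i j) (dg x))).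
  by rewrite [f x * _]mulrC.
- exists (fun x : 'rV[R]_N => g1 x + g2 x); first by constructor.
  by move=> x; exact: (is_deriveD (dg1 x) (dg2 x)).
- exists (fun x : 'rV[R]_N => c * g x); first by constructor.
  move=> x; apply: (is_derive_eq (is_derive_mul (is_derive_cst c x (e_ i)) (dg x))).
  by rewrite /cst mulr0 addr0.
Qed.

Lemma flatfun_smooth kap f : 0 < kap -> flatfun kap f -> smooth f.
Proof.
move=> kap0 ff s.
have {}ff : flatfun kap (iter_partial s f).
  elim: s => [//|i s IH] /=; have [g fg dg] := flatfun_derive i kap0 IH.
  rewrite (_ : partial i _ = g)//; apply/funext => x.
  by have [_ <-] := dg x.
move=> x; split; first exact: flatfun_continuous ff x.
by move=> i; have [g _ dg] := flatfun_derive i kap0 ff; have [] := dg x.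
Qed.

Lemma flatfun_zero kap f x : flatfun kap f -> T <= sqrad x -> f x = 0.
Proof.
move=> ff xT; elim: ff => [m|i {}f _ ->|{}f g _ -> _ ->|c {}f _ ->].
- by rewrite /flat subr_gt0 ltNge xT.
- by rewrite mulr0.
- by rewrite addr0.
- by rewrite mulr0.
Qed.

Lemma flatfun_sqrad kap f : flatfun kap f -> flatfun kap (fun x : 'rV[R]_N => (T - sqrad x) * f x).
Proof.
move=> ff.
have fs (s : seq 'I_N) : flatfun kap (fun x : 'rV[R]_N => (\sum_(i <- s) (x ord0 i - x0 ord0 i) ^+ 2) * f x).
  elim: s => [|i s IH].
    rewrite (_ : (fun x : 'rV[R]_N => _) = fun x : 'rV[R]_N => 0 * f x); first exact: flatfunZ.
    by apply/funext => x; rewrite big_nil.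
  rewrite (_ : (fun x : 'rV[R]_N => _) = fun x : 'rV[R]_N => (x ord0 i - x0 ord0 i) * ((x ord0 i - x0 ord0 i) * f x) +
     (\sum_(i <- s) (x ord0 i - x0 ord0 i) ^+ 2) * f x).
    by apply: flatfunD => //; do 2 apply: flatfun_coord.
  by apply/funext => x; rewrite big_cons; ring.
rewrite (_ : (fun x : 'rV[R]_N => _) = fun x : 'rV[R]_N => T * f x + - k * (sqdist x * f x)).
  by apply: flatfunD; apply: flatfunZ => //; exact: fs.
by apply/funext => x; rewrite /sqrad; ring.
Qed.

Lemma flatfun_horner kap f (p : {poly R}) : flatfun kap f ->
  flatfun kap (fun x : 'rV[R]_N => p.[T - sqrad x] * f x).
Proof.
move=> ff; elim/poly_ind: p => [|p c IH].
  rewrite (_ : (fun x : 'rV[R]_N => _) = fun x : 'rV[R]_N => 0 * f x); first exact: flatfunZ.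
  by apply/funext => x; rewrite horner0.
rewrite (_ : (fun x : 'rV[R]_N => _) = fun x : 'rV[R]_N => (T - sqrad x) * (p.[T - sqrad x] * f x) + c * f x).
  by apply: flatfunD; [exact: flatfun_sqrad|exact: flatfunZ].
by apply/funext => x; rewrite hornerMXaddC; ring.
Qed.

End radial.

(** * Radial functions in H^1_0 *)

Section sobolev.
Variables (R : realType) (N : nat) (Omega : set 'rV[R]_N).
Hypothesis oO : open Omega.
Local Notation mu := (lebesgue_rV R N).
Local Notation e_ i := (delta_mx ord0 i : 'rV[R]_N).

Let mO : measurable Omega. Proof. exact: open_measurable_rV. Qed.

Lemma Rintegral_support (f : 'rV[R]_N -> R) : (forall x, ~ Omega x -> f x = 0) ->
  \int[mu]_(x in Omega) f x = \int[mu]_x f x.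
Proof.
move=> f0; rewrite Rintegral_mkcond; congr (Rintegral _ _ _).
apply/funext => x; rewrite /patch; case: ifPn => // /negP xO.
by rewrite f0// => Ox; apply: xO; rewrite inE.
Qed.

Lemma cbs_integrableS (f : 'rV[R]_N -> R) : cont_bounded_support f ->
  mu.-integrable Omega (EFin \o f).
Proof. by move=> fs; exact: integrableS measurableT mO (@subsetT _ _) (cbs_integrable fs). Qed.

Lemma in_L2_cbs (f : 'rV[R]_N -> R) : cont_bounded_support f -> in_L2 Omega f.
Proof.
move=> fs; have [cf _] := fs; split.
  by apply: measurable_funTS; exact: continuous_measurable_rV.
have := cbs_integrableS (cbsM fs cf).
congr (integrable _ _ _); apply/funext => x; by rewrite /= expr2.
Qed.

Lemma smooth_is_derive (phi : 'rV[R]_N -> R) (i : 'I_N) x : smooth phi ->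
  is_derive x (e_ i) phi (partial i phi x).
Proof. by move=> sp; apply/derivableP; exact: ((sp [::] x).2 i). Qed.

Lemma smooth_continuous (phi : 'rV[R]_N -> R) : smooth phi -> continuous phi.
Proof. by move=> sp x; exact: (sp [::] x).1. Qed.

Lemma smooth_continuous_partial (phi : 'rV[R]_N -> R) (i : 'I_N) : smooth phi ->
  continuous (partial i phi).
Proof. by move=> sp x; exact: (sp [:: i] x).1. Qed.

(** The derivative of u * phi has integral 0 over R^N. *)
Lemma weak_partial_classical (i : 'I_N) (u g : 'rV[R]_N -> R) :
  cont_bounded_support u -> cont_bounded_support g ->
  (forall x, ~ Omega x -> u x = 0) -> (forall x, ~ Omega x -> g x = 0) ->
  (forall x, is_derive x (e_ i) u (g x)) ->
  forall phi, smooth phi ->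
    \int[mu]_(x in Omega) (u x * partial i phi x) =
    - \int[mu]_(x in Omega) (g x * phi x).
Proof.
move=> us gs u0 g0 du phi sp.
rewrite !Rintegral_support; [|by move=> x /g0 ->; rewrite mul0r|by move=> x /u0 ->; rewrite mul0r].
have cp := smooth_continuous sp; have cdp := @smooth_continuous_partial phi i sp.
have us' := cbsM us cdp; have gs' := cbsM gs cp.
have H : \int[mu]_x (u x * partial i phi x + g x * phi x) = 0.
  apply: (@cbs_derive0 R N (fun x => u x * phi x) i).
  - exact: cbsM.
  - exact: cbsD.
  - move=> x; apply: (is_derive_eq (is_derive_mul (du x) (@smooth_is_derive phi i x sp))).
    by rewrite [phi x * _]mulrC.
move: H; rewrite RintegralD//; [|exact: cbs_integrable|exact: cbs_integrable].
by move/eqP; rewrite addr_eq0 => /eqP.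
Qed.

Lemma cbs_sqr_integral_le (f : 'rV[R]_N -> R) (x0 : 'rV[R]_N) (L M : R) :
  cont_bounded_support f -> 0 < L -> (forall x, `|f x| <= M) ->
  (forall x, ~ ball x0 L x -> f x = 0) ->
  \int[mu]_x (f x ^+ 2) <= M ^+ 2 * (2 * L) ^+ N.
Proof.
move=> fs L0 fM f0; have [cf _] := fs.
have mB := @measurable_rV_ball R N x0 _ L0.
have Bfin : (mu (ball x0 L)%R < +oo)%E by rewrite lebesgue_rV_ball// ltry.
have f2 : cont_bounded_support (fun x => f x ^+ 2).
  rewrite (_ : (fun x => _) = fun x => f x * f x); first exact: cbsM.
  by apply/funext => x; rewrite expr2.
have -> : \int[mu]_x (f x ^+ 2) = \int[mu]_(x in ball x0 L) (f x ^+ 2).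
  rewrite [RHS]Rintegral_mkcond; congr (Rintegral _ _ _).
  apply/funext => x; rewrite /patch; case: ifPn => // /negP xB.
  by rewrite f0 ?expr0n// => Bx; apply: xB; rewrite inE.
apply: (@le_trans _ _ (\int[mu]_(x in ball x0 L) (M ^+ 2))).
  apply: le_Rintegral => //.
  - exact: integrableS measurableT mB (@subsetT _ _) (cbs_integrable f2).
  - apply: measurable_bounded_integrable => //.
    exists (M ^+ 2); split; first exact: num_real.
    by move=> K MK x _; rewrite /= ger0_norm ?sqr_ge0// ltW.
  - move=> x _; rewrite -real_normK ?num_real// ler_pXn2r ?nnegrE//.
    exact: le_trans (fM x).
rewrite Rintegral_cst//.
rewrite [X in fine X](_ : _ = ((2 * L) ^+ N)%:E)//; exact: lebesgue_rV_ball.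
Qed.

Variables (x0 : 'rV[R]_N) (k T : R) (F Q : R -> R).
Hypotheses (k0 : 0 < k) (T0 : 0 < T) (cQ : continuous Q).
Hypotheses (dF : forall t : R, is_derive t 1 F (- Q t)).
Hypotheses (FT : forall t, T <= t -> F t = 0) (QT : forall t, T <= t -> Q t = 0).
Hypothesis (KO : [set x | sqrad x0 k x <= T] `<=` Omega).
Local Notation sqrad := (sqrad x0 k).

Definition radial (x : 'rV[R]_N) : R := F (sqrad x).
Definition radial_grad (i : 'I_N) (x : 'rV[R]_N) : R :=
  - Q (sqrad x) * (2 * k * (x ord0 i - x0 ord0 i)).

Let cF : continuous F. Proof. by move=> t; exact: is_derive_cont (dF t). Qed.

Lemma continuous_comp_sqrad (f : R -> R) : continuous f -> continuous (fun x => f (sqrad x)).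
Proof.
by move=> cf x; apply: (@continuous_comp _ _ _ sqrad f _ (@continuous_sqrad R N x0 k x)); exact: cf.
Qed.

Lemma outside_sqrad x : ~ Omega x -> T <= sqrad x.
Proof.
by move=> Ox; apply/ltW; rewrite ltNge; apply/negP => xT; exact: Ox (KO xT).
Qed.

Lemma radial_cbs : cont_bounded_support radial.
Proof.
apply: (@sqrad_cbs R N x0 k T k0 T0); first exact: continuous_comp_sqrad.
by move=> x xT; exact: FT xT.
Qed.

Lemma radial_grad_cbs i : cont_bounded_support (radial_grad i).
Proof.
apply: (@sqrad_cbs R N x0 k T k0 T0).
  move=> x; exact: (cvgM (cvgN (@continuous_comp_sqrad Q cQ x))
    (cvgM (cvg_cst _) (@continuous_coordB R N x0 i x))).
by move=> x /QT; rewrite /radial_grad => ->; rewrite oppr0 mul0r.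
Qed.

Lemma is_derive_radial (i : 'I_N) x : is_derive x (e_ i) radial (radial_grad i x).
Proof. exact: is_derive_sqrad. Qed.

Lemma radial_outside x : ~ Omega x -> radial x = 0.
Proof. by move=> /outside_sqrad xT; exact: FT xT. Qed.

Lemma radial_grad_outside i x : ~ Omega x -> radial_grad i x = 0.
Proof. by move/outside_sqrad/QT; rewrite /radial_grad => ->; rewrite oppr0 mul0r. Qed.

Lemma flatfun_test kap f : 0 < kap -> flatfun x0 k T kap f -> test_function Omega f.
Proof.
move=> kap0 ff; split; first exact: flatfun_smooth ff.
exists [set x | sqrad x <= T]; split => //; first exact: sqrad_compact.
by move=> x /= /negP; rewrite -ltNge => /ltW xT; exact: (flatfun_zero ff xT).
Qed.

(** [flat_approx] is applied to s |-> F (T - s): composed with T - sqrad x, the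
approximations are test functions supported in the same ball as u, and a C^1
estimate on this ball gives an H^1 estimate. *)
Lemma radial_in_H10 : in_H10 Omega radial radial_grad.
Proof.
split.
  split; first exact: (in_L2_cbs radial_cbs).
  move=> i; split; first exact: (in_L2_cbs (radial_grad_cbs i)).
  move=> phi [sp _]; apply: weak_partial_classical => //.
  - exact: radial_cbs.
  - exact: radial_grad_cbs.
  - exact: radial_outside.
  - exact: radial_grad_outside.
  - exact: is_derive_radial.
move=> e e0.
have [k0' T0'] : 0 < k /\ 0 < T by [].
pose L := T / k + 1; have L0 : 0 < L by rewrite /L; have := divr_gt0 T0' k0'; lra.
pose C : R := (2 * L) ^+ N * (1 + N%:R * (2 * k * L) ^+ 2).
have C0 : 0 < C.
  rewrite mulr_gt0 ?exprn_gt0 ?mulr_gt0//.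
  have : 0 <= N%:R * (2 * k * L) ^+ 2 by rewrite mulr_ge0 ?sqr_ge0.
  lra.
have [d [d0 d1 dC]] : exists d : R, [/\ 0 < d, d <= 1 & d * C * 2 <= e].
  exists (Num.min 1 (e / (C * 2))); split.
  - by rewrite lt_min ltr01 divr_gt0// mulr_gt0.
  - by rewrite ge_min lexx.
  - have C2 : 0 < C * 2 by rewrite mulr_gt0.
    by rewrite -mulrA -(ler_pdivlMr _ _ C2) ge_min lexx orbT.
have dT (s : R) : is_derive s 1 (fun t : R => T - t) (-1).
  by apply: (is_derive_eq (is_deriveB (is_derive_cst T s (1 : R)) (is_derive_id s (1 : R)))); rewrite sub0r.
have dG (s : R) : is_derive s 1 (fun s => F (T - s)) (Q (T - s)).
  apply: (is_derive_eq (@is_derive_comp1 R F (fun t => T - t) s _ _ (dF _) (dT s))).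
  by rewrite mulrN1 opprK.
have cg : continuous (fun s => Q (T - s)).
  move=> s; apply: (@continuous_comp _ _ _ (fun s => T - s) Q); last exact: cQ.
  exact: (cvgB (cvg_cst _) cvg_id).
have G0 : F (T - 0) = 0 by rewrite subr0 FT.
have g0 : Q (T - 0) = 0 by rewrite subr0 QT.
have [p [kap [kap0 Hp]]] := flat_approx cg dG G0 g0 T0 d0.
pose phi x := p.[T - sqrad x] * flat kap 0 (T - sqrad x).
have fphi : flatfun x0 k T kap phi by apply: flatfun_horner; exact: flatfun_flat.
pose dphi (s : R) := p^`().[s] * flat kap 0 s + p.[s] * (kap * flat kap 2 s).
have tphi := flatfun_test kap0 fphi; have [sphi _] := tphi.
have dphiE i x : partial i phi x = - dphi (T - sqrad x) * (2 * k * (x ord0 i - x0 ord0 i)).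
  have dp (s : R) : is_derive s 1 (fun s => p.[s] * flat kap 0 s) (dphi s).
    apply: (is_derive_eq (is_derive_mul (is_derive_poly p s) (is_derive_flat kap0 0 s))).
    by rewrite /dphi oppr0 mul0r add0r; ring.
  have d2 : is_derive (sqrad x) 1 (fun t => p.[T - t] * flat kap 0 (T - t)) (- dphi (T - sqrad x)).
    apply: (is_derive_eq (@is_derive_comp1 R _ (fun t => T - t) (sqrad x) _ _ (dp _) (dT _))).
    by rewrite mulrN1.
  by have [_ <-] := is_derive_sqrad i d2.
have phi0 x : T <= sqrad x -> phi x = 0 by move=> xT; exact: (flatfun_zero fphi).
have dphi0 s : s <= 0 -> dphi s = 0.
  by move=> s0; rewrite /dphi /flat ltNge s0 /= !mulr0 addr0.
have phis : cont_bounded_support phi.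
  by apply: (@sqrad_cbs R N x0 k T k0 T0) => //; exact: smooth_continuous.
have dphis i : cont_bounded_support (partial i phi).
  apply: (@sqrad_cbs R N x0 k T k0 T0); first exact: smooth_continuous_partial.
  by move=> x xT; rewrite dphiE dphi0 ?subr_le0// oppr0 mul0r.
exists phi => //.
have ballT x : ~ ball x0 L x -> T <= sqrad x.
  by move=> xL; apply/ltW; rewrite ltNge; apply/negP => /(sqrad_ball k0 T0).
have pO x : ~ Omega x -> T <= sqrad x by exact: outside_sqrad.
rewrite Rintegral_support; last first.
  by move=> x /pO xT; rewrite /radial FT// phi0// subrr expr0n.
under eq_bigr => i _.
  rewrite Rintegral_support; last first.
    move=> x Ox; rewrite radial_grad_outside// dphiE dphi0 ?subr_le0 ?pO//.
    by rewrite oppr0 mul0r subrr expr0n.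
  over.
have I1 : \int[mu]_x (radial x - phi x) ^+ 2 <= d ^+ 2 * (2 * L) ^+ N.
  apply: (@cbs_sqr_integral_le _ x0) => //.
  - by apply: cbsB => //; exact: radial_cbs.
  - move=> x; have [xT|xT] := leP T (sqrad x).
      by rewrite /radial FT// phi0// subrr normr0 ltW.
    have := Hp (T - sqrad x); rewrite subr_gt0 => /(_ xT).
    rewrite lerBlDr lerDl sqrad_ge0// => /(_ isT)[h _].
    by rewrite distrC; move: h; rewrite /radial subKr.
  - by move=> x /ballT xT; rewrite /radial FT// phi0// subrr.
have I2 i : \int[mu]_x (radial_grad i x - partial i phi x) ^+ 2 <=
    (d * (2 * k * L)) ^+ 2 * (2 * L) ^+ N.
  apply: (@cbs_sqr_integral_le _ x0) => //.
  - by apply: cbsB => //; exact: radial_grad_cbs.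
  - move=> x; rewrite /radial_grad dphiE -mulrBl.
    have [xT|xT] := leP T (sqrad x).
      rewrite QT// dphi0 ?subr_le0// subrr mul0r normr0.
      by rewrite !mulr_ge0 ?(ltW d0) ?(ltW k0) ?(ltW L0).
    have := Hp (T - sqrad x); rewrite subr_gt0 => /(_ xT).
    rewrite lerBlDr lerDl sqrad_ge0// subKr => /(_ isT)[_ h].
    rewrite normrM -opprD normrN; apply: ler_pM => //.
      by rewrite distrC.
    rewrite normrM ger0_norm ?mulr_ge0 ?(ltW k0)// ler_pM2l ?mulr_gt0//.
    have := sqrad_ball k0 T0 (ltW xT); rewrite rV_ballE// => /(_ i).
    by rewrite distrC => /ltW.
  - move=> x /ballT xT; rewrite /radial_grad QT// dphiE dphi0 ?subr_le0//.
    by rewrite subrr.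
apply: (@le_lt_trans _ _ (d ^+ 2 * (2 * L) ^+ N + \sum_(i < N) (d * (2 * k * L)) ^+ 2 * (2 * L) ^+ N)).
  by rewrite lerD// ler_sum.
rewrite sumr_const card_ord.
have -> : d ^+ 2 * (2 * L) ^+ N + (d * (2 * k * L)) ^+ 2 * (2 * L) ^+ N *+ N = d ^+ 2 * C.
  by rewrite /C -mulr_natr; ring.
apply: (@le_lt_trans _ _ (d * C)).
  by rewrite ler_pM2r// expr2 ler_piMr// ltW.
lra.
Qed.

End sobolev.

(** * Density of the test functions in the weak formulation *)

Section density.
Variables (R : realType) (N : nat) (Omega : set 'rV[R]_N).
Hypothesis oO : open Omega.
Local Notation mu := (lebesgue_rV R N).
Local Notation e_ i := (delta_mx ord0 i : 'rV[R]_N).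
Implicit Types f g : 'rV[R]_N -> R.

Let mO : measurable Omega. Proof. exact: open_measurable_rV. Qed.

Lemma in_L2_measurableM f g : in_L2 Omega f -> in_L2 Omega g ->
  measurable_fun Omega (EFin \o (fun x => f x * g x)).
Proof. by move=> [mf _] [mg _]; apply/measurable_EFinP; exact: measurable_funM. Qed.

Lemma in_L2_integrableM f g : in_L2 Omega f -> in_L2 Omega g ->
  mu.-integrable Omega (EFin \o (fun x => f x * g x)).
Proof.
move=> f2 g2; have [_ if2] := f2; have [_ ig2] := g2.
apply: (le_integrable mO _ _ (integrableD mO if2 ig2)).
  exact: in_L2_measurableM.
move=> x _ /=; rewrite lee_fin [leRHS]ger0_norm ?addr_ge0 ?sqr_ge0//.
rewrite normrM -[f x ^+ 2]real_normK ?num_real// -[g x ^+ 2]real_normK ?num_real//.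
have := sqr_ge0 (`|f x| - `|g x|); have := sqr_ge0 (`|f x|); have := sqr_ge0 (`|g x|).
by rewrite !expr2; nra.
Qed.

Lemma in_L2B f g : in_L2 Omega f -> in_L2 Omega g -> in_L2 Omega (fun x => f x - g x).
Proof.
move=> f2 g2; have [mf if2] := f2; have [mg ig2] := g2.
have mfg : measurable_fun Omega (fun x => f x - g x) by exact: measurable_funB.
split => //.
apply: (le_integrable mO _ _ (integrableD mO (integrableZl mO 2 if2) (integrableZl mO 2 ig2))).
  by apply/measurable_EFinP; under eq_fun do rewrite expr2; exact: measurable_funM.
move=> x _ /=; rewrite lee_fin [leLHS]ger0_norm ?sqr_ge0// [leRHS]ger0_norm; last first.
  by have := sqr_ge0 (f x); have := sqr_ge0 (g x); lra.
have := sqr_ge0 (f x + g x); rewrite !expr2; lra.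
Qed.

(** Young's inequality with a free parameter e serves as a Cauchy-Schwarz inequality:
it makes a pairing small when the second factor is small in L^2. *)
Lemma Rintegral_young f g (e : R) : 0 < e -> in_L2 Omega f -> in_L2 Omega g ->
  `|\int[mu]_(x in Omega) (f x * g x)| <=
  (e * \int[mu]_(x in Omega) (f x ^+ 2) + e^-1 * \int[mu]_(x in Omega) (g x ^+ 2)) / 2.
Proof.
move=> e0 f2 g2; have ifg := in_L2_integrableM f2 g2.
have [_ if2] := f2; have [_ ig2] := g2.
apply: (le_trans (le_normr_Rintegral mO ifg)).
have i1 : mu.-integrable Omega (EFin \o (fun x => e * f x ^+ 2)) by exact: (integrableZl mO e if2).
have i2 : mu.-integrable Omega (EFin \o (fun x => e^-1 * g x ^+ 2)) by exact: (integrableZl mO e^-1 ig2).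
have i12 : mu.-integrable Omega (EFin \o (fun x => e * f x ^+ 2 + e^-1 * g x ^+ 2)) by exact: (integrableD mO i1 i2).
have -> : (e * \int[mu]_(x in Omega) (f x ^+ 2) + e^-1 * \int[mu]_(x in Omega) (g x ^+ 2)) / 2 =
   \int[mu]_(x in Omega) (2^-1 * (e * f x ^+ 2 + e^-1 * g x ^+ 2)).
  have E1 := RintegralZl 2^-1 mO i12; have E2 := RintegralD mO i1 i2.
  have E3 := RintegralZl e mO if2; have E4 := RintegralZl e^-1 mO ig2.
  by rewrite E1 E2 E3 E4 mulrC.
apply: le_Rintegral => //.
- have := integrable_norm ifg; congr (integrable _ _ _).
- exact: (integrableZl mO 2^-1 i12).
move=> x _; rewrite normrM -[f x ^+ 2]real_normK ?num_real// -[g x ^+ 2]real_normK ?num_real//.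
rewrite [leRHS]mulrC ler_pdivlMr//.
rewrite -(ler_pM2l e0) [leRHS](_ : _ = e * e * `|f x| ^+ 2 + `|g x| ^+ 2); last first.
  by field; rewrite gt_eqF.
have := sqr_ge0 (e * `|f x| - `|g x|); rewrite !expr2; lra.
Qed.

Lemma Rintegral_sum (I : Type) (s : seq I) (f : I -> 'rV[R]_N -> R) :
  (forall i, mu.-integrable Omega (EFin \o f i)) ->
  \int[mu]_(x in Omega) (\sum_(i <- s) f i x) = \sum_(i <- s) \int[mu]_(x in Omega) f i x.
Proof.
move=> fi; elim: s => [|i s IH].
  rewrite big_nil; under eq_Rintegral do rewrite big_nil.
  by rewrite Rintegral_cst// mul0r.
rewrite big_cons -IH; under eq_Rintegral do rewrite big_cons.
rewrite RintegralD//.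
have := @integrable_sum _ _ _ mu Omega mO I s xpredT (fun i => EFin \o f i) (fun i _ => fi i).
congr (integrable _ _ _); apply/funext => x /=.
by rewrite sumEFin.
Qed.

Lemma test_function_cbs (phi : 'rV[R]_N -> R) : test_function Omega phi ->
  cont_bounded_support phi /\ forall i, cont_bounded_support (partial i phi).
Proof.
move=> [sp [K [cK KO phi0]]].
have [M [_ HM]] := compact_bounded cK.
have KM (x : 'rV[R]_N) : `|M| + 1 < `|x| -> ~ K x.
  move=> Mx Kx; have M1 : M < `|M| + 1 by have := ler_norm M; lra.
  by have := HM _ M1 x Kx; rewrite /= leNgt Mx.
split.
  split; first exact: smooth_continuous.
  by exists (`|M| + 1) => x /KM; exact: phi0.
move=> i; split; first exact: smooth_continuous_partial.
exists (`|M| + 1) => x /KM xK; rewrite /partial.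
have oK : open (~` K) by apply: closed_openC; apply: compact_closed => //; exact: norm_hausdorff.
have nK : nbhs x (~` K) by exact: open_nbhs_nbhs.
rewrite (@near_eq_derive _ _ _ phi (cst 0)) ?derive_cst//.
by apply: filterS nK => y /phi0.
Qed.

(** An identity between continuous functionals which holds for the test
functions holds on their closure H^1_0. *)
Lemma H10_density (G : 'I_N -> 'rV[R]_N -> R) (P : 'rV[R]_N -> R) :
  (forall i, in_L2 Omega (G i)) -> in_L2 Omega P ->
  (forall psi, test_function Omega psi ->
    \sum_(i < N) \int[mu]_(x in Omega) (G i x * partial i psi x) =
    \int[mu]_(x in Omega) (P x * psi x)) ->
  forall phi h, in_H10 Omega phi h ->
    \int[mu]_(x in Omega) (\sum_(i < N) G i x * h i x) =
    \int[mu]_(x in Omega) (P x * phi x).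
Proof.
move=> G2 P2 H phi h [[phi2 h2] Happ].
have {}h2 i : in_L2 Omega (h i) by have [] := h2 i.
rewrite Rintegral_sum; last by move=> i; exact: in_L2_integrableM.
apply/eqP; rewrite -subr_eq0 -normr_le0; apply/ler_addgt0Pr => e0 e00; rewrite add0r.
pose B := \sum_(i < N) \int[mu]_(x in Omega) (G i x ^+ 2) + \int[mu]_(x in Omega) (P x ^+ 2).
have B0 : 0 <= B.
  by rewrite addr_ge0 ?sumr_ge0//; [move=> i _|]; apply: Rintegral_ge0 => x _; exact: sqr_ge0.
pose e := e0 / (B + 1).
have e_gt0 : 0 < e by rewrite divr_gt0//; lra.
have e2 : 0 < e ^+ 2 by rewrite exprn_gt0.
have [psi tpsi Hpsi] := Happ _ e2.
have [psis dpsis] := test_function_cbs tpsi.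
have psi2 := in_L2_cbs oO psis; have dpsi2 i := in_L2_cbs oO (dpsis i).
have dphi2 := in_L2B phi2 psi2; have dh2 i := in_L2B (h2 i) (dpsi2 i).
have E1 : \int[mu]_(x in Omega) (P x * phi x) =
   \int[mu]_(x in Omega) (P x * psi x) + \int[mu]_(x in Omega) (P x * (phi x - psi x)).
  rewrite -RintegralD//; [|exact: in_L2_integrableM|exact: in_L2_integrableM].
  by apply: eq_Rintegral => x _; ring.
have E2 i : \int[mu]_(x in Omega) (G i x * h i x) =
   \int[mu]_(x in Omega) (G i x * partial i psi x) +
   \int[mu]_(x in Omega) (G i x * (h i x - partial i psi x)).
  rewrite -RintegralD//; [|exact: in_L2_integrableM|exact: in_L2_integrableM].
  by apply: eq_Rintegral => x _; ring.
rewrite E1 (eq_bigr _ (fun i _ => E2 i)) big_split /= H//.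
rewrite [X in `|X|](_ : _ = \sum_(i < N) \int[mu]_(x in Omega) (G i x * (h i x - partial i psi x)) -
  \int[mu]_(x in Omega) (P x * (phi x - psi x))); last ring.
apply: le_trans (ler_normB _ _) _.
have Y1 := Rintegral_young e_gt0 P2 dphi2.
have Y2 : `|\sum_(i < N) \int[mu]_(x in Omega) (G i x * (h i x - partial i psi x))| <=
   (e * \sum_(i < N) \int[mu]_(x in Omega) (G i x ^+ 2) +
    e^-1 * \sum_(i < N) \int[mu]_(x in Omega) ((h i x - partial i psi x) ^+ 2)) / 2.
  apply: le_trans (ler_norm_sum _ _ _) _.
  rewrite !mulr_sumr -big_split mulr_suml /=; apply: ler_sum => i _.
  exact: Rintegral_young.
apply: (le_trans (lerD Y2 Y1)); rewrite -mulrDl.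
apply: (@le_trans _ _ ((e * B + e^-1 * e ^+ 2) / 2)).
  rewrite ler_pM2r// [leLHS](_ : _ = e * B + e^-1 *
      (\int[mu]_(x in Omega) (phi x - psi x) ^+ 2 +
       \sum_(i < N) \int[mu]_(x in Omega) (h i x - partial i psi x) ^+ 2)); last first.
    by rewrite /B; ring.
  by rewrite lerD2l ler_pM2l ?invr_gt0// ltW.
rewrite expr2 mulrA mulVf ?gt_eqF// mul1r.
have -> : e0 = e * (B + 1) by rewrite /e divfK// gt_eqF//; lra.
by nra.
Qed.

End density.

(** * The Laplacian of a radial function *)

Lemma is_derive_mul_id (R : realType) (f : R -> R) : {for 0, continuous f} ->
  is_derive (0 : R) 1 (fun s => f s * s) (f 0).
Proof.
move=> cf; apply: slope_is_derive => e e0.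
have cf0 : \forall s \near (0 : R), `|f 0 - f s| <= e by exact: (proj1 (cvgrPdist_le _ _) cf).
have [d /= d0 Hd] := (nbhs_ballP _ _).1 cf0.
exists d => // a b ab abc; rewrite !subr0 => ad bd.
have fb (s : R) : `|s| < d -> `|f s - f 0| <= e.
  by move=> sd; rewrite distrC; apply: Hd; rewrite /= /ball /= sub0r normrN.
case: abc => E; move: ab ad bd; rewrite E => ab ad bd.
  rewrite mulr0 !subr0 -mulrBl normrM [`|b|]ger0_norm//.
  by apply: ler_wpM2r => //; exact: fb.
rewrite mulr0 !sub0r.
rewrite (_ : _ - _ = (f a - f 0) * - a); last ring.
rewrite normrM normrN [`|a|]ler0_norm//.
by apply: ler_wpM2r; [rewrite oppr_ge0|exact: fb].
Qed.

Section laplacian.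
Variables (R : realType) (N : nat) (Omega : set 'rV[R]_N).
Hypothesis oO : open Omega.
Local Notation mu := (lebesgue_rV R N).
Local Notation e_ i := (delta_mx ord0 i : 'rV[R]_N).
Variables (x0 : 'rV[R]_N) (k T : R) (Q S : R -> R).
Hypotheses (k0 : 0 < k) (T0 : 0 < T) (cQ : continuous Q) (cS : continuous S).
Hypotheses (S0 : S 0 = 0) (QT : forall t, T <= t -> Q t = 0) (ST : forall t, T <= t -> S t = 0).
Hypothesis (dQ : forall t : R, 0 < t -> is_derive t 1 Q (S t / (2 * t))).
Hypothesis (KO : [set x | sqrad x0 k x <= T] `<=` Omega).
Local Notation srad := (sqrad x0 k).
Local Notation rgrad := (radial_grad x0 k Q).

(** The derivative of [radial_grad i] in the direction i when Q'(t) = S(t) / (2 t).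
At the centre the second term vanishes with x_i - x0_i. *)
Definition radial_hess (i : 'I_N) (x : 'rV[R]_N) : R :=
  - (2 * k) * Q (srad x) -
  (2 * k * (x ord0 i - x0 ord0 i)) ^+ 2 * (S (srad x) / (2 * srad x)).

Lemma sqrad_coord_le (i : 'I_N) (x : 'rV[R]_N) : k * (x ord0 i - x0 ord0 i) ^+ 2 <= srad x.
Proof.
rewrite ler_pM2l// /sqdist (bigD1 i)//= lerDl.
by apply: sumr_ge0 => j _; exact: sqr_ge0.
Qed.

Lemma sqrad_eq0_coord (i : 'I_N) (x : 'rV[R]_N) : srad x = 0 -> x ord0 i = x0 ord0 i.
Proof.
have k0' := k0; move=> s0; have := sqrad_coord_le i x; rewrite s0.
have := sqr_ge0 (x ord0 i - x0 ord0 i) => h1 h2.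
have /eqP : (x ord0 i - x0 ord0 i) ^+ 2 = 0 by nra.
by rewrite sqrf_eq0 subr_eq0 => /eqP.
Qed.

(** At the centre Q need not be differentiable, but there [radial_grad i] is Q times
a factor that vanishes, and continuity of Q is enough. *)
Lemma is_derive_radial_grad (i : 'I_N) x :
  is_derive x (e_ i) (rgrad i) (radial_hess i x).
Proof.
have := @sqrad_ge0 R N x0 k k0 x; rewrite le_eqVlt => /predU1P[/esym s0|s0].
  have xi := sqrad_eq0_coord i s0.
  rewrite /radial_hess xi subrr mulr0 expr0n /= mul0r subr0 s0.
  suff : is_derive (x + 0 *: e_ i) (e_ i) (rgrad i) (- (2 * k) * Q 0).
    by rewrite scale0r addr0.
  apply: (proj2 (@is_derive_lineP R _ (rgrad i) x (e_ i) 0 _)).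
  have -> : (fun t : R => rgrad i (x + t *: e_ i)) =
      (fun t : R => (- (2 * k) * Q (k * (t * t))) * t).
    apply/funext => t; rewrite /radial_grad.
    have -> : sqrad x0 k (x + t *: e_ i) = k * (t * t).
      rewrite /sqrad sqdist_line xi subrr mulr0 mulr0 addr0.
      by move: s0; rewrite /sqrad mulrDr => ->; rewrite add0r expr2.
    by rewrite !mxE !eqxx /= xi; ring.
  have -> : - (2 * k) * Q 0 = (fun t : R => - (2 * k) * Q (k * (t * t))) 0.
    by rewrite /= !mulr0.
  apply: (@is_derive_mul_id R (fun t : R => - (2 * k) * Q (k * (t * t)))).
  have cq : {for (0 : R), continuous (fun t : R => k * (t * t))}.
    exact: (cvgM (cvg_cst _) (cvgM cvg_id cvg_id)).
  have cQq : {for (0 : R), continuous (fun t : R => Q (k * (t * t)))}.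
    by apply: (@continuous_comp _ _ _ (fun t : R => k * (t * t)) Q _ cq); exact: cQ.
  exact: (cvgM (cvg_cst _) cQq).
have d1 := is_derive_sqrad i (dQ s0).
have d2 := is_derive_mul (is_derive_cst (- (2 * k)) x (e_ i)) d1.
have d3 := is_derive_mul d2 (is_derive_coord x0 x i i).
rewrite (_ : rgrad i = fun y => - (2 * k) * Q (srad y) * (y ord0 i - x0 ord0 i)); last first.
  by apply/funext => y; rewrite /radial_grad; ring.
apply: (is_derive_eq d3).
by rewrite eqxx /= mulr1 /radial_hess /cst; ring.
Qed.

(** Near the centre the second term is at most 2 k |S|, since k (x_i - x0_i)^2 is at
most sqrad x, and S vanishes at 0. *)
Lemma radial_hess_continuous (i : 'I_N) : continuous (radial_hess i).
Proof.
have k0' := k0; move=> x.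
have cs := @continuous_sqrad R N x0 k x.
have cSs : {for x, continuous (fun x => S (srad x))} by exact: continuous_comp_sqrad.
have c1 : {for x, continuous (fun x => - (2 * k) * Q (srad x))}.
  exact: (cvgM (cvg_cst _) (@continuous_comp_sqrad R N x0 k Q cQ x)).
pose W (y : 'rV[R]_N) := (2 * k * (y ord0 i - x0 ord0 i)) ^+ 2 * (S (srad y) / (2 * srad y)).
suff c2 : W @ x --> W x by exact: (cvgB c1 c2).
have := @sqrad_ge0 R N x0 k k0 x; rewrite le_eqVlt => /predU1P[/esym s0|s0].
  rewrite [X in cvg_to _ (nbhs X)](_ : _ = 0); last by rewrite /W s0 S0 mul0r mulr0.
  apply: (proj2 (@cvgr0Pnorm_le _ _ _ (nbhs x) _ W)) => e e0.
  have e2 : 0 < e / (2 * k) by rewrite divr_gt0// mulr_gt0.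
  have cS0 : (fun y => S (srad y)) @ x --> (0 : R) by rewrite -S0 -s0; exact: cSs.
  have : \forall y \near x, `|S (srad y)| <= e / (2 * k).
    exact: (proj1 (cvgr0Pnorm_le _) cS0).
  apply: filterS => y; rewrite /W.
  have := @sqrad_ge0 R N x0 k k0 y; rewrite le_eqVlt => /predU1P[<-|y0].
    by rewrite S0 mul0r mulr0 normr0 => _; exact: ltW.
  rewrite ler_pdivlMr ?mulr_gt0// => h; apply: le_trans h.
  rewrite normrM [`|S _ / _|]normrM normfV [`|2 * _|]ger0_norm; last by rewrite mulr_ge0// ltW.
  rewrite ger0_norm ?sqr_ge0// mulrCA; apply: ler_wpM2l => //.
  have y2 : 0 < 2 * srad y by lra.
  rewrite (ler_pdivrMr _ _ y2).
  have := sqrad_coord_le i y; rewrite exprMn; nra.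
have cc := @continuous_coordB R N x0 i x.
have ci : (fun x : 'rV[R]_N => (2 * srad x)^-1) @ x --> (2 * srad x)^-1.
  have s2 : 2 * srad x != 0 by rewrite gt_eqF// pmulr_rgt0.
  have c2s : (fun y : 'rV[R]_N => 2 * srad y) @ x --> 2 * srad x.
    exact: (cvgM (cvg_cst (2 : R)) cs).
  exact: (cvgV s2 c2s).
have c3 : (fun y : 'rV[R]_N => 2 * k * (y ord0 i - x0 ord0 i)) @ x --> 2 * k * (x ord0 i - x0 ord0 i).
  exact: (cvgM (cvg_cst _) cc).
have -> : W = (fun y : 'rV[R]_N => (2 * k * (y ord0 i - x0 ord0 i)) * (2 * k * (y ord0 i - x0 ord0 i)) *
    (S (srad y) / (2 * srad y))) by apply/funext => y; rewrite /W expr2.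
exact: (cvgM (cvgM c3 c3) (cvgM cSs ci)).
Qed.

Lemma radial_hess_cbs i : cont_bounded_support (radial_hess i).
Proof.
apply: (@sqrad_cbs R N x0 k T k0 T0); first exact: radial_hess_continuous.
by move=> x xT; rewrite /radial_hess QT// ST// mulr0 mul0r mulr0 subrr.
Qed.

Lemma sum_radial_hess x :
  \sum_(i < N) radial_hess i x = - (2 * k) * (N%:R * Q (srad x) + S (srad x)).
Proof.
rewrite big_split /= sumr_const card_ord sumrN -mulr_suml.
under eq_bigr do rewrite exprMn.
rewrite -mulr_sumr -/(sqdist x0 x) -[_ *+ N]mulr_natl.
suff -> : (2 * k) ^+ 2 * sqdist x0 x * (S (srad x) / (2 * srad x)) = 2 * k * S (srad x) by ring.
have := @sqrad_ge0 R N x0 k k0 x; rewrite le_eqVlt => /predU1P[/esym s0|s0].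
  by rewrite s0 S0 mul0r !mulr0.
have sE : srad x = k * sqdist x0 x by [].
have d0 : sqdist x0 x != 0 by apply: contraTneq s0; rewrite sE => ->; rewrite mulr0 ltxx.
by rewrite sE; field; rewrite d0 gt_eqF.
Qed.

(** Integration by parts against test functions, extended to H^1_0 by density. *)
Lemma radial_weak_laplacian phi h : in_H10 Omega phi h ->
  \int[mu]_(x in Omega) (\sum_(i < N) rgrad i x * h i x) =
  \int[mu]_(x in Omega) (2 * k * (N%:R * Q (srad x) + S (srad x)) * phi x).
Proof.
have Ps : cont_bounded_support (fun x : 'rV[R]_N => 2 * k * (N%:R * Q (srad x) + S (srad x))).
  apply: (@sqrad_cbs R N x0 k T k0 T0).
    move=> x; have cQx := @continuous_comp_sqrad R N x0 k Q cQ x.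
    have cSx := @continuous_comp_sqrad R N x0 k S cS x.
    exact: (cvgM (cvg_cst _) (cvgD (cvgM (cvg_cst _) cQx) cSx)).
  by move=> x xT; rewrite QT// ST// mulr0 addr0 mulr0.
apply: (H10_density oO).
- by move=> i; apply: (in_L2_cbs oO); apply: (@radial_grad_cbs _ _ _ _ T).
- exact: (in_L2_cbs oO Ps).
move=> psi tpsi; have [sp _] := tpsi; have cp := smooth_continuous sp.
rewrite (eq_bigr (fun i => - \int[mu]_(x in Omega) (radial_hess i x * psi x))); last first.
  move=> i _; apply: weak_partial_classical => //.
  - by apply: (@radial_grad_cbs _ _ _ _ T).
  - exact: radial_hess_cbs.
  - by move=> x Ox; exact: (radial_grad_outside QT KO).
  - move=> x /(outside_sqrad KO) xT.
    by rewrite /radial_hess QT// ST// mulr0 mul0r mulr0 subrr.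
  - exact: is_derive_radial_grad.
have mO : measurable Omega by exact: open_measurable_rV.
have ci i : mu.-integrable Omega (EFin \o (fun x => radial_hess i x * psi x)).
  by apply: cbs_integrableS => //; apply: cbsM => //; exact: radial_hess_cbs.
rewrite sumrN -(Rintegral_sum oO _ ci) -mulN1r -RintegralZl//.
  apply: eq_Rintegral => x _; rewrite -mulr_suml sum_radial_hess; ring.
have := @integrable_sum _ _ _ mu Omega mO _ (index_enum 'I_N) xpredT (fun i => EFin \o (fun x => radial_hess i x * psi x)) (fun i _ => ci i).
congr (integrable _ _ _); apply/funext => x /=.
by rewrite sumEFin.
Qed.

End laplacian.

(** * Rescaled solutions *)

Section scaled_profile.
Variables (R : realType) (N : nat) (Omega : set 'rV[R]_N).
Hypothesis oO : open Omega.
Local Notation mu := (lebesgue_rV R N).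
Local Notation e_ i := (delta_mx ord0 i : 'rV[R]_N).
Variables (al be A T : R) (F Q : R -> R).
Hypotheses (al0 : 0 < al) (albe : al < be) (T0 : 0 < T).
Hypotheses (F0 : F 0 = 1) (F01 : forall t, 0 <= t -> 0 <= F t <= 1).
Hypotheses (FT : forall t, T <= t -> F t = 0) (QT : forall t, T <= t -> Q t = 0).
Hypotheses (cQ : continuous Q) (NQ0 : N%:R * Q 0 = 1 - A).
Hypothesis (dF : forall t : R, is_derive t 1 F (- Q t)).
Hypothesis (dQ : forall t : R, 0 < t ->
  is_derive t 1 Q ((F t `^ be - A * F t `^ al - N%:R * Q t) / (2 * t))).

(** The Dirichlet integral of y |-> F (|y|^2 / 2), as |y| Q is the length of its
gradient. *)
Definition profile_energy : R :=
  \int[mu]_y (sqdist 0 y * Q (sqrad 0 2^-1 y) ^+ 2).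

Let cF : continuous F. Proof. by move=> t; exact: is_derive_cont (dF t). Qed.

Lemma profile_energy_cbs :
  cont_bounded_support (fun y : 'rV[R]_N => sqdist 0 y * Q (sqrad 0 2^-1 y) ^+ 2).
Proof.
have h0 : 0 < 2^-1 :> R by rewrite invr_gt0.
apply: (@sqrad_cbs R N 0 2^-1 T h0 T0); last first.
  by move=> y /QT ->; rewrite expr0n mulr0.
have -> : (fun y : 'rV[R]_N => sqdist 0 y * Q (sqrad 0 2^-1 y) ^+ 2) =
   (fun y => sqrad 0 1 y * (Q (sqrad 0 2^-1 y) * Q (sqrad 0 2^-1 y))).
  by apply/funext => y; rewrite /sqrad mul1r expr2.
move=> y; have cQy := @continuous_comp_sqrad R N 0 2^-1 Q cQ y.
exact: (cvgM (@continuous_sqrad R N 0 1 y) (cvgM cQy cQy)).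
Qed.

Lemma sqdist_axis (x0 : 'rV[R]_N) (i : 'I_N) (s : R) : sqdist x0 (x0 + s *: e_ i) = s ^+ 2.
Proof.
rewrite sqdist_line subrr mulr0 mulr0 addr0 [sqdist x0 x0]big1 ?add0r//.
by move=> j _; rewrite subrr expr0n.
Qed.

Lemma profile_energy_gt0 (i : 'I_N) (t : R) : 0 < t -> 0 < Q t -> 0 < profile_energy.
Proof.
move=> t0 Qt; apply: (@cbs_int_gt0 R N _ (Num.sqrt (2 * t) *: e_ i) profile_energy_cbs).
  by move=> y; rewrite mulr_ge0 ?sqr_ge0// sqdist_ge0.
have E : sqdist 0 (Num.sqrt (2 * t) *: e_ i) = 2 * t.
  by rewrite -[_ *: _]add0r sqdist_axis sqr_sqrtr// mulr_ge0// ltW.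
rewrite /sqrad E mulrA mulVf ?pnatr_eq0// mul1r.
by apply: mulr_gt0; [rewrite mulr_gt0|exact: exprn_gt0].
Qed.

Variables (x0 : 'rV[R]_N) (rho c : R).
Hypotheses (rho0 : 0 < rho) (c0 : 0 < c).
(** Makes the variable of the profile |x - x0|^2 / (2 rho^2). *)
Definition sol_k : R := (2 * rho ^+ 2)^-1.
Hypothesis (KO : [set x | sqrad x0 sol_k x <= T] `<=` Omega).

Definition sol : 'rV[R]_N -> R := radial x0 sol_k (fun t => c * F t).
Definition sol_grad : 'I_N -> 'rV[R]_N -> R := radial_grad x0 sol_k (fun t => c * Q t).

Let k0 : 0 < sol_k. Proof. by rewrite invr_gt0 mulr_gt0// exprn_gt0. Qed.

Let ccQ : continuous (fun t => c * Q t).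
Proof. move=> t; exact: (cvgM (cvg_cst _) (@cQ t)). Qed.

Let dcF (t : R) : is_derive t 1 (fun t => c * F t) (- (c * Q t)).
Proof.
apply: (is_derive_eq (is_derive_mul (is_derive_cst c t (1 : R)) (dF t))).
by rewrite /cst /= mulr0 addr0 mulrN.
Qed.

Let cFT t : T <= t -> c * F t = 0. Proof. by move=> /FT ->; rewrite mulr0. Qed.
Let cQT t : T <= t -> c * Q t = 0. Proof. by move=> /QT ->; rewrite mulr0. Qed.

Lemma sol_in_H10 : in_H10 Omega sol sol_grad.
Proof. exact: (radial_in_H10 oO k0 T0 ccQ dcF cFT cQT KO). Qed.

Lemma sol_cbs : cont_bounded_support sol.
Proof. exact: (radial_cbs x0 k0 T0 dcF cFT). Qed.

Lemma sol_ge0_le (x : 'rV[R]_N) : 0 <= sol x <= c.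
Proof.
have /F01 /andP[f0 f1] := @sqrad_ge0 R N x0 sol_k k0 x.
by rewrite /sol /radial mulr_ge0 ?(ltW c0)//= ler_piMr// ltW.
Qed.

Lemma sol_center : sol x0 = c.
Proof.
rewrite /sol /radial /sqrad (_ : sqdist x0 x0 = 0) ?mulr0 ?F0 ?mulr1//.
by rewrite /sqdist big1// => i _; rewrite subrr expr0n.
Qed.

Lemma sol_not_ae0 : ~ {ae mu, forall x, Omega x -> sol x = 0}.
Proof.
move=> sol0; have scbs := sol_cbs.
have : 0 < \int[mu]_x sol x.
  apply: (@cbs_int_gt0 R N sol x0 scbs); first by move=> x; have /andP[] := sol_ge0_le x.
  by rewrite sol_center.
have so x : ~ Omega x -> sol x = 0 by exact: (radial_outside cFT KO).
have ae0 : {ae mu, forall x, setT x -> (sol x)%:E = 0%E}.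
  apply: filterS sol0 => x sx _; have [Ox|Ox] := pselect (Omega x); first by rewrite sx.
  by rewrite so.
have : (\int[mu]_x (sol x)%:E = 0)%E.
  rewrite (ae_eq_integral (cst 0%E)) ?integral0//.
  by apply: measurable_int (cbs_integrable scbs).
by rewrite /Rintegral => ->; rewrite ltxx.
Qed.

Lemma sum_sol_grad_sqr (y : 'rV[R]_N) :
  \sum_(i < N) sol_grad i (affine x0 rho y) ^+ 2 =
  c ^+ 2 / rho ^+ 2 * (sqdist 0 y * Q (sqrad 0 2^-1 y) ^+ 2).
Proof.
have r0 : rho != 0 by rewrite gt_eqF.
have coordE i : affine x0 rho y ord0 i - x0 ord0 i = rho * y ord0 i.
  by rewrite /affine !mxE addrAC subrr add0r.
have sE : sqrad x0 sol_k (affine x0 rho y) = sqrad 0 2^-1 y.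
  rewrite /sqrad /sqdist; under eq_bigr do rewrite coordE exprMn.
  under [in RHS]eq_bigr do rewrite mxE subr0.
  by rewrite -mulr_sumr mulrA /sol_k; congr (_ * _); field.
rewrite /sol_grad /radial_grad sE.
rewrite (eq_bigr (fun i => c ^+ 2 * Q (sqrad 0 2^-1 y) ^+ 2 / rho ^+ 2 * y ord0 i ^+ 2)); last first.
  by move=> i _; rewrite coordE /sol_k; field.
rewrite -mulr_sumr /sqdist; under [in RHS]eq_bigr do rewrite mxE subr0.
ring.
Qed.

Lemma sol_W_norm :
  W_norm Omega sol_grad ^+ 2 = c ^+ 2 * (rho ^+ N / rho ^+ 2) * profile_energy.
Proof.
have gcbs i := @radial_grad_cbs R N x0 sol_k T (fun t => c * Q t) k0 T0 ccQ cQT i.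
have sg0 (x : 'rV[R]_N) : 0 <= \sum_(i < N) sol_grad i x ^+ 2.
  by apply: sumr_ge0 => i _; exact: sqr_ge0.
rewrite /W_norm sqr_sqrtr; last by apply: Rintegral_ge0 => x _; exact: sg0.
rewrite Rintegral_support; last first.
  move=> x Ox; rewrite big1// => i _.
  by rewrite [sol_grad i x](radial_grad_outside cQT KO)// expr0n.
have ig : mu.-integrable setT (EFin \o (fun x => \sum_(i < N) sol_grad i x ^+ 2)).
  have i2 i : mu.-integrable setT (EFin \o (fun x => sol_grad i x ^+ 2)).
    rewrite (_ : (fun x => _) = fun x => sol_grad i x * sol_grad i x).
      by apply: cbs_integrable; apply: cbsM => //; exact: (proj1 (gcbs i)).
    by apply/funext => x; rewrite expr2.
  have := @integrable_sum _ _ _ mu setT measurableT _ (index_enum 'I_N) xpredT (fun i => EFin \o (fun x => sol_grad i x ^+ 2)) (fun i _ => i2 i).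
  congr (integrable _ _ _); apply/funext => x /=.
  by rewrite sumEFin.
have := Rintegral_rV_affine x0 rho0 ig.
under eq_Rintegral do rewrite sum_sol_grad_sqr.
rewrite RintegralZl//; last exact: cbs_integrable profile_energy_cbs.
rewrite -/profile_energy => E.
have -> : \int[mu]_x (\sum_(i < N) sol_grad i x ^+ 2) =
   rho ^+ N * (c ^+ 2 / rho ^+ 2 * profile_energy).
  by rewrite E mulrA mulfV ?mul1r// expf_neq0// gt_eqF.
by ring.
Qed.

(** K stands for the nonlocal coefficient. The function solves the equation
- Delta u = (c / rho^2) (F^be - A F^al), and the hypotheses on K and a turn
the powers of F into powers of u = c F. *)
Lemma sol_weak (K a : R) : K * (c / rho ^+ 2) = c `^ be -> a = A * c `^ (be - al) ->
  forall phi h, in_H10 Omega phi h ->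
    K * \int[mu]_(x in Omega) (\sum_(i < N) sol_grad i x * h i x) =
    \int[mu]_(x in Omega) ((- a * sol x `^ al + sol x `^ be) * phi x).
Proof.
have [al0' albe' c0'] : [/\ 0 < al, al < be & 0 < c] by [].
have be0 : 0 < be by lra.
move=> KE aE phi h phih; have mO := open_measurable_rV oO.
pose S t := c * (nonlin al be A (F t) - N%:R * Q t).
have cS : continuous S.
  move=> t; apply: (cvgM (cvg_cst _)); apply: cvgB.
    have cA : (fun _ : R => A) @ t --> A by exact: cvg_cst.
    exact: (nonlin_cvg al0 albe cA (@cF t)).
  exact: (cvgM (cvg_cst _) (@cQ t)).
have nlE t : 0 <= t -> nonlin al be A (F t) = F t `^ be - A * F t `^ al.
  by move=> /F01 f01; rewrite /nonlin clamp_id.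
have S0 : S 0 = 0.
  by rewrite /S nlE// F0 !powR1 mulr1 NQ0 subrr mulr0.
have ST t : T <= t -> S t = 0.
  move=> Tt; rewrite /S nlE; last by rewrite (le_trans (ltW T0)).
  by rewrite FT// QT// !powR0 ?gt_eqF// !mulr0 !subr0 mulr0.
have dcQ (t : R) : 0 < t -> is_derive t 1 (fun t => c * Q t) (S t / (2 * t)).
  move=> t0; apply: (is_derive_eq (is_derive_mul (is_derive_cst c t (1 : R)) (dQ t0))).
  by rewrite /cst /= mulr0 addr0 /S nlE ?(ltW t0)// mulrA.
have W := radial_weak_laplacian oO k0 T0 ccQ cS S0 cQT ST dcQ KO phih.
have nls : cont_bounded_support (fun x => 2 * sol_k * (N%:R * (c * Q (sqrad x0 sol_k x)) + S (sqrad x0 sol_k x))).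
  apply: (@sqrad_cbs R N x0 sol_k T k0 T0).
    move=> x; have cQx := @continuous_comp_sqrad R N x0 sol_k _ ccQ x.
    have cSx := @continuous_comp_sqrad R N x0 sol_k S cS x.
    exact: (cvgM (cvg_cst _) (cvgD (cvgM (cvg_cst _) cQx) cSx)).
  by move=> x xT; rewrite cQT// ST// mulr0 addr0 mulr0.
rewrite W -RintegralZl//; last first.
  by apply: in_L2_integrableM => //; [exact: in_L2_cbs|case: phih => -[]].
apply: eq_Rintegral => x _; rewrite mulrA; congr (_ * _).
have s0 := @sqrad_ge0 R N x0 sol_k k0 x; have /andP[f0 _] := F01 s0.
rewrite /S nlE// /sol /radial !powRM ?(ltW c0')//.
set f := F _.
have cal : c `^ (be - al) * c `^ al = c `^ be.
  by rewrite -powRD ?subrK// (gt_eqF c0') implybT.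
rewrite [LHS](_ : _ = K * (c / rho ^+ 2) * (f `^ be - A * f `^ al)); last first.
  by rewrite /sol_k; field; rewrite gt_eqF.
rewrite KE aE -cal; ring.
Qed.

Lemma sol_Linfty : (Linfty_norm Omega sol <= c%:E)%E.
Proof.
rewrite /Linfty_norm unlock /=; case: ifPn => _; last by rewrite lee_fin ltW.
apply/ess_supP/aeW => x /=; rewrite /patch; case: ifPn => _.
  by rewrite /= lee_fin; have /andP[s0 sc] := sol_ge0_le x; rewrite ger0_norm.
by rewrite /= normr0 lee_fin ltW.
Qed.

Lemma partial_sol (i : 'I_N) (x : 'rV[R]_N) : partial i sol x = sol_grad i x.
Proof. by have [_ dE] := @is_derive_radial R N x0 sol_k _ _ dcF i x; exact: dE. Qed.

Lemma sol_in_C1 : in_C1 Omega sol.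
Proof.
split.
- by move=> x _ i; have [] := @is_derive_radial R N x0 sol_k _ _ dcF i x.
- exists sol => //; apply: continuous_subspaceT; exact: (proj1 sol_cbs).
- move=> i; exists (sol_grad i); last by move=> x _; rewrite partial_sol.
  apply: continuous_subspaceT; exact: (proj1 (radial_grad_cbs x0 k0 T0 ccQ cQT i)).
Qed.

Lemma sol_C1_norm (i : 'I_N) (t : R) : 0 < t -> t <= T ->
  ((c / rho * (Num.sqrt (2 * t) * Q t))%:E <= C1_norm Omega sol)%E.
Proof.
move=> t0 tT; pose x := x0 + (rho * Num.sqrt (2 * t)) *: e_ i.
have r0 : rho != 0 by rewrite gt_eqF.
have sx : sqrad x0 sol_k x = t.
  rewrite /sqrad sqdist_axis exprMn sqr_sqrtr ?mulr_ge0 ?(ltW t0)// /sol_k.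
  by field.
have Ox : Omega x by apply: KO; rewrite /= sx.
have sup0 (f : 'rV[R]_N -> R) : (`|f x|%:E <= ereal_sup [set `|f y|%:E | y in Omega])%E.
  by apply: ereal_sup_ubound; exists x.
have sup_ge0 (f : 'rV[R]_N -> R) : (0 <= ereal_sup [set `|f y|%:E | y in Omega])%E.
  by apply: le_trans (sup0 f); rewrite lee_fin.
rewrite /C1_norm (bigD1 i)//=.
apply: (@le_trans _ _ (ereal_sup [set `|partial i sol y|%:E | y in Omega])); last first.
  rewrite addeCA; apply: leeDl; apply: adde_ge0; first exact: sup_ge0.
  by apply: sume_ge0 => j _; exact: sup_ge0.
apply: le_trans (sup0 (partial i sol)); rewrite lee_fin partial_sol.
rewrite -normrN; apply: le_trans (ler_norm _).
rewrite /sol_grad /radial_grad sx /x !mxE !eqxx /= mulr1n mulr1.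
rewrite [x0 ord0 i + _]addrC addrK /sol_k le_eqVlt; apply/orP; left; apply/eqP.
by field.
Qed.

End scaled_profile.

(** * The amplitude and the family of solutions *)

Section amplitude.
Variables (R : realType) (N : nat) (D m be : R).
Hypotheses (D0 : 0 < D) (sig0 : 0 < 2 * m + 1 - be).
Local Notation sig := (2 * m + 1 - be).

(** The solution c of the scalar equation that the nonlocal coefficient imposes,
see [amplitude_eq]; D is the Dirichlet integral of the profile and m = (r - 2) / 2. *)
Definition amplitude (rho : R) : R :=
  D `^ (- m / sig) * rho `^ ((2 - (N%:R - 2) * m) / sig).

Lemma amplitude_gt0 rho : 0 < rho -> 0 < amplitude rho.
Proof. by move=> r0; rewrite mulr_gt0 ?powR_gt0. Qed.

Lemma amplitude_eq rho : 0 < rho -> let c := amplitude rho in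
  (c ^+ 2 * (rho ^+ N / rho ^+ 2) * D) `^ m * (c / rho ^+ 2) = c `^ be.
Proof.
move=> r0 c; have c0 : 0 < c := amplitude_gt0 r0.
have [rn cn Dn] : [/\ rho != 0, c != 0 & D != 0] by rewrite !gt_eqF.
have cs : c `^ sig = D `^ (- m) * rho `^ (2 - (N%:R - 2) * m).
  by rewrite powRM ?powR_ge0// -!powRrM !mulfVK// gt_eqF.
have E1 : rho ^+ N / rho ^+ 2 = rho `^ (N%:R - 2).
  by rewrite powRB ?rn ?implybT// (powR_mulrn N (ltW r0)) (powR_mulrn 2 (ltW r0)).
have E2 : (c ^+ 2) `^ m * c = c `^ sig * c `^ be.
  rewrite -powRD ?cn ?implybT// subrK -(powR_mulrn 2 (ltW c0)) -powRrM.
  by rewrite powRD ?cn ?implybT// powRr1// ltW.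
have E3 : rho `^ (2 - (N%:R - 2) * m) * rho `^ ((N%:R - 2) * m) = rho ^+ 2.
  by rewrite -powRD ?rn ?implybT// subrK (powR_mulrn 2 (ltW r0)).
have E4 : D `^ (- m) * D `^ m = 1 by rewrite -powRD ?Dn ?implybT// addNr powRr0.
have E5 : (c ^+ 2 * rho `^ (N%:R - 2) * D) `^ m =
    (c ^+ 2) `^ m * rho `^ ((N%:R - 2) * m) * D `^ m.
  rewrite [in RHS]powRrM -powRM ?sqr_ge0 ?powR_ge0// -powRM ?(ltW D0)//.
  by rewrite mulr_ge0 ?sqr_ge0 ?powR_ge0.
rewrite E1 E5.
rewrite [LHS](_ : _ = (c ^+ 2) `^ m * c * (rho `^ ((N%:R - 2) * m) * D `^ m / rho ^+ 2)); last ring.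
rewrite E2 cs.
rewrite [LHS](_ : _ = (D `^ (- m) * D `^ m) *
  (rho `^ (2 - (N%:R - 2) * m) * rho `^ ((N%:R - 2) * m)) / rho ^+ 2 * c `^ be); last ring.
by rewrite E3 E4 mul1r mulfV ?mul1r// expf_neq0.
Qed.

(** The amplitude is a constant times a power of rho with exponent less than 1, so
its quotient by rho is a negative power of rho. *)
Lemma amplitude_unbounded (b rho1 C : R) : 2 - (N%:R - 2) * m < sig -> 0 < b -> 0 < rho1 ->
  exists rho, [/\ 0 < rho, rho <= rho1 & C < amplitude rho / rho * b].
Proof.
move=> gs b0 r10; set g := (2 - (N%:R - 2) * m) / sig.
have d0 : 0 < 1 - g by rewrite subr_gt0 ltr_pdivrMr// mul1r.
have C1 : 0 < `|C| + 1 by have := normr_ge0 C; lra.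
set kap := D `^ (- m / sig); have kap0 : 0 < kap by exact: powR_gt0.
pose Y := kap * b / (`|C| + 1); have Y0 : 0 < Y by rewrite divr_gt0// mulr_gt0.
pose rho := Num.min rho1 (Y `^ (1 - g)^-1).
have r0 : 0 < rho by rewrite lt_min r10 powR_gt0.
exists rho; split => //; first by rewrite ge_min lexx.
have rY : rho `^ (1 - g) <= Y.
  rewrite [leRHS](_ : _ = (Y `^ (1 - g)^-1) `^ (1 - g)); last first.
    by rewrite -powRrM mulVf ?gt_eqF// powRr1// ltW.
  apply: ge0_ler_powR; rewrite ?nnegrE ?(ltW d0) ?(ltW r0) ?powR_ge0//.
  by rewrite ge_min lexx orbT.
have E : amplitude rho / rho = kap / rho `^ (1 - g).
  rewrite /amplitude -/kap -/g -mulrA; congr (_ * _).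
  by rewrite -powRN opprB powRB ?(gt_eqF r0) ?implybT// (powRr1 (ltW r0)).
rewrite E; apply: (@lt_le_trans _ _ (`|C| + 1)); first by have := ler_norm C; lra.
rewrite mulrAC ler_pdivlMr ?powR_gt0// mulrC.
by rewrite -ler_pdivlMr.
Qed.

End amplitude.

Section family.
Variables (R : realType) (N : nat) (Omega : set 'rV[R]_N) (r : R) (M : R -> R).
Hypotheses (hN : (3 <= N)%N) (oO : open Omega) (O0 : Omega !=set0).
Hypothesis hM : forall s : R, 0 <= s -> M (s ^+ 2) = s `^ (r - 2).
Variables q p : R.
Hypotheses (q1 : 1 < q) (qp : q < p) (p2 : p < 2).
Local Notation m := ((r - 2) / 2).
Hypothesis m0 : 0 < m.

(** The supports shrink to the point x0 of the open set Omega as rho tends to 0. The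
constant b is the slope of the profile at a radius where Q is positive. *)
Lemma solution_family : exists A D b rho1 : R,
  [/\ 0 < A < 1, 0 < D, 0 < b, 0 < rho1 & forall rho, 0 < rho -> rho <= rho1 ->
    let c := amplitude N D m (p - 1) rho in exists u : 'rV[R]_N -> R,
    [/\ solves_P Omega M (A * c `^ ((p - 1) - (q - 1))) q p u,
        (Linfty_norm Omega u <= c%:E)%E,
        in_C1 Omega u &
        ((c / rho * b)%:E <= C1_norm Omega u)%E]].
Proof.
have [m0' q1' qp' p2'] : [/\ 0 < m, 1 < q, q < p & p < 2] by [].
have al0 : 0 < q - 1 by lra.
have albe : q - 1 < p - 1 by lra.
have be1 : p - 1 < 1 by lra.
have sig0 : 0 < 2 * m + 1 - (p - 1) by lra.
have [A [T [F [Q [A01 T0 [F0 F01 FT QT] [cQ NQ0] [dF dQ]]]]]] :=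
  compact_profile (ltnW hN) al0 albe be1.
have N0 : 0 < N%:R :> R by rewrite ltr0n (leq_trans _ hN).
have Q0 : 0 < Q 0.
  by rewrite -(pmulr_rgt0 _ N0) NQ0 subr_gt0; have /andP[] := A01.
have [t [t0 tT Qt]] : exists t : R, [/\ 0 < t, t <= T & 0 < Q t].
  have [e /= e0 He] := (nbhs_ballP _ _).1 (cvgr_gt (Q 0) (@cQ 0) _ Q0).
  exists (Num.min (e / 2) T).
  have t0 : 0 < Num.min (e / 2) T by rewrite lt_min T0 divr_gt0.
  split => //; first by rewrite ge_min lexx orbT.
  apply: He; rewrite /ball /= sub0r normrN gtr0_norm//.
  by apply: (@le_lt_trans _ _ (e / 2)); [rewrite ge_min lexx|lra].
pose i : 'I_N := Ordinal (leq_trans (isT : (0 < 3)%N) hN).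
pose D := profile_energy N Q.
have D0 : 0 < D by exact: (profile_energy_gt0 T0 QT cQ i t0 Qt).
have [x0 Ox0] := O0.
have [e /= e0 He] := (nbhs_ballP _ _).1 (open_nbhs_nbhs (conj oO Ox0)).
have T1 : 0 < 2 * T + 1 by lra.
exists A, D, (Num.sqrt (2 * t) * Q t), (e / (2 * T + 1)); split => //.
- by rewrite mulr_gt0// sqrtr_gt0 mulr_gt0.
- by rewrite divr_gt0.
move=> rho rho0 rho1; set c := amplitude N D m (p - 1) rho.
have c0 : 0 < c by exact: amplitude_gt0.
have KO : [set x | sqrad x0 (sol_k rho) x <= T] `<=` Omega.
  have k0 : 0 < sol_k rho by rewrite invr_gt0 mulr_gt0// exprn_gt0.
  move=> x /= xT; apply: He; rewrite rV_ballE// => j; rewrite distrC.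
  have := le_trans (sqrad_coord_le x0 k0 j x) xT.
  rewrite /sol_k mulrC ler_pdivrMr ?mulr_gt0 ?exprn_gt0//.
  rewrite -real_normK ?num_real//; move: rho1; rewrite ler_pdivlMr//.
  have := normr_ge0 (x ord0 j - x0 ord0 j); move: (`|_|) => z z0 h1 h2.
  rewrite ltNge; apply/negP => ez.
  have h3 : (rho * (2 * T + 1)) * (rho * (2 * T + 1)) <= z * z.
    have h0 : 0 <= rho * (2 * T + 1) by rewrite mulr_ge0 ?(ltW rho0) ?(ltW T1).
    have h1' := le_trans h1 ez; exact: ler_pM.
  have h4 : 0 < rho * rho by rewrite mulr_gt0.
  have h5 : 0 < rho * rho * (T * T) by rewrite !mulr_gt0.
  have h6 : 0 < rho * rho * T by rewrite !mulr_gt0.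
  by rewrite !expr2 in h2; nra.
exists (sol F x0 rho c); split.
- split.
  + by apply: aeW => x _; have /andP[] := sol_ge0_le F01 x0 rho0 c0 x.
  + exact: (sol_not_ae0 T0 F0 F01 FT dF rho0 c0 KO).
  + exists (sol_grad Q x0 rho c).
      exact: (sol_in_H10 oO T0 FT QT cQ dF c rho0 KO).
    apply: (sol_weak oO al0 albe T0 F0 F01 FT QT cQ NQ0 dF dQ rho0 c0 KO) => //.
    rewrite hM ?sqrtr_ge0//.
    have -> : r - 2 = 2%:R * m by field.
    rewrite powRrM powR_mulrn ?sqrtr_ge0//.
    rewrite (sol_W_norm T0 QT cQ c rho0 KO).
    exact: amplitude_eq.
- exact: (sol_Linfty Omega F01 x0 rho0 c0).
- exact: (sol_in_C1 Omega T0 FT QT cQ dF x0 c rho0).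
- exact: (sol_C1_norm dF c rho0 KO i t0 tT).
Qed.

End family.

Theorem proposition6p1 (R : realType) (N : nat) (Omega : set 'rV[R]_N)
    (r : R) (M : R -> R)
    (hN : (3 <= N)%N) (hOmega : bounded_smooth_domain Omega)
    (hM : forall s : R, 0 <= s -> M (s ^+ 2) = s `^ (r - 2)) :
  (2 + 2 / N%:R < r -> r < sobolev_exponent R N ->
   exists q p : R, [/\ 1 < q, q < p, p < 2 &
     exists F : set ('rV[R]_N -> R),
       [/\ forall u, F u ->
             exists a : R, [/\ 0 < a, a <= 1 & solves_P Omega M a q p u],
           bounded_in_Linfty Omega F &
           unbounded_in_C1 Omega F]]) /\
  (r = sobolev_exponent R N ->
   exists q p : R, [/\ 1 < q, q < p, p < 2 &
     exists a : R, 0 < a /\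
     exists F : set ('rV[R]_N -> R),
       [/\ forall u, F u -> solves_P Omega M a q p u,
           bounded_in_Linfty Omega F &
           unbounded_in_C1 Omega F]]).
Proof.
have N3 : 3 <= N%:R :> R by rewrite (ler_nat R 3).
have [oO _ O0 _ _] := hOmega.
pose m := (r - 2) / 2.
have mE : m = (r - 2) / 2 by [].
have [n nE] : exists n : R, n = N%:R by exists N%:R.
rewrite -nE in N3.
rewrite /sobolev_exponent -nE; split.
- move=> r1 r2.
  have nr : 2 < (r - 2) * n.
    by rewrite -ltr_pdivrMr; lra.
  have nr2 : (n - 2) * m < 2.
    have n2 : 0 < n - 2 by lra.
    move: r2; rewrite ltr_pdivlMr// mE; lra.
  have m0 : 0 < m by rewrite mE; nra.
  have mn1 : 1 < m * n by rewrite mE; lra.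
  (* p < m n is the condition for c / rho to be unbounded *)
  have [p [p1 p2 pn]] : exists p : R, [/\ 1 < p, p < 2 & p < m * n].
    exists ((1 + Num.min 2 (m * n)) / 2); have [h|h] := leP 2 (m * n); split; lra.
  pose q := (1 + p) / 2.
  have q1 : 1 < q by rewrite /q; lra.
  have qp : q < p by rewrite /q; lra.
  exists q, p; split => //.
  have sig0 : 0 < 2 * m + 1 - (p - 1) by lra.
  have gs : 2 - (N%:R - 2) * m < 2 * m + 1 - (p - 1) by rewrite -nE; lra.
  have [A [D [b [rho1 [/andP[A0 A1] D0 b0 rho10 H]]]]] := solution_family hN oO O0 hM q1 qp p2 m0.
  pose c := amplitude N D m (p - 1).
  (* below rho2 the amplitude is at most 1 *)
  pose rho2 := Num.min rho1 ((D `^ m) `^ (2 - (N%:R - 2) * m)^-1).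
  have rho20 : 0 < rho2 by rewrite lt_min rho10 powR_gt0 ?powR_gt0.
  have g0 : 0 < 2 - (N%:R - 2) * m by rewrite -nE; lra.
  have c1 rho : 0 < rho -> rho <= rho2 -> c rho <= 1.
    move=> r0 rr; rewrite /c /amplitude [D `^ _]powRrM [rho `^ _]powRrM -powRM ?powR_ge0//.
    rewrite [leRHS](_ : _ = 1 `^ (2 * m + 1 - (p - 1))^-1); last by rewrite powR1.
    apply: ge0_ler_powR; rewrite ?nnegrE ?invr_ge0 ?(ltW sig0) ?mulr_ge0 ?powR_ge0//.
    rewrite powRN mulrC ler_pdivrMr ?powR_gt0// mul1r.
    rewrite [leRHS](_ : _ = ((D `^ m) `^ (2 - (N%:R - 2) * m)^-1) `^ (2 - (N%:R - 2) * m)); last first.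
      by rewrite -[RHS]powRrM mulVf ?gt_eqF// powRr1// powR_ge0.
    apply: ge0_ler_powR; rewrite ?nnegrE ?(ltW g0) ?(ltW r0) ?powR_ge0//.
    by apply: le_trans rr _; rewrite ge_min lexx orbT.
  exists [set u | exists2 rho, 0 < rho <= rho2 &
    [/\ solves_P Omega M (A * c rho `^ ((p - 1) - (q - 1))) q p u,
        (Linfty_norm Omega u <= (c rho)%:E)%E & in_C1 Omega u]].
  split.
  + move=> u [rho /andP[r0 rr] [su _ _]]; exists (A * c rho `^ ((p - 1) - (q - 1))).
    have c0 : 0 < c rho by exact: amplitude_gt0.
    split => //; first by rewrite mulr_gt0// powR_gt0.
    rewrite -[leRHS]mulr1; apply: ler_pM; rewrite ?powR_ge0 ?(ltW A0) ?(ltW A1)//.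
    rewrite [leRHS](_ : _ = 1 `^ ((p - 1) - (q - 1))); last by rewrite powR1.
    apply: ge0_ler_powR; rewrite ?nnegrE ?(ltW c0) ?c1//; lra.
  + exists 1 => u [rho /andP[r0 rr] [_ ul _]]; apply: le_trans ul _.
    by rewrite lee_fin c1.
  + split=> [u [rho _ [_ _]]//|C].
    have [rho [r0 rr Cr]] := @amplitude_unbounded R N D m (p - 1) D0 sig0 b rho2 C gs b0 rho20.
    have rr1 : rho <= rho1 by apply: le_trans rr _; rewrite ge_min lexx.
    have [u [u1 u2 u3 u4]] := H rho r0 rr1.
    exists u; first by exists rho; rewrite ?r0.
    by apply: lt_le_trans u4; rewrite lte_fin.
- move=> rE.
  (* the exponent of rho in the amplitude is 0, so that c and a do not depend on rho *)
  have n2 : 0 < n - 2 by lra.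
  have nm : (n - 2) * m = 2.
    by rewrite mE rE; field; rewrite gt_eqF.
  have m0 : 0 < m by rewrite -(pmulr_rgt0 _ n2) nm.
  have q1 : 1 < 5 / 4 :> R by lra.
  have qp : 5 / 4 < 3 / 2 :> R by lra.
  have p2 : 3 / 2 < 2 :> R by lra.
  exists (5 / 4), (3 / 2); split => //.
  have sig0 : 0 < 2 * m + 1 - (3 / 2 - 1) by lra.
  have g0 : 2 - (N%:R - 2) * m = 0 by rewrite -nE nm subrr.
  have gs : 2 - (N%:R - 2) * m < 2 * m + 1 - (3 / 2 - 1) by rewrite g0.
  have [A [D [b [rho1 [/andP[A0 A1] D0 b0 rho10 H]]]]] := solution_family hN oO O0 hM q1 qp p2 m0.
  pose c := D `^ (- m / (2 * m + 1 - (3 / 2 - 1))).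
  have cE rho : amplitude N D m (3 / 2 - 1) rho = c.
    by rewrite /amplitude g0 mul0r powRr0 mulr1.
  exists (A * c `^ ((3 / 2 - 1) - (5 / 4 - 1))).
  split; first by rewrite mulr_gt0// powR_gt0// powR_gt0.
  exists [set u | [/\ solves_P Omega M (A * c `^ ((3 / 2 - 1) - (5 / 4 - 1))) (5 / 4) (3 / 2) u,
        (Linfty_norm Omega u <= c%:E)%E & in_C1 Omega u]].
  split; [by move=> u []|by exists c => u []|split=> [u []//|C]].
  have [rho [r0 rr Cr]] := @amplitude_unbounded R N D m (3 / 2 - 1) D0 sig0 b rho1 C gs b0 rho10.
  have [u] := H rho r0 rr; rewrite cE => -[u1 u2 u3 u4].
  by exists u => //; apply: lt_le_trans u4; rewrite lte_fin -(cE rho).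
Qed.
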